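(* The layer-averaged version of the hydrostatic Navier-Stokes system with free surface (stated in the context with its boundary conditions) is given by $$\sum_{\alpha=1}^N\frac{\partial h_\alpha}{\partial t}+\sum_{\alpha=1}^N\nabla_{x,y}\cdot(h_\alpha{\bf u}_\alpha)=0,$$ and, for $\alpha=1,\dots,N$, $$\begin{aligned}\frac{\partial (h_\alpha{\bf u}_\alpha)}{\partial t}&+\nabla_{x,y}\cdot(h_\alpha{\bf u}_\alpha\otimes{\bf u}_\alpha)+\nabla_{x,y}\Bigl(\frac g2hh_\alpha\Bigr)=-gh_\alpha\nabla_{x,y}z_b+{\bf u}_{\alpha+1/2}G_{\alpha+1/2}-{\bf u}_{\alpha-1/2}G_{\alpha-1/2}\\&+\nabla_{x,y}\cdot(h_\alpha{\bf\Sigma}_\alpha)-{\bf\Sigma}_{\alpha+1/2}\nabla_{x,y}z_{\alpha+1/2}+{\bf\Sigma}_{\alpha-1/2}\nabla_{x,y}z_{\alpha-1/2}\\&+2\nu_{\alpha+1/2}\frac{{\bf u}_{\alpha+1}-{\bf u}_\alpha}{h_{\alpha+1}+h_\alpha}-2\nu_{\alpha-1/2}\frac{{\bf u}_\alpha-{\bf u}_{\alpha-1}}{h_\alpha+h_{\alpha-1}}-\kappa_\alpha{\bf u}_\alpha+W_\alpha{\bf t}_s,\end{aligned}$$ with $${\bf\Sigma}_{\alpha+1/2}=\begin{pmatrix}\Sigma_{xx,\alpha+1/2}&\Sigma_{xy,\alpha+1/2}\\ \Sigma_{yx,\alpha+1/2}&\Sigma_{yy,\alpha+1/2}\end{pmatrix},$$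 $$\Sigma_{xx,\alpha+1/2}=\frac{\nu_{\alpha+1/2}}{h_{\alpha+1}+h_\alpha}\Bigl(h_\alpha\frac{\partial u_\alpha}{\partial x}+h_{\alpha+1}\frac{\partial u_{\alpha+1}}{\partial x}\Bigr)-2\nu_{\alpha+1/2}\frac{\partial z_{\alpha+1/2}}{\partial x}\,\frac{u_{\alpha+1}-u_\alpha}{h_{\alpha+1}+h_\alpha},$$ $$\Sigma_{xy,\alpha+1/2}=\frac{\nu_{\alpha+1/2}}{h_{\alpha+1}+h_\alpha}\Bigl(h_\alpha\frac{\partial u_\alpha}{\partial y}+h_{\alpha+1}\frac{\partial u_{\alpha+1}}{\partial y}\Bigr)-2\nu_{\alpha+1/2}\frac{\partial z_{\alpha+1/2}}{\partial y}\,\frac{u_{\alpha+1}-u_\alpha}{h_{\alpha+1}+h_\alpha},$$ ($\Sigma_{yx,\alpha+1/2}$ and $\Sigma_{yy,\alpha+1/2}$ being given by the same two formulas with $v$ in place of $u$), $${\bf\Sigma}_\alpha=\begin{pmatrix}\Sigma_{xx,\alpha}&\Sigma_{xy,\alpha}\\ \Sigma_{yx,\alpha}&\Sigma_{yy,\alpha}\end{pmatrix}=\frac{{\bf\Sigma}_{\alpha+1/2}+{\bf\Sigma}_{\alpha-1/2}}{2},$$ and $\kappa_\alpha=\kappa$ if $\alpha=1$, $\kappa_\alpha=0$ if $\alpha\ne1$; $\nu_{\alpha+1/2}=0$ if $\alpha=0,N$, $\nu_{\alpha+1/2}=\nu$ if $\alpha=1,\dots,N-1$; $W_\alpha=W$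 if $\alpha=N$, $W_\alpha=0$ if $\alpha\ne N$. The vertical velocities $\{w_\alpha\}_{\alpha=1}^N$ are defined by $w_\alpha=k_\alpha-z_\alpha\nabla_{x,y}\cdot{\bf u}_\alpha$ with $k_1=\nabla_{x,y}\cdot(z_b{\bf u}_1)$ and $k_{\alpha+1}=k_\alpha+\nabla_{x,y}\cdot\bigl(z_{\alpha+1/2}({\bf u}_{\alpha+1}-{\bf u}_\alpha)\bigr)$. For smooth solutions, this system admits the energy balance $$\begin{aligned}\frac{\partial}{\partial t}\sum_{\alpha=1}^NE_\alpha&+\nabla_{x,y}\cdot\sum_{\alpha=1}^N{\bf u}_\alpha\Bigl(E_\alpha+\frac g2h_\alpha h-h_\alpha{\bf\Sigma}_\alpha\Bigr)=-\sum_{\alpha=1}^{N-1}\frac{|{\bf u}_{\alpha+1/2}-{\bf u}_\alpha|^2}{2}|G_{\alpha+1/2}|\\&-\sum_{\alpha=1}^{N-1}\frac{h_{\alpha+1}+h_\alpha}{2\nu}{\bf\Sigma}_{\alpha+1/2}^2-\sum_{\alpha=1}^{N-1}2\nu\frac{|{\bf u}_{\alpha+1}-{\bf u}_\alpha|^2}{h_{\alpha+1}+h_\alpha}-\kappa|{\bf u}_1|^2+W{\bf u}_N\cdot{\bf t}_s,\end{aligned}$$ where $E_\alpha=\frac{h_\alpha|{\bf u}_\alpha|^2}{2}+\frac g2h_\alpha h+gh_\alpha z_b$, ${\bf\Sigma}_{\alpha+1/2}^2=\sum_{i,j}\Sigma_{i,j,\alpha+1/2}^2$, and ${\bf u}_\alpha{\bf\Sigma}_\alpha=\begin{pmatrix}u_\alpha\Sigma_{xx,\alpha}+v_\alpha\Sigma_{yx,\alpha}\\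 u_\alpha\Sigma_{xy,\alpha}+v_\alpha\Sigma_{yy,\alpha}\end{pmatrix}$. This relation is consistent with a layer-averaged discretization of the energy balance of the continuous system, $$\frac{\partial}{\partial t}\int_{z_b}^\eta E\,dz+\nabla_{x,y}\cdot\int_{z_b}^\eta\Bigl({\bf u}\bigl(E+g(\eta-z)\bigr)-\nu\nabla_{x,y}\frac{|{\bf u}|^2}{2}\Bigr)dz=-\nu\int_{z_b}^\eta|\nabla_{x,y}{\bf u}|^2dz-\kappa\,{\bf u}|_b^2,\qquad E=\frac{|{\bf u}|^2}{2}+gz.$$
   Context: Continuous system. $z_b(x,y)$ is the bottom topography, $h(t,x,y)$ the water depth, $\eta=h+z_b$, $g$ gravity, $\rho_0$ the fluid density, $\mu$ the viscosity coefficient, $\nu=\mu/\rho_0$, $p$ the pressure; ${\bf U}=(u,v,w)^T$, ${\bf u}=(u,v)^T$, $\nabla=(\partial_x,\partial_y,\partial_z)^T$, $\nabla_{x,y}=(\partial_x,\partial_y)^T$. For $z_b\le z\le\eta$: $\nabla\cdot{\bf U}=0$; $\partial_t{\bf u}+\nabla_{x,y}\cdot({\bf u}\otimes{\bf u})+\partial_z({\bf u}w)=\frac1{\rho_0}\nabla_{x,y}\cdot\sigma+\frac\mu{\rho_0}\partial_z^2{\bf u}$; $\partial_zp=-\rho_0g$; with $\sigma=-pI_d+\mu\nabla_{x,y}{\bf u}$. Let ${\bf n}_b$, ${\bf n}_s$ be the unit outward normals at the bottom and the free surface. Boundary conditions: ${\bf U}\cdot{\bf n}_b=0$ and $\nu\sqrt{1+|\nabla_{x,y}z_b|^2}\,\partial{\bf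 u}/\partial{\bf n}_b=-\kappa{\bf u}$ at the bottom ($\kappa$ a Navier friction coefficient); $\partial_t\eta+{\bf u}\cdot\nabla_{x,y}\eta-w=0$ and $\nu\,\partial\tilde{\bf u}/\partial{\bf n}_s-p{\bf n}_s=-p^a{\bf n}_s+W{\bf t}_s$ at the free surface, with $\tilde{\bf u}=({\bf u},0)^T$, atmospheric pressure $p^a=0$, $W(t,x,y)$ a given wind term and ${\bf t}_s$ a given unit horizontal vector. ${\bf u}|_b$ is the velocity at the bottom. Layers. $l_1,\dots,l_N$ are constants with $\sum_\alpha l_\alpha=1$; $h_\alpha=l_\alpha h$; $z_{\alpha+1/2}=z_b+\sum_{j=1}^\alpha h_j$ for $\alpha=0,\dots,N$; $z_\alpha=(z_{\alpha-1/2}+z_{\alpha+1/2})/2$; layer $\alpha$ is $z_{\alpha-1/2}\le z\le z_{\alpha+1/2}$. Layer-averaging: the velocity components are approximated by functions piecewise constant in $z$ on the layers, with values $u_\alpha,v_\alpha,w_\alpha$ depending on $(t,x,y)$, ${\bf u}_\alpha=(u_\alpha,v_\alpha)^T$, and the equations are integrated in $z$ over each layer. Exchange terms: $G_{\alpha+1/2}=\sum_{j=1}^\alpha(\partial_th_j+\nabla_{x,y}\cdot(h_j{\bf u}_j))=-\sum_{j=1}^N\bigl(\sum_{p=1}^\alpha l_p-{\bf 1}_{j\le\alpha}\bigr)\nabla_{x,y}\cdot(h_j{\bf u}_j)$, with ${\bf 1}_{j\le\alpha}=1$ if $j\le\alpha$, $0$ otherwise, and $G_{1/2}=G_{N+1/2}=0$.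 Interface velocities: ${\bf u}_{\alpha+1/2}={\bf u}_\alpha$ if $G_{\alpha+1/2}\le0$, ${\bf u}_{\alpha+1/2}={\bf u}_{\alpha+1}$ if $G_{\alpha+1/2}>0$. Terms multiplied by $\nu_{1/2}=\nu_{N+1/2}=0$ vanish. For a $2\times2$ tensor $T$, $\nabla_{x,y}\cdot T=(\partial_xT_{xx}+\partial_yT_{xy},\ \partial_xT_{yx}+\partial_yT_{yy})^T$.
   Formalization: Exchange dissipation uses |u_{α+1}−u_α|² (printed term is 0 when G<0); the continuous energy balance adds the missing −ν∫|∂_z u|² and wind work with factor √(1+|∇η|²); that factor is taken as 1 in averaging the surface condition to get W t_s. *)

(* Defs.v *)
From Stdlib Require Import Reals Arith.
From Coquelicot Require Import Coquelicot.
Open Scope R_scope.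

(* Functions of (t, x, y) and of (t, x, y, z). *)
Definition hfield := R -> R -> R -> R.
Definition vfield := R -> R -> R -> R -> R.

Definition dt (f : hfield) : hfield := fun t x y => Derive (fun s => f s x y) t.
Definition dx (f : hfield) : hfield := fun t x y => Derive (fun s => f t s y) x.
Definition dy (f : hfield) : hfield := fun t x y => Derive (fun s => f t x s) y.

Definition Dt (f : vfield) : vfield := fun t x y z => Derive (fun s => f s x y z) t.
Definition Dx (f : vfield) : vfield := fun t x y z => Derive (fun s => f t s y z) x.
Definition Dy (f : vfield) : vfield := fun t x y z => Derive (fun s => f t x s z) y.
Definition Dz (f : vfield) : vfield := fun t x y z => Derive (fun s => f t x y s) z.

Definition hmul (f g : hfield) : hfield := fun t x y => f t x y * g t x y.
Definition vmul (f g : vfield) : vfield := fun t x y z => f t x y z * g t x y z.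

(* Horizontal divergence of (f, g)^T. *)
Definition hdiv (f g : hfield) : hfield := fun t x y => dx f t x y + dy g t x y.

(* C^k on a set D, meant for D open: all partial derivatives up to order k
   exist at the points of D and are jointly continuous there. *)
Fixpoint hCk (k : nat) (D : R * R * R -> Prop) (f : hfield) : Prop :=
  (forall t x y, D (t, x, y) ->
     continuous (fun q : R * R * R => f (fst (fst q)) (snd (fst q)) (snd q)) (t, x, y)) /\
  match k with
  | O => True
  | S k' =>
      (forall t x y, D (t, x, y) ->
         ex_derive (fun s => f s x y) t /\
         ex_derive (fun s => f t s y) x /\
         ex_derive (fun s => f t x s) y) /\
      hCk k' D (dt f) /\ hCk k' D (dx f) /\ hCk k' D (dy f)
  end.

Fixpoint vCk (k : nat) (D : R * R * R * R -> Prop) (f : vfield) : Prop :=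
  (forall t x y z, D (t, x, y, z) ->
     continuous (fun q : R * R * R * R =>
       f (fst (fst (fst q))) (snd (fst (fst q))) (snd (fst q)) (snd q)) (t, x, y, z)) /\
  match k with
  | O => True
  | S k' =>
      (forall t x y z, D (t, x, y, z) ->
         ex_derive (fun s => f s x y z) t /\
         ex_derive (fun s => f t s y z) x /\
         ex_derive (fun s => f t x s z) y /\
         ex_derive (fun s => f t x y s) z) /\
      vCk k' D (Dt f) /\ vCk k' D (Dx f) /\ vCk k' D (Dy f) /\ vCk k' D (Dz f)
  end.

Definition hsmooth (D : R * R * R -> Prop) (f : hfield) : Prop := forall k, hCk k D f.
Definition vsmooth (D : R * R * R * R -> Prop) (f : vfield) : Prop := forall k, vCk k D f.

Record params := {
  grav : R;
  rho0 : R;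
  mu : R;
  kappa : R;
  zb : R -> R -> R;
  wind : hfield;
  tsx : hfield;
  tsy : hfield
}.

Definition nu (P : params) : R := mu P / rho0 P.
Definition patm : R := 0.
Definition bottom (P : params) : hfield := fun _ x y => zb P x y.
Definition eta (P : params) (h : hfield) : hfield := fun t x y => h t x y + zb P x y.

(* [Omega] is the set of (t, x, y) on which the flow is considered. *)
Definition fluid (P : params) (Omega : R * R * R -> Prop) (h : hfield) (t x y z : R) : Prop :=
  Omega (t, x, y) /\ zb P x y <= z <= eta P h t x y.

Definition valid_params (P : params) (Omega : R * R * R -> Prop) : Prop :=
  0 < rho0 P /\ 0 < mu P /\ hsmooth Omega (bottom P) /\
  (forall t x y, Omega (t, x, y) -> tsx P t x y ^ 2 + tsy P t x y ^ 2 = 1).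

(** * Continuous system *)

(* Length of (-d_x f, -d_y f, 1), not normalised. *)
Definition metric (f : hfield) : hfield :=
  fun t x y => sqrt (1 + (dx f t x y ^ 2 + dy f t x y ^ 2)).

(* Derivative of f at the point (t, x, y, z) along (a, b, c). *)
Definition dir_deriv (f : vfield) (a b c : R) : vfield :=
  fun t x y z => Dx f t x y z * a + Dy f t x y z * b + Dz f t x y z * c.

(* Outward unit normals. *)
Definition nbx P : hfield := fun t x y => dx (bottom P) t x y / metric (bottom P) t x y.
Definition nby P : hfield := fun t x y => dy (bottom P) t x y / metric (bottom P) t x y.
Definition nbz P : hfield := fun t x y => - 1 / metric (bottom P) t x y.
Definition nsx P h : hfield := fun t x y => - dx (eta P h) t x y / metric (eta P h) t x y.
Definition nsy P h : hfield := fun t x y => - dy (eta P h) t x y / metric (eta P h) t x y.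
Definition nsz P h : hfield := fun t x y => 1 / metric (eta P h) t x y.

(* Momentum equation for one horizontal component f of the velocity;
   (sx, sy) is the corresponding row of sigma. *)
Definition momentum_eq P (u v w f sx sy : vfield) (t x y z : R) : Prop :=
  Dt f t x y z + (Dx (vmul f u) t x y z + Dy (vmul f v) t x y z) + Dz (vmul f w) t x y z
  = 1 / rho0 P * (Dx sx t x y z + Dy sy t x y z) + mu P / rho0 P * Dz (Dz f) t x y z.

Record hydrostatic_NS (P : params) (Omega : R * R * R -> Prop) (h : hfield)
    (u v w p : vfield) : Prop := {
  NS_incompressible : forall t x y z, fluid P Omega h t x y z ->
    Dx u t x y z + Dy v t x y z + Dz w t x y z = 0;
  NS_momentum_x : forall t x y z, fluid P Omega h t x y z ->
    momentum_eq P u v w u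
      (fun t x y z => - p t x y z + mu P * Dx u t x y z)
      (fun t x y z => mu P * Dy u t x y z) t x y z;
  NS_momentum_y : forall t x y z, fluid P Omega h t x y z ->
    momentum_eq P u v w v
      (fun t x y z => mu P * Dx v t x y z)
      (fun t x y z => - p t x y z + mu P * Dy v t x y z) t x y z;
  NS_hydrostatic : forall t x y z, fluid P Omega h t x y z ->
    Dz p t x y z = - rho0 P * grav P;
  NS_no_penetration : forall t x y, Omega (t, x, y) ->
    let z := zb P x y in
    u t x y z * nbx P t x y + v t x y z * nby P t x y + w t x y z * nbz P t x y = 0;
  NS_friction : forall t x y, Omega (t, x, y) ->
    let z := zb P x y in
    nu P * metric (bottom P) t x y
      * dir_deriv u (nbx P t x y) (nby P t x y) (nbz P t x y) t x y z
      = - kappa P * u t x y z /\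
    nu P * metric (bottom P) t x y
      * dir_deriv v (nbx P t x y) (nby P t x y) (nbz P t x y) t x y z
      = - kappa P * v t x y z;
  NS_kinematic : forall t x y, Omega (t, x, y) ->
    let z := eta P h t x y in
    dt (eta P h) t x y + u t x y z * dx (eta P h) t x y + v t x y z * dy (eta P h) t x y
      - w t x y z = 0;
  (* the three components of the dynamic condition *)
  NS_dynamic : forall t x y, Omega (t, x, y) ->
    let z := eta P h t x y in
    nu P * dir_deriv u (nsx P h t x y) (nsy P h t x y) (nsz P h t x y) t x y z
      - p t x y z * nsx P h t x y
      = - patm * nsx P h t x y + wind P t x y * tsx P t x y /\
    nu P * dir_deriv v (nsx P h t x y) (nsy P h t x y) (nsz P h t x y) t x y z
      - p t x y z * nsy P h t x y
      = - patm * nsy P h t x y + wind P t x y * tsy P t x y /\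
    - p t x y z * nsz P h t x y = - patm * nsz P h t x y
}.

(* Smoothness up to the bottom and the free surface. *)
Definition smooth_flow P Omega h (u v w p : vfield) : Prop :=
  exists O : R * R * R * R -> Prop,
    open O /\
    (forall t x y z, fluid P Omega h t x y z -> O (t, x, y, z)) /\
    vsmooth O u /\ vsmooth O v /\ vsmooth O w /\ vsmooth O p.

(** * Layers *)

Record layering := { nlay : nat; frac : nat -> R }.

Definition valid_layering (L : layering) : Prop :=
  (1 <= nlay L)%nat /\
  (forall a, (1 <= a <= nlay L)%nat -> 0 < frac L a) /\
  sum_n_m (frac L) 1 (nlay L) = 1.

Definition hl (L : layering) (h : hfield) (a : nat) : hfield :=
  fun t x y => frac L a * h t x y.

(* [zi a] is the interface z_{a+1/2}; more generally an interface quantity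
   X_{a+1/2} has index a. *)
Definition zi P L h (a : nat) : hfield :=
  fun t x y => zb P x y + sum_n_m (fun j => hl L h j t x y) 1 a.

Definition zc P L h (a : nat) : hfield :=
  fun t x y => (zi P L h (a - 1) t x y + zi P L h a t x y) / 2.

(* The function piecewise constant in z with value f a in layer a. It is
   right-continuous in z, and extended by f N above the surface and by 0
   below the bottom. *)
Fixpoint pw_upto P L h (f : nat -> hfield) (n : nat) : vfield :=
  fun t x y z =>
    match n with
    | O => 0
    | S m => if Rlt_dec z (zi P L h m t x y) then pw_upto P L h f m t x y z
             else f n t x y
    end.

Definition pw P L h (f : nat -> hfield) : vfield := pw_upto P L h f (nlay L).

Definition zint (f : vfield) (a b : hfield) : hfield :=
  fun t x y => RInt (fun z => f t x y z) (a t x y) (b t x y).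

Definition lint P L h (f : vfield) (a : nat) : hfield :=
  zint f (zi P L h (a - 1)) (zi P L h a).

(** * Integration of the equations over the layers *)

(* Everything in the layer-integrated equations which is not an integral of
   u, v, p or of their products: the mass flux G and the transported velocity at the
   interfaces, the integrals over the layers of nu grad u (first index: component
   of the velocity), and the interface values of
   nu d_z u - (nu grad_{x,y} u) grad_{x,y} z_{a+1/2}. *)
Record exchanges := {
  exG : nat -> hfield;
  exu : nat -> hfield; exv : nat -> hfield;
  exSxx : nat -> hfield; exSxy : nat -> hfield;
  exSyx : nat -> hfield; exSyy : nat -> hfield;
  exTx : nat -> hfield; exTy : nat -> hfield
}.

(* Leibniz' rule applied to the integral of the momentum equation over layer a;
   d is dx or dy according to the component f. *)
Definition layer_momentum P L h (u v p f : vfield) (d : hfield -> hfield)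
    (G fi Sx Sy T : nat -> hfield) (a : nat) (t x y : R) : Prop :=
  dt (lint P L h f a) t x y
    + hdiv (lint P L h (vmul f u) a) (lint P L h (vmul f v) a) t x y
  = fi a t x y * G a t x y - fi (a - 1)%nat t x y * G (a - 1)%nat t x y
    - 1 / rho0 P *
      (d (lint P L h p a) t x y
         - p t x y (zi P L h a t x y) * d (zi P L h a) t x y
         + p t x y (zi P L h (a - 1) t x y) * d (zi P L h (a - 1)) t x y)
    + hdiv (Sx a) (Sy a) t x y
    + T a t x y - T (a - 1)%nat t x y.

Definition layer_balance P Omega L h (u v p : vfield) (X : exchanges) : Prop :=
  forall t x y, Omega (t, x, y) -> forall a, (1 <= a <= nlay L)%nat ->
    dt (hl L h a) t x y
      + hdiv (lint P L h u a) (lint P L h v a) t x y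
      = exG X a t x y - exG X (a - 1)%nat t x y /\
    layer_momentum P L h u v p u dx (exG X) (exu X) (exSxx X) (exSxy X) (exTx X) a t x y /\
    layer_momentum P L h u v p v dy (exG X) (exv X) (exSyx X) (exSyy X) (exTy X) a t x y.

Definition on_interface P L h (f : vfield) (a : nat) : hfield :=
  fun t x y => f t x y (zi P L h a t x y).

Definition traction P L h (f : vfield) (a : nat) : hfield :=
  fun t x y =>
    let z := zi P L h a t x y in
    nu P * Dz f t x y z
    - (nu P * Dx f t x y z * dx (zi P L h a) t x y
       + nu P * Dy f t x y z * dy (zi P L h a) t x y).

Definition exact_exchanges P L h (u v w : vfield) : exchanges := {|
  exG := fun a t x y =>
    let z := zi P L h a t x y in
    dt (zi P L h a) t x y + u t x y z * dx (zi P L h a) t x y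
      + v t x y z * dy (zi P L h a) t x y - w t x y z;
  exu := on_interface P L h u;
  exv := on_interface P L h v;
  exSxx := lint P L h (fun t x y z => nu P * Dx u t x y z);
  exSxy := lint P L h (fun t x y z => nu P * Dy u t x y z);
  exSyx := lint P L h (fun t x y z => nu P * Dx v t x y z);
  exSyy := lint P L h (fun t x y z => nu P * Dy v t x y z);
  exTx := traction P L h u;
  exTy := traction P L h v
|}.

(* For f smooth in z this is the mean of d_x f (d = dx) or d_y f (d = dy) over
   the dual cell [z_a, z_{a+1}] around the interface z_{a+1/2}. For f piecewise constant
   it is the mean of the distributional derivative, whose mass on the moving
   interface is included. *)
Definition dual_mean P L h (d : hfield -> hfield) (f : vfield) (a : nat) : hfield :=
  fun t x y =>
    let lo := zc P L h a in
    let hi := zc P L h (a + 1) in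
    (d (zint f lo hi) t x y
       - f t x y (hi t x y) * d hi t x y + f t x y (lo t x y) * d lo t x y)
    / (hi t x y - lo t x y).

(* The same for d_z f. *)
Definition dual_mean_z P L h (f : vfield) (a : nat) : hfield :=
  fun t x y =>
    let lo := zc P L h a t x y in
    let hi := zc P L h (a + 1) t x y in
    (f t x y hi - f t x y lo) / (hi - lo).

(* nu_{a+1/2} *)
Definition nui P L (a : nat) : R :=
  if orb (Nat.eqb a 0) (Nat.eqb a (nlay L)) then 0 else nu P.

Definition upwind (G : nat -> hfield) (f : nat -> hfield) (a : nat) : hfield :=
  fun t x y => if Rle_dec (G a t x y) 0 then f a t x y else f (a + 1)%nat t x y.

Definition cell_mean (S : nat -> hfield) (a : nat) : hfield :=
  fun t x y => (S a t x y + S (a - 1)%nat t x y) / 2.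

Definition dual_stress P L h (d : hfield -> hfield) (f : vfield) (a : nat) : hfield :=
  fun t x y => nui P L a * dual_mean P L h d f a t x y.

(* Boundary conditions at the bottom (friction) and at the surface (wind),
   dual-cell means in between. The wind stress is taken per unit horizontal area: the area
   element [metric (eta P h)] of the free surface is replaced by 1. *)
Definition dual_traction P L h (f : vfield) (ts : hfield) (a : nat) : hfield :=
  fun t x y =>
    if Nat.eqb a 0 then kappa P * f t x y (zb P x y)
    else if Nat.eqb a (nlay L) then wind P t x y * ts t x y
    else nu P * dual_mean_z P L h f a t x y
         - (dual_stress P L h dx f a t x y * dx (zi P L h a) t x y
            + dual_stress P L h dy f a t x y * dy (zi P L h a) t x y).

Definition layer_stress P L h (d : hfield -> hfield) (f : vfield) (a : nat) : hfield :=
  hmul (hl L h a) (cell_mean (dual_stress P L h d f) a).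

Definition layered_exchanges P L h (us vs : nat -> hfield) (G : nat -> hfield) : exchanges :=
  let u := pw P L h us in
  let v := pw P L h vs in
  {| exG := G;
     exu := upwind G us;
     exv := upwind G vs;
     exSxx := layer_stress P L h dx u;
     exSxy := layer_stress P L h dy u;
     exSyx := layer_stress P L h dx v;
     exSyy := layer_stress P L h dy v;
     exTx := dual_traction P L h u (tsx P);
     exTy := dual_traction P L h v (tsy P) |}.

Definition hydrostatic_pressure P h : vfield :=
  fun t x y z => rho0 P * grav P * (eta P h t x y - z).

(* The hydrostatic Navier-Stokes system integrated over each layer, for a
   velocity piecewise constant in z. The mass fluxes through the interfaces are
   unknowns, vanishing at the bottom and at the free surface. *)
Definition layer_averaged_NS P Omega L h (us vs : nat -> hfield) : Prop :=
  exists G : nat -> hfield,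
    (forall t x y, Omega (t, x, y) -> G 0%nat t x y = 0 /\ G (nlay L) t x y = 0) /\
    layer_balance P Omega L h (pw P L h us) (pw P L h vs) (hydrostatic_pressure P h)
      (layered_exchanges P L h us vs G).

(** * The layer-averaged system in explicit form *)

Definition Gx L h (us vs : nat -> hfield) (a : nat) : hfield :=
  fun t x y => sum_n_m (fun j =>
    dt (hl L h j) t x y
    + hdiv (hmul (hl L h j) (us j)) (hmul (hl L h j) (vs j)) t x y) 1 a.

(* Sigma_{a+1/2}: f = us, vs gives the rows and d = dx, dy the columns. *)
Definition Sig P L h (d : hfield -> hfield) (f : nat -> hfield) (a : nat) : hfield :=
  fun t x y =>
    nui P L a / (hl L h (a + 1) t x y + hl L h a t x y)
      * (hl L h a t x y * d (f a) t x y
         + hl L h (a + 1) t x y * d (f (a + 1)%nat) t x y)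
    - 2 * nui P L a * d (zi P L h a) t x y
      * ((f (a + 1)%nat t x y - f a t x y) / (hl L h (a + 1) t x y + hl L h a t x y)).

Definition kappal P (a : nat) : R := if Nat.eqb a 1 then kappa P else 0.
Definition windl P L (a : nat) : hfield :=
  fun t x y => if Nat.eqb a (nlay L) then wind P t x y else 0.

Definition system_mass L h (us vs : nat -> hfield) (t x y : R) : Prop :=
  sum_n_m (fun a => dt (hl L h a) t x y) 1 (nlay L)
  + sum_n_m (fun a => hdiv (hmul (hl L h a) (us a)) (hmul (hl L h a) (vs a)) t x y)
      1 (nlay L) = 0.

(* Component f = us (d = dx, ts = tsx) or f = vs (d = dy, ts = tsy). *)
Definition system_momentum P L h (us vs f : nat -> hfield) (d : hfield -> hfield)
    (ts : hfield) (a : nat) (t x y : R) : Prop :=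
  let G := Gx L h us vs in
  let Sx := Sig P L h dx f in
  let Sy := Sig P L h dy f in
  dt (hmul (hl L h a) (f a)) t x y
  + hdiv (hmul (hl L h a) (hmul (f a) (us a))) (hmul (hl L h a) (hmul (f a) (vs a))) t x y
  + d (fun t x y => grav P / 2 * h t x y * hl L h a t x y) t x y
  = - grav P * hl L h a t x y * d (bottom P) t x y
    + upwind G f a t x y * G a t x y
    - upwind G f (a - 1)%nat t x y * G (a - 1)%nat t x y
    + hdiv (hmul (hl L h a) (cell_mean Sx a)) (hmul (hl L h a) (cell_mean Sy a)) t x y
    - (Sx a t x y * dx (zi P L h a) t x y + Sy a t x y * dy (zi P L h a) t x y)
    + (Sx (a - 1)%nat t x y * dx (zi P L h (a - 1)) t x y
       + Sy (a - 1)%nat t x y * dy (zi P L h (a - 1)) t x y)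
    + 2 * nui P L a
      * ((f (a + 1)%nat t x y - f a t x y) / (hl L h (a + 1) t x y + hl L h a t x y))
    - 2 * nui P L (a - 1)
      * ((f a t x y - f (a - 1)%nat t x y) / (hl L h a t x y + hl L h (a - 1) t x y))
    - kappal P a * f a t x y
    + windl P L a t x y * ts t x y.

Definition layer_averaged_system P Omega L h (us vs : nat -> hfield) : Prop :=
  forall t x y, Omega (t, x, y) ->
    system_mass L h us vs t x y /\
    forall a, (1 <= a <= nlay L)%nat ->
      system_momentum P L h us vs us dx (tsx P) a t x y /\
      system_momentum P L h us vs vs dy (tsy P) a t x y.

(* The second expression of the exchange terms. *)
Definition Gx_closed L h (us vs : nat -> hfield) (a : nat) : hfield :=
  fun t x y => - sum_n_m (fun j =>
    (sum_n_m (frac L) 1 a - (if Nat.leb j a then 1 else 0))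
    * hdiv (hmul (hl L h j) (us j)) (hmul (hl L h j) (vs j)) t x y) 1 (nlay L).

(** * Vertical velocity *)

(* The value for a = 0 is not used. *)
Fixpoint kz P L h (us vs : nat -> hfield) (a : nat) : hfield :=
  match a with
  | O => fun _ _ _ => 0
  | S O => hdiv (hmul (bottom P) (us 1%nat)) (hmul (bottom P) (vs 1%nat))
  | S (S _ as b) => fun t x y =>
      kz P L h us vs b t x y
      + hdiv (fun t x y => zi P L h b t x y * (us (b + 1)%nat t x y - us b t x y))
             (fun t x y => zi P L h b t x y * (vs (b + 1)%nat t x y - vs b t x y)) t x y
  end.

Definition wl P L h (us vs : nat -> hfield) (a : nat) : hfield :=
  fun t x y => kz P L h us vs a t x y - zc P L h a t x y * hdiv (us a) (vs a) t x y.

(* Integral from the bottom to z of the incompressibility condition, using the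
   no-penetration condition: w(z) = - div_{x,y} int_{z_b}^z (u, v). *)
Definition vertical_velocity P (u v : vfield) : vfield :=
  fun t x y z =>
    - hdiv (zint u (bottom P) (fun _ _ _ => z)) (zint v (bottom P) (fun _ _ _ => z)) t x y.

(** * Energy *)

Definition energy P (u v : vfield) : vfield :=
  fun t x y z => (u t x y z ^ 2 + v t x y z ^ 2) / 2 + grav P * z.

Definition column P h (f : vfield) : hfield := zint f (bottom P) (eta P h).

(* Inviscid part of the flux of energy; f is the advecting component u or v. *)
Definition energy_flux P h (u v f : vfield) : vfield :=
  fun t x y z => f t x y z * (energy P u v t x y z + grav P * (eta P h t x y - z)).

Definition kinetic (u v : vfield) : vfield :=
  fun t x y z => (u t x y z ^ 2 + v t x y z ^ 2) / 2.

Definition dissipation (u v : vfield) : vfield :=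
  fun t x y z =>
    Dx u t x y z ^ 2 + Dy u t x y z ^ 2 + Dx v t x y z ^ 2 + Dy v t x y z ^ 2
    + (Dz u t x y z ^ 2 + Dz v t x y z ^ 2).

(* The vertical part |d_z u|^2 of the dissipation and the work of the wind are
   included; the latter carries the area element of the free surface since the
   wind stress is prescribed through the unit normal. *)
Definition continuous_energy_balance P Omega h (u v : vfield) : Prop :=
  forall t x y, Omega (t, x, y) ->
    let zs := eta P h t x y in
    dt (column P h (energy P u v)) t x y
    + hdiv
        (column P h (fun t x y z =>
           energy_flux P h u v u t x y z - nu P * Dx (kinetic u v) t x y z))
        (column P h (fun t x y z =>
           energy_flux P h u v v t x y z - nu P * Dy (kinetic u v) t x y z)) t x y
    = - nu P * column P h (dissipation u v) t x y
      - kappa P * (u t x y (zb P x y) ^ 2 + v t x y (zb P x y) ^ 2)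
      + metric (eta P h) t x y * wind P t x y
        * (u t x y zs * tsx P t x y + v t x y zs * tsy P t x y).

Definition El P L h (us vs : nat -> hfield) (a : nat) : hfield :=
  fun t x y =>
    hl L h a t x y * (us a t x y ^ 2 + vs a t x y ^ 2) / 2
    + grav P / 2 * hl L h a t x y * h t x y
    + grav P * hl L h a t x y * zb P x y.

(* f = us (d = dx) or f = vs (d = dy) is the advecting component. *)
Definition layered_flux_inviscid P L h (us vs f : nat -> hfield) (a : nat) : hfield :=
  fun t x y => f a t x y * (El P L h us vs a t x y + grav P / 2 * hl L h a t x y * h t x y).

Definition layered_flux_viscous P L h (us vs : nat -> hfield) (d : hfield -> hfield)
    (a : nat) : hfield :=
  fun t x y =>
    hl L h a t x y
    * (us a t x y * cell_mean (Sig P L h d us) a t x y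
       + vs a t x y * cell_mean (Sig P L h d vs) a t x y).

Definition layered_flux P L h (us vs f : nat -> hfield) (d : hfield -> hfield) : hfield :=
  fun t x y => sum_n_m (fun a =>
    layered_flux_inviscid P L h us vs f a t x y - layered_flux_viscous P L h us vs d a t x y)
    1 (nlay L).

(* Loss of energy due to the upwinding of the exchange terms. The jump is u_{a+1} - u_a
   for both signs of G; u_{a+1/2} - u_a would vanish where G <= 0. *)
Definition exchange_dissipation L h (us vs : nat -> hfield) : hfield :=
  fun t x y => sum_n_m (fun a =>
    ((us (a + 1)%nat t x y - us a t x y) ^ 2 + (vs (a + 1)%nat t x y - vs a t x y) ^ 2) / 2
    * Rabs (Gx L h us vs a t x y)) 1 (nlay L - 1).

Definition horizontal_dissipation P L h (us vs : nat -> hfield) : hfield :=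
  fun t x y => sum_n_m (fun a =>
    (hl L h (a + 1) t x y + hl L h a t x y) / (2 * nu P)
    * (Sig P L h dx us a t x y ^ 2 + Sig P L h dy us a t x y ^ 2
       + Sig P L h dx vs a t x y ^ 2 + Sig P L h dy vs a t x y ^ 2)) 1 (nlay L - 1).

Definition vertical_dissipation P L h (us vs : nat -> hfield) : hfield :=
  fun t x y => sum_n_m (fun a =>
    2 * nu P
    * (((us (a + 1)%nat t x y - us a t x y) ^ 2 + (vs (a + 1)%nat t x y - vs a t x y) ^ 2)
       / (hl L h (a + 1) t x y + hl L h a t x y))) 1 (nlay L - 1).

Definition layered_energy_balance P Omega L h (us vs : nat -> hfield) : Prop :=
  forall t x y, Omega (t, x, y) ->
    dt (fun t x y => sum_n_m (fun a => El P L h us vs a t x y) 1 (nlay L)) t x y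
    + hdiv (layered_flux P L h us vs us dx) (layered_flux P L h us vs vs dy) t x y
    = - exchange_dissipation L h us vs t x y
      - horizontal_dissipation P L h us vs t x y
      - vertical_dissipation P L h us vs t x y
      - kappa P * (us 1%nat t x y ^ 2 + vs 1%nat t x y ^ 2)
      + wind P t x y * (us (nlay L) t x y * tsx P t x y + vs (nlay L) t x y * tsy P t x y).

(* Term by term, the layer-averaged energy balance is the continuous one
   evaluated on the piecewise constant velocity, with gradients replaced by
   their dual-cell means; grad(|u|^2/2) is discretised as u grad u. *)
Definition energy_terms_discretised P Omega L h (us vs : nat -> hfield) : Prop :=
  let u := pw P L h us in
  let v := pw P L h vs in
  forall t x y, Omega (t, x, y) ->
    sum_n_m (fun a => El P L h us vs a t x y) 1 (nlay L)
      = column P h (energy P u v) t x y /\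
    sum_n_m (fun a => layered_flux_inviscid P L h us vs us a t x y) 1 (nlay L)
      = column P h (energy_flux P h u v u) t x y /\
    sum_n_m (fun a => layered_flux_inviscid P L h us vs vs a t x y) 1 (nlay L)
      = column P h (energy_flux P h u v v) t x y /\
    (forall a, (1 <= a <= nlay L)%nat ->
       layered_flux_viscous P L h us vs dx a t x y
         = us a t x y * layer_stress P L h dx u a t x y
           + vs a t x y * layer_stress P L h dx v a t x y /\
       layered_flux_viscous P L h us vs dy a t x y
         = us a t x y * layer_stress P L h dy u a t x y
           + vs a t x y * layer_stress P L h dy v a t x y) /\
    horizontal_dissipation P L h us vs t x y
      = nu P * sum_n_m (fun a =>
          (zc P L h (a + 1) t x y - zc P L h a t x y)
          * (dual_mean P L h dx u a t x y ^ 2 + dual_mean P L h dy u a t x y ^ 2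
             + dual_mean P L h dx v a t x y ^ 2 + dual_mean P L h dy v a t x y ^ 2))
          1 (nlay L - 1) /\
    vertical_dissipation P L h us vs t x y
      = nu P * sum_n_m (fun a =>
          (zc P L h (a + 1) t x y - zc P L h a t x y)
          * (dual_mean_z P L h u a t x y ^ 2 + dual_mean_z P L h v a t x y ^ 2))
          1 (nlay L - 1) /\
    us 1%nat t x y = u t x y (zb P x y) /\ vs 1%nat t x y = v t x y (zb P x y) /\
    us (nlay L) t x y = u t x y (eta P h t x y) /\ vs (nlay L) t x y = v t x y (eta P h t x y).

Definition layer_mean P L h (f : vfield) (a : nat) : hfield :=
  fun t x y => lint P L h f a t x y / hl L h a t x y.

(* The only term without a continuous counterpart disappears when the layers
   are refined. *)
Definition exchange_dissipation_vanishes P Omega h (u v : vfield) : Prop :=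
  forall Ls : nat -> layering,
    (forall n, valid_layering (Ls n)) ->
    (forall eps, 0 < eps -> exists n0, forall n, (n0 <= n)%nat ->
       forall a, (1 <= a <= nlay (Ls n))%nat -> frac (Ls n) a < eps) ->
    forall t x y, Omega (t, x, y) ->
      is_lim_seq (fun n =>
        exchange_dissipation (Ls n) h
          (layer_mean P (Ls n) h u) (layer_mean P (Ls n) h v) t x y) 0.

(* Main.v *)
From Stdlib Require Import Reals Lra Lia List Classical ClassicalEpsilon.
From Coquelicot Require Import Coquelicot.
(* Last, because Stdlib's [Rderiv] also defines a [Dx]. *)
Require Import Defs.
Open Scope R_scope.

(** Continuous system. The pressure is hydrostatic, and every balance over a layer is
    Leibniz' rule between two moving graphs; its boundary terms combine into the mass flux and
    the viscous stress through these graphs, which the boundary conditions give at the bottom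
    and at the free surface. Testing the momentum equation with the velocity gives a local
    energy balance whose remainder is the z-derivative of
    - w (|u|^2 / 2 + g eta) + nu d_z |u|^2 / 2.

    Layers. For piecewise constant velocities all the integrals are explicit. Testing the
    momentum equation of layer a with u_a and regrouping the sum over the layers by interfaces
    leaves at each interior interface the square of the jump times -|G| / 2 (by the
    upwinding), and complete squares of Sigma and of the vertical difference quotient.

    Refinement. For the layer means of a smooth flow the exchange term G is the exact flux
    through the interface, hence bounded, and the jumps are O(l_a + l_{a+1}); the sum of their
    squares is thus O(max l_a). *)

(** * Finite sums *)

(** Two obstacles shape the proof. The equations hold on [Omega] or in the closed fluid column only,
    while a derivative needs a neighbourhood. Identities between fields are therefore proved on a
    whole open set before being differentiated, and identities between integrands are required only
    strictly between the ends of the interval; the hydrostatic pressure, for instance, is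
    differentiated horizontally inside the column only. Secondly, a piecewise constant velocity has
    no derivative across an interface: the dual-cell mean stands in for it, and the second term of
    Sigma is the mass that the jump puts on the sloping interface. The fluxes G are unknowns of the
    integrated system; summation from the bottom determines them, and the explicit mass equation is
    what remains of the condition at the free surface. Once derivatives are expanded, an energy
    balance is a linear combination of the equations with field coefficients; after multiplication
    by these, [lra] concludes with monomials as atoms. *)

Lemma sum1_O (F : nat -> R) : sum_n_m F 1 0 = 0 :> R.
Proof. rewrite sum_n_m_zero; [reflexivity | lia]. Qed.

Lemma sum1_S (F : nat -> R) n : sum_n_m F 1 (S n) = sum_n_m F 1 n + F (S n) :> R.
Proof. rewrite sum_n_Sm; [reflexivity | lia]. Qed.

Lemma sum1_ext (F G : nat -> R) n :
  (forall a, (1 <= a <= n)%nat -> F a = G a) -> sum_n_m F 1 n = sum_n_m G 1 n :> R.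
Proof. apply sum_n_m_ext_loc. Qed.

Lemma sum1_plus (F G : nat -> R) n :
  sum_n_m (fun a => F a + G a) 1 n = sum_n_m F 1 n + sum_n_m G 1 n :> R.
Proof. apply (sum_n_m_plus F G). Qed.

Lemma sum1_scal c (F : nat -> R) n : sum_n_m (fun a => c * F a) 1 n = c * sum_n_m F 1 n :> R.
Proof. apply (sum_n_m_mult_l c F). Qed.

Lemma sum1_le (F G : nat -> R) n :
  (forall a, (1 <= a <= n)%nat -> F a <= G a) -> sum_n_m F 1 n <= sum_n_m G 1 n.
Proof.
induction n as [|n IH]; intros H.
- rewrite !sum1_O; lra.
- rewrite !sum1_S. apply Rplus_le_compat; [apply IH; intros; apply H; lia | apply H; lia].
Qed.

Lemma sum1_telescope (G : nat -> R) n :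
  sum_n_m (fun a => G a - G (a - 1)%nat) 1 n = G n - G 0%nat :> R.
Proof.
induction n as [|n IH].
- rewrite sum1_O; ring.
- rewrite sum1_S, IH. replace (S n - 1)%nat with n by lia. ring.
Qed.

(** Layer a meets interface a from below ([A]) and interface a - 1 from above ([B]). Regrouping
    pairs both sides of each interior interface and leaves the two outermost faces. *)
Lemma sum1_interfaces (A B : nat -> R) n : (1 <= n)%nat ->
  sum_n_m (fun a => A a + B (a - 1)%nat) 1 n
  = A n + B 0%nat + sum_n_m (fun b => A b + B b) 1 (n - 1) :> R.
Proof.
induction n as [|n IH]; intros H; [lia|].
rewrite sum1_S. replace (S n - 1)%nat with n by lia.
destruct n as [|n].
- rewrite !sum1_O; ring.
- rewrite IH by lia. replace (S n - 1)%nat with n by lia. rewrite sum1_S. ring.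
Qed.

(** Extracts friction, which acts in layer 1 only, and the wind, which acts in layer N only, from a
    sum over the layers. *)
Lemma sum1_indicator (c : R) a0 n : (1 <= a0 <= n)%nat ->
  sum_n_m (fun a => if Nat.eqb a a0 then c else 0) 1 n = c :> R.
Proof.
assert (E : forall m, sum_n_m (fun a => if Nat.eqb a a0 then c else 0) 1 m
               = (if andb (Nat.leb 1 a0) (Nat.leb a0 m) then c else 0) :> R).
{ induction m as [|m IH].
  - rewrite sum1_O. destruct a0; reflexivity.
  - rewrite sum1_S, IH.
    destruct (Nat.leb_spec 1 a0), (Nat.leb_spec a0 m), (Nat.leb_spec a0 (S m)),
      (Nat.eqb_spec (S m) a0); simpl; try lia; ring. }
intros H. rewrite E.
destruct (Nat.leb_spec 1 a0), (Nat.leb_spec a0 n); simpl; try lia; reflexivity.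
Qed.

(** * Partial derivatives of fields of (t, x, y) *)

(** A single index for t, x and y, so that each rule of calculus is proved once. [pd Dirx] reduces
    to [dx], and likewise for t and y, which the casts inside later [rewrite]s rely on. *)
Inductive dir := Dirt | Dirx | Diry.

Definition coord (i : dir) (t x y : R) : R :=
  match i with Dirt => t | Dirx => x | Diry => y end.

Definition slice (i : dir) (f : hfield) (t x y : R) : R -> R :=
  match i with
  | Dirt => fun s => f s x y
  | Dirx => fun s => f t s y
  | Diry => fun s => f t x s
  end.

Definition pd (i : dir) : hfield -> hfield :=
  match i with Dirt => dt | Dirx => dx | Diry => dy end.

Definition expd (i : dir) (f : hfield) (t x y : R) : Prop :=
  ex_derive (slice i f t x y) (coord i t x y).

Lemma pd_slice i f t x y : pd i f t x y = Derive (slice i f t x y) (coord i t x y).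
Proof. destruct i; reflexivity. Qed.

Lemma slice_coord i f t x y : slice i f t x y (coord i t x y) = f t x y.
Proof. destruct i; reflexivity. Qed.

Lemma open_slice i (D : R * R * R -> Prop) t x y : open D -> D (t, x, y) ->
  locally (coord i t x y) (fun s =>
    D (match i with Dirt => (s, x, y) | Dirx => (t, s, y) | Diry => (t, x, s) end)).
Proof.
intros HD H. destruct (HD _ H) as [eps He]. exists eps. intros s Hs. apply He.
destruct i; repeat split; simpl in *; auto; apply ball_center.
Qed.

Lemma pd_ext_loc i f g t x y :
  locally (coord i t x y) (fun s => slice i f t x y s = slice i g t x y s) ->
  pd i f t x y = pd i g t x y.
Proof. intros H. rewrite !pd_slice. apply Derive_ext_loc, H. Qed.

Lemma expd_ext_loc i f g t x y :
  locally (coord i t x y) (fun s => slice i f t x y s = slice i g t x y s) ->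
  expd i f t x y -> expd i g t x y.
Proof. intros H. apply ex_derive_ext_loc, H. Qed.

(** Openness makes an identity on [D] valid along a short coordinate segment, which is all that a
    partial derivative sees. The explicit values of layer integrals hold only where h > 0, hence on
    [Omega] and not everywhere. *)
Lemma slice_ext_on i (D : R * R * R -> Prop) (f g : hfield) t x y : open D -> D (t, x, y) ->
  (forall t x y, D (t, x, y) -> f t x y = g t x y) ->
  locally (coord i t x y) (fun s => slice i f t x y s = slice i g t x y s).
Proof.
intros HD H E. generalize (open_slice i D t x y HD H). apply filter_imp.
intros s Hs. destruct i; apply E, Hs.
Qed.

Lemma pd_ext_on i (D : R * R * R -> Prop) f g t x y : open D -> D (t, x, y) ->
  (forall t x y, D (t, x, y) -> f t x y = g t x y) ->
  pd i f t x y = pd i g t x y.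
Proof. intros HD H E. apply pd_ext_loc, (slice_ext_on i D); assumption. Qed.

Lemma expd_ext_on i (D : R * R * R -> Prop) f g t x y : open D -> D (t, x, y) ->
  (forall t x y, D (t, x, y) -> f t x y = g t x y) ->
  expd i f t x y -> expd i g t x y.
Proof. intros HD H E. apply expd_ext_loc, (slice_ext_on i D); assumption. Qed.

Lemma hdiv_ext_on (D : R * R * R -> Prop) f f' g g' t x y : open D -> D (t, x, y) ->
  (forall t x y, D (t, x, y) -> f t x y = f' t x y) ->
  (forall t x y, D (t, x, y) -> g t x y = g' t x y) ->
  hdiv f g t x y = hdiv f' g' t x y.
Proof.
intros HD H E E'. unfold hdiv.
rewrite (pd_ext_on Dirx D f f' t x y HD H E : dx f t x y = dx f' t x y).
rewrite (pd_ext_on Diry D g g' t x y HD H E' : dy g t x y = dy g' t x y).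
reflexivity.
Qed.

Section Rules.
Variables (i : dir) (t x y : R).
Let ex f := expd i f t x y.

Lemma expd_const c : ex (fun _ _ _ => c).
Proof. unfold ex, expd. destruct i; apply ex_derive_const. Qed.

Lemma expd_plus f g : ex f -> ex g -> ex (fun t x y => f t x y + g t x y).
Proof. unfold ex, expd. destruct i; apply (@ex_derive_plus R_AbsRing R_NormedModule). Qed.

Lemma expd_minus f g : ex f -> ex g -> ex (fun t x y => f t x y - g t x y).
Proof. unfold ex, expd. destruct i; apply (@ex_derive_minus R_AbsRing R_NormedModule). Qed.

Lemma expd_mult f g : ex f -> ex g -> ex (fun t x y => f t x y * g t x y).
Proof. unfold ex, expd. destruct i; apply ex_derive_mult. Qed.

Lemma expd_scal c f : ex f -> ex (fun t x y => c * f t x y).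
Proof. apply (expd_mult (fun _ _ _ => c)), expd_const. Qed.

Lemma expd_div f g : ex f -> ex g -> g t x y <> 0 -> ex (fun t x y => f t x y / g t x y).
Proof. unfold ex, expd. destruct i; simpl; intros; apply ex_derive_div; assumption. Qed.

Lemma pd_const c : pd i (fun _ _ _ => c) t x y = 0.
Proof. rewrite pd_slice. destruct i; simpl; apply Derive_const. Qed.

Lemma pd_plus f g : ex f -> ex g ->
  pd i (fun t x y => f t x y + g t x y) t x y = pd i f t x y + pd i g t x y.
Proof.
rewrite !pd_slice. unfold ex, expd. intros Hf Hg.
destruct i; exact (Derive_plus _ _ _ Hf Hg).
Qed.

Lemma pd_minus f g : ex f -> ex g ->
  pd i (fun t x y => f t x y - g t x y) t x y = pd i f t x y - pd i g t x y.
Proof.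
rewrite !pd_slice. unfold ex, expd. intros Hf Hg.
destruct i; exact (Derive_minus _ _ _ Hf Hg).
Qed.

Lemma pd_mult f g : ex f -> ex g ->
  pd i (fun t x y => f t x y * g t x y) t x y
  = pd i f t x y * g t x y + f t x y * pd i g t x y.
Proof.
rewrite !pd_slice. unfold ex, expd. intros Hf Hg.
destruct i; exact (Derive_mult _ _ _ Hf Hg).
Qed.

Lemma pd_scal c f : pd i (fun t x y => c * f t x y) t x y = c * pd i f t x y.
Proof. rewrite !pd_slice. destruct i; exact (Derive_scal _ _ _). Qed.

Lemma expd_sum (F : nat -> hfield) n : (forall a, (1 <= a <= n)%nat -> ex (F a)) ->
  ex (fun t x y => sum_n_m (fun a => F a t x y) 1 n).
Proof.
induction n as [|n IH]; intros H.
- apply expd_ext_loc with (2 := expd_const 0).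
  apply filter_forall. intros s. destruct i; simpl; rewrite sum1_O; reflexivity.
- apply expd_ext_loc with (f := fun t x y => sum_n_m (fun a => F a t x y) 1 n + F (S n) t x y).
  + apply filter_forall. intros s. destruct i; simpl; rewrite sum1_S; reflexivity.
  + apply expd_plus; [apply IH; intros; apply H; lia | apply H; lia].
Qed.

Lemma pd_sum (F : nat -> hfield) n : (forall a, (1 <= a <= n)%nat -> ex (F a)) ->
  pd i (fun t x y => sum_n_m (fun a => F a t x y) 1 n) t x y
  = sum_n_m (fun a => pd i (F a) t x y) 1 n.
Proof.
induction n as [|n IH]; intros H.
- rewrite sum1_O, <- (pd_const 0). apply pd_ext_loc.
  apply filter_forall. intros s. destruct i; simpl; rewrite sum1_O; reflexivity.
- rewrite sum1_S, <- IH by (intros; apply H; lia).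
  rewrite <- pd_plus; [| apply expd_sum; intros; apply H; lia | apply H; lia].
  apply pd_ext_loc. apply filter_forall. intros s.
  destruct i; simpl; rewrite sum1_S; reflexivity.
Qed.

End Rules.

Lemma hsmooth_expd i D f t x y : hsmooth D f -> D (t, x, y) -> expd i f t x y.
Proof.
intros H HD. destruct (H 1%nat) as [_ [He _]].
destruct (He t x y HD) as [? [? ?]]. destruct i; assumption.
Qed.

Lemma hsmooth_pd i D f : hsmooth D f -> hsmooth D (pd i f).
Proof. intros H k. destruct (H (S k)) as [_ [_ [? [? ?]]]]. destruct i; assumption. Qed.

(** * Layer geometry *)

(** As every layer is a constant fraction of [h], this is the coefficient of [h] in z_{a+1/2};
    derivatives of all interfaces reduce to those of [bottom] and [h]. *)
Definition lsum (L : layering) (a : nat) : R := sum_n_m (frac L) 1 a.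

Lemma lsum_pred L a : (1 <= a)%nat -> lsum L a = lsum L (a - 1) + frac L a.
Proof.
intros H. destruct a as [|a]; [lia|]. unfold lsum. rewrite sum1_S.
replace (S a - 1)%nat with a by lia. reflexivity.
Qed.

Lemma lsum_S L a : lsum L (a + 1) = lsum L a + frac L (a + 1).
Proof.
rewrite (lsum_pred L (a + 1)) by lia. replace (a + 1 - 1)%nat with a by lia. reflexivity.
Qed.

Lemma lsum_0 L : lsum L 0 = 0.
Proof. apply sum1_O. Qed.

Lemma lsum_N L : valid_layering L -> lsum L (nlay L) = 1.
Proof. intros [_ [_ H]]. exact H. Qed.

Lemma lsum_mono L a b : valid_layering L -> (a <= b <= nlay L)%nat -> lsum L a <= lsum L b.
Proof.
intros HL H. induction b as [|b IH].
- replace a with 0%nat by lia. lra.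
- destruct (Nat.eq_dec a (S b)) as [->|Hne]; [lra|].
  assert (lsum L a <= lsum L b) by (apply IH; lia).
  rewrite (lsum_pred L (S b)) by lia. replace (S b - 1)%nat with b by lia.
  destruct HL as [_ [Hl _]]. specialize (Hl (S b) ltac:(lia)). lra.
Qed.

Lemma lsum_01 L a : valid_layering L -> (a <= nlay L)%nat -> 0 <= lsum L a <= 1.
Proof.
intros HL H. split.
- rewrite <- (lsum_0 L). apply lsum_mono; [assumption | lia].
- rewrite <- (lsum_N L HL). apply lsum_mono; [assumption | lia].
Qed.

Lemma zi_lsum P L h a t x y : zi P L h a t x y = zb P x y + lsum L a * h t x y.
Proof.
unfold zi, lsum, hl. rewrite (Rmult_comm (sum_n_m _ _ _)), <- sum1_scal. f_equal.
apply sum1_ext. intros; ring.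
Qed.

Lemma zi_bottom P L h t x y : zi P L h 0 t x y = zb P x y.
Proof. rewrite zi_lsum, lsum_0. ring. Qed.

Lemma zi_eta P L h t x y : valid_layering L -> zi P L h (nlay L) t x y = eta P h t x y.
Proof. intros HL. rewrite zi_lsum, lsum_N by assumption. unfold eta. ring. Qed.

Lemma zi_pred P L h a t x y : (1 <= a)%nat ->
  zi P L h a t x y = zi P L h (a - 1) t x y + hl L h a t x y.
Proof. intros H. rewrite !zi_lsum, (lsum_pred L a H). unfold hl. ring. Qed.

Lemma hl_pos L h a t x y : valid_layering L -> 0 < h t x y -> (1 <= a <= nlay L)%nat ->
  0 < hl L h a t x y.
Proof. intros [_ [Hl _]] Hh Ha. apply Rmult_lt_0_compat; auto. Qed.

Lemma zi_mono P L h a b t x y : valid_layering L -> 0 < h t x y -> (a <= b <= nlay L)%nat ->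
  zi P L h a t x y <= zi P L h b t x y.
Proof.
intros HL Hh H. rewrite !zi_lsum. assert (M := lsum_mono L a b HL H).
apply Rplus_le_compat_l, Rmult_le_compat_r; lra.
Qed.

Lemma zi_column P L h a t x y : valid_layering L -> 0 < h t x y -> (a <= nlay L)%nat ->
  zb P x y <= zi P L h a t x y <= eta P h t x y.
Proof.
intros HL Hh H. rewrite <- (zi_bottom P L h t x y), <- (zi_eta P L h t x y HL).
split; apply zi_mono; auto; lia.
Qed.

Section Geometry.
Variables (i : dir) (P : params) (L : layering) (h : hfield) (t x y : R).
Hypotheses (Hb : expd i (bottom P) t x y) (Hh : expd i h t x y).

Lemma expd_hl a : expd i (hl L h a) t x y.
Proof. apply expd_scal, Hh. Qed.

Lemma pd_hl a : pd i (hl L h a) t x y = frac L a * pd i h t x y.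
Proof. apply pd_scal. Qed.

Lemma slice_zi a : locally (coord i t x y) (fun s =>
  slice i (fun t x y => bottom P t x y + lsum L a * h t x y) t x y s
  = slice i (zi P L h a) t x y s).
Proof. apply filter_forall. intros s. destruct i; simpl; rewrite zi_lsum; reflexivity. Qed.

Lemma expd_zi a : expd i (zi P L h a) t x y.
Proof.
apply expd_ext_loc with (1 := slice_zi a). apply expd_plus; [exact Hb|].
apply expd_scal, Hh.
Qed.

Lemma pd_zi a : pd i (zi P L h a) t x y = pd i (bottom P) t x y + lsum L a * pd i h t x y.
Proof.
rewrite <- (pd_ext_loc _ _ _ _ _ _ (slice_zi a)).
rewrite pd_plus; [|exact Hb|apply expd_scal, Hh].
rewrite pd_scal. reflexivity.
Qed.

Lemma pd_zc a : pd i (zc P L h a) t x y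
  = pd i (bottom P) t x y + (lsum L (a - 1) + lsum L a) / 2 * pd i h t x y.
Proof.
unfold zc, Rdiv.
rewrite (pd_mult i t x y (fun t x y => zi P L h (a - 1) t x y + zi P L h a t x y)
  (fun _ _ _ => / 2)); [|apply expd_plus; apply expd_zi|apply expd_const].
rewrite pd_plus, !pd_zi, pd_const by apply expd_zi. field.
Qed.

End Geometry.

(** * Integrals of piecewise constant functions *)

(** The interval is open because [pw] takes at an interior interface the value of the layer
    above. *)
Lemma RInt_const_open (f : R -> R) c A B : A <= B -> (forall z, A < z < B -> f z = c) ->
  ex_RInt f A B /\ RInt f A B = (B - A) * c.
Proof.
intros HAB H. split.
- apply ex_RInt_ext with (fun _ => c); [|apply ex_RInt_const].
  rewrite Rmin_left, Rmax_right by lra. intros z Hz. symmetry; auto.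
- rewrite (RInt_ext f (fun _ => c)).
  + apply (RInt_const (V := R_CompleteNormedModule)).
  + rewrite Rmin_left, Rmax_right by lra. auto.
Qed.

(** The midpoint rule is exact for affine integrands; this is where the mid-heights z_a come
    from. *)
Lemma RInt_affine c0 c1 A B :
  ex_RInt (fun z => c0 + c1 * z) A B /\
  RInt (fun z => c0 + c1 * z) A B = (B - A) * (c0 + c1 * ((A + B) / 2)).
Proof.
assert (H : is_RInt (fun z => c0 + c1 * z) A B
  (minus (c0 * B + c1 * B ^ 2 / 2) (c0 * A + c1 * A ^ 2 / 2))).
{ apply (is_RInt_derive (fun z => c0 * z + c1 * z ^ 2 / 2)).
  - intros z _. auto_derive; [exact I | field].
  - intros z _. apply (ex_derive_continuous (fun z => c0 + c1 * z)). auto_derive. exact I. }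
split; [eexists; exact H|].
rewrite (is_RInt_unique _ _ _ _ H). unfold minus, plus, opp. simpl. field.
Qed.

Lemma RInt_affine_open (f : R -> R) c0 c1 A B : A <= B ->
  (forall z, A < z < B -> f z = c0 + c1 * z) ->
  ex_RInt f A B /\ RInt f A B = (B - A) * (c0 + c1 * ((A + B) / 2)).
Proof.
intros HAB H. destruct (RInt_affine c0 c1 A B) as [H1 H2]. split.
- apply ex_RInt_ext with (2 := H1).
  rewrite Rmin_left, Rmax_right by lra. intros z Hz. symmetry; auto.
- rewrite <- H2. apply (RInt_ext f).
  rewrite Rmin_left, Rmax_right by lra. auto.
Qed.

Lemma RInt_layers (F : R -> R) (z : nat -> R) n :
  (forall a, (1 <= a <= n)%nat -> ex_RInt F (z (a - 1)%nat) (z a)) ->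
  ex_RInt F (z 0%nat) (z n) /\
  RInt F (z 0%nat) (z n) = sum_n_m (fun a => RInt F (z (a - 1)%nat) (z a)) 1 n :> R.
Proof.
induction n as [|n IH]; intros H.
- split; [apply ex_RInt_point|]. rewrite sum1_O. apply (RInt_point (V := R_CompleteNormedModule)).
- destruct IH as [I1 I2]; [intros; apply H; lia|].
  assert (H' := H (S n) ltac:(lia)). rewrite sum1_S.
  replace (S n - 1)%nat with n in * by lia. split.
  + apply ex_RInt_Chasles with (z n); assumption.
  + exact (eq_trans (eq_sym (RInt_Chasles F _ _ _ I1 H')) (f_equal2 Rplus I2 eq_refl)).
Qed.

Section PiecewiseConstant.
Variables (P : params) (L : layering) (h : hfield) (t x y : R).
Hypotheses (HL : valid_layering L) (Hh : 0 < h t x y).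

(** The layer is closed below and, except for the top one, open above: the convention of [pw]. Both
    boundary values [pw_bottom] and [pw_eta] are instances. *)
Lemma pw_layer f a z : (1 <= a <= nlay L)%nat -> zi P L h (a - 1) t x y <= z ->
  z < zi P L h a t x y \/ a = nlay L -> pw P L h f t x y z = f a t x y.
Proof.
intros Ha Hz Hz'. unfold pw.
assert (E : forall n, (a <= n <= nlay L)%nat -> pw_upto P L h f n t x y z = f a t x y);
  [|apply E; lia].
induction n as [|n IH]; intros Hn; [lia|]. simpl.
destruct (Nat.eq_dec a (S n)) as [->|Hne].
- replace (S n - 1)%nat with n in Hz by lia.
  destruct (Rlt_dec z (zi P L h n t x y)); [lra|reflexivity].
- destruct (Rlt_dec z (zi P L h n t x y)) as [|Hge]; [apply IH; lia|].
  exfalso. apply Hge. apply Rlt_le_trans with (zi P L h a t x y).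
  + destruct Hz' as [|]; [assumption|lia].
  + apply zi_mono; auto; lia.
Qed.

Lemma pw_bottom f : pw P L h f t x y (zb P x y) = f 1%nat t x y.
Proof.
assert (H1 : (1 <= nlay L)%nat) by apply HL.
apply pw_layer; [lia | rewrite zi_bottom; lra |]. left.
rewrite zi_pred by lia. rewrite zi_bottom.
assert (Hp := hl_pos L h 1 t x y HL Hh ltac:(lia)). lra.
Qed.

Lemma pw_eta f : pw P L h f t x y (eta P h t x y) = f (nlay L) t x y.
Proof.
assert (H1 : (1 <= nlay L)%nat) by apply HL.
apply pw_layer; [lia | | now right].
apply zi_column; auto; lia.
Qed.

Lemma pw_open f a z : (1 <= a <= nlay L)%nat ->
  zi P L h (a - 1) t x y < z < zi P L h a t x y -> pw P L h f t x y z = f a t x y.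
Proof. intros Ha Hz. apply pw_layer; auto; lra. Qed.

Lemma zi_pred_le a : (1 <= a <= nlay L)%nat -> zi P L h (a - 1) t x y <= zi P L h a t x y.
Proof. intros. apply zi_mono; auto; lia. Qed.

Lemma lint_const (f : vfield) a c : (1 <= a <= nlay L)%nat ->
  (forall z, zi P L h (a - 1) t x y < z < zi P L h a t x y -> f t x y z = c) ->
  lint P L h f a t x y = hl L h a t x y * c.
Proof.
intros Ha H. unfold lint, zint.
destruct (RInt_const_open (fun z => f t x y z) c _ _ (zi_pred_le a Ha) H) as [_ ->].
rewrite (zi_pred P L h a) by lia. ring.
Qed.

Lemma lint_pw f a : (1 <= a <= nlay L)%nat ->
  lint P L h (pw P L h f) a t x y = hl L h a t x y * f a t x y.
Proof. intros Ha. apply lint_const; auto. intros; apply pw_open; auto. Qed.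

Lemma lint_pw_mult f g a : (1 <= a <= nlay L)%nat ->
  lint P L h (vmul (pw P L h f) (pw P L h g)) a t x y
  = hl L h a t x y * (f a t x y * g a t x y).
Proof. intros Ha. apply lint_const; auto. intros; unfold vmul. rewrite !(pw_open _ a); auto. Qed.

(** Affine in z on each layer covers the energy, through g z, and the inviscid flux, in which z
    cancels. *)
Lemma column_layers (f : vfield) (c0 c1 : nat -> R) :
  (forall a z, (1 <= a <= nlay L)%nat ->
     zi P L h (a - 1) t x y < z < zi P L h a t x y -> f t x y z = c0 a + c1 a * z) ->
  column P h f t x y
  = sum_n_m (fun a => hl L h a t x y * (c0 a + c1 a * zc P L h a t x y)) 1 (nlay L) :> R.
Proof.
intros H. unfold column, zint. unfold bottom.
rewrite <- (zi_bottom P L h t x y), <- (zi_eta P L h t x y HL).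
destruct (RInt_layers (fun z => f t x y z) (fun a => zi P L h a t x y) (nlay L)) as [_ ->].
- intros a Ha. apply (RInt_affine_open _ (c0 a) (c1 a)); auto using zi_pred_le.
- apply sum1_ext. intros a Ha.
  destruct (RInt_affine_open (fun z => f t x y z) (c0 a) (c1 a) _ _ (zi_pred_le a Ha))
    as [_ ->]; auto.
  unfold zc. rewrite (zi_pred P L h a) by lia. field.
Qed.

Lemma zc_in a : (1 <= a <= nlay L)%nat ->
  zi P L h (a - 1) t x y < zc P L h a t x y < zi P L h a t x y.
Proof.
intros Ha. unfold zc. rewrite (zi_pred P L h a) by lia.
assert (Hp := hl_pos L h a t x y HL Hh Ha). lra.
Qed.

Lemma zc_lo a : (1 <= a)%nat -> zc P L h a t x y = zi P L h a t x y - hl L h a t x y / 2.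
Proof. intros Ha. unfold zc. rewrite (zi_pred P L h a) by lia. field. Qed.

Lemma zc_hi a : zc P L h (a + 1) t x y = zi P L h a t x y + hl L h (a + 1) t x y / 2.
Proof.
unfold zc. rewrite (zi_pred P L h (a + 1)) by lia.
replace (a + 1 - 1)%nat with a by lia. field.
Qed.

Lemma pw_zc f a : (1 <= a <= nlay L)%nat ->
  pw P L h f t x y (zc P L h a t x y) = f a t x y.
Proof. intros Ha. apply pw_open; auto using zc_in. Qed.

(** The dual cell crosses a single interface and consists of the upper half of layer a and the lower
    half of layer a + 1. *)
Lemma zint_dual f a : (1 <= a < nlay L)%nat ->
  zint (pw P L h f) (zc P L h a) (zc P L h (a + 1)) t x y
  = hl L h a t x y / 2 * f a t x y + hl L h (a + 1) t x y / 2 * f (a + 1)%nat t x y.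
Proof.
intros Ha. unfold zint.
assert (Z1 := zc_in a ltac:(lia)). assert (Z2 := zc_in (a + 1) ltac:(lia)).
replace (a + 1 - 1)%nat with a in Z2 by lia.
destruct (RInt_const_open (fun z => pw P L h f t x y z) (f a t x y)
  (zc P L h a t x y) (zi P L h a t x y)) as [E1 I1].
- lra.
- intros z Hz. apply pw_open; [lia | lra].
- destruct (RInt_const_open (fun z => pw P L h f t x y z) (f (a + 1)%nat t x y)
    (zi P L h a t x y) (zc P L h (a + 1) t x y)) as [E2 I2].
  + lra.
  + intros z Hz. apply pw_open; [lia | replace (a + 1 - 1)%nat with a by lia; lra].
  + rewrite <- (RInt_Chasles _ _ _ _ E1 E2), I1, I2, zc_lo, zc_hi by lia.
    unfold plus; simpl. field.
Qed.

End PiecewiseConstant.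

(** * The layer-averaged system *)

Lemma nui_0 P L : nui P L 0 = 0.
Proof. reflexivity. Qed.

Lemma nui_N P L : nui P L (nlay L) = 0.
Proof. unfold nui. rewrite Nat.eqb_refl, Bool.orb_true_r. reflexivity. Qed.

Lemma nui_in P L a : (1 <= a < nlay L)%nat -> nui P L a = nu P.
Proof.
intros H. unfold nui.
destruct (Nat.eqb_spec a 0), (Nat.eqb_spec a (nlay L)); try lia. reflexivity.
Qed.

Lemma Sig_nui_0 P L h d f a t x y : nui P L a = 0 -> Sig P L h d f a t x y = 0.
Proof. intros H. unfold Sig. rewrite H. unfold Rdiv. ring. Qed.

Lemma interface_cases L a : (a <= nlay L)%nat ->
  a = 0%nat \/ a = nlay L \/ (1 <= a < nlay L)%nat.
Proof. lia. Qed.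

Section Layered.
Variables (P : params) (Omega : R * R * R -> Prop) (L : layering) (h : hfield).
Hypotheses (HOmega : open Omega) (Hbot : hsmooth Omega (bottom P))
  (HL : valid_layering L) (Hsmooth : hsmooth Omega h)
  (Hpos : forall t x y, Omega (t, x, y) -> 0 < h t x y).

Definition layers_smooth (f : nat -> hfield) : Prop :=
  forall a, (1 <= a <= nlay L)%nat -> hsmooth Omega (f a).

Lemma expd_layer i f a t x y : layers_smooth f -> Omega (t, x, y) ->
  (1 <= a <= nlay L)%nat -> expd i (f a) t x y.
Proof. intros Hf H Ha. apply hsmooth_expd with Omega; auto. Qed.

Lemma expd_h i t x y : Omega (t, x, y) -> expd i h t x y.
Proof. apply hsmooth_expd; assumption. Qed.

Lemma expd_bottom i t x y : Omega (t, x, y) -> expd i (bottom P) t x y.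
Proof. apply hsmooth_expd; assumption. Qed.

(** The product rule differentiates the two half thicknesses of the dual cell. Together with the
    terms from its moving ends these add up to minus the slope of the interface times the jump. *)
Lemma dual_mean_pw i f a t x y : layers_smooth f -> Omega (t, x, y) -> (1 <= a < nlay L)%nat ->
  dual_mean P L h (pd i) (pw P L h f) a t x y
  = ((hl L h a t x y * pd i (f a) t x y + hl L h (a + 1) t x y * pd i (f (a + 1)%nat) t x y) / 2
     - pd i (zi P L h a) t x y * (f (a + 1)%nat t x y - f a t x y))
    / ((hl L h (a + 1) t x y + hl L h a t x y) / 2).
Proof.
intros Hf H Ha.
assert (Eh := expd_h i t x y H). assert (Eb := expd_bottom i t x y H).
unfold dual_mean. cbv zeta.
rewrite !(pw_zc P L h t x y HL (Hpos t x y H)) by lia.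
rewrite (pd_ext_on i Omega (zint (pw P L h f) (zc P L h a) (zc P L h (a + 1)))
  (fun t x y => frac L a / 2 * (h t x y * f a t x y)
     + frac L (a + 1) / 2 * (h t x y * f (a + 1)%nat t x y)) t x y HOmega H).
2:{ intros t' x' y' H'. rewrite zint_dual; auto. unfold hl. field. }
assert (E1 : expd i (f a) t x y) by (apply expd_layer; auto; lia).
assert (E2 : expd i (f (a + 1)%nat) t x y) by (apply expd_layer; auto; lia).
rewrite pd_plus by (apply expd_scal, expd_mult; assumption).
rewrite !pd_scal, !pd_mult by assumption.
rewrite !pd_zc, pd_zi by assumption.
rewrite zc_hi, zc_lo by lia. replace (a + 1 - 1)%nat with a by lia.
rewrite lsum_S, (lsum_pred L a) by lia. unfold hl.
f_equal; field.
Qed.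

(** Dividing by the cell width (h_{a+1} + h_a) / 2 cancels the 1/2 of the gradient term and creates
    the factor 2 of the jump term in Sigma. At the bottom and the surface both sides vanish with
    [nui]. *)
Lemma dual_stress_Sig i f a t x y : layers_smooth f -> Omega (t, x, y) -> (a <= nlay L)%nat ->
  dual_stress P L h (pd i) (pw P L h f) a t x y = Sig P L h (pd i) f a t x y.
Proof.
intros Hf H Ha. unfold dual_stress.
destruct (interface_cases L a Ha) as [->|[->|Ha']].
- rewrite Sig_nui_0 by apply nui_0. rewrite nui_0. ring.
- rewrite Sig_nui_0 by apply nui_N. rewrite nui_N. ring.
- rewrite dual_mean_pw by assumption. unfold Sig.
  assert (H1 := hl_pos L h a t x y HL (Hpos t x y H) ltac:(lia)).
  assert (H2 := hl_pos L h (a + 1) t x y HL (Hpos t x y H) ltac:(lia)).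
  field. lra.
Qed.

Lemma layer_stress_Sig i f a t x y : layers_smooth f -> Omega (t, x, y) ->
  (1 <= a <= nlay L)%nat ->
  layer_stress P L h (pd i) (pw P L h f) a t x y
  = hmul (hl L h a) (cell_mean (Sig P L h (pd i) f) a) t x y.
Proof.
intros Hf H Ha. unfold layer_stress, hmul, cell_mean.
rewrite !dual_stress_Sig by (auto; lia). reflexivity.
Qed.

Lemma expd_Sig j i f a t x y : layers_smooth f -> Omega (t, x, y) -> (a <= nlay L)%nat ->
  expd j (Sig P L h (pd i) f a) t x y.
Proof.
intros Hf H Ha.
(* At the ends [Sig] mentions [f 0] or [f (nlay L + 1)], whose regularity is not given; the factor
   [nui] makes it the constant 0 there. *)
assert (Z : nui P L a = 0 -> expd j (Sig P L h (pd i) f a) t x y).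
{ intros E. apply (expd_ext_on j Omega (fun _ _ _ => 0)); auto using expd_const.
  intros. rewrite Sig_nui_0; auto. }
destruct (interface_cases L a Ha) as [->|[->|Ha']]; [apply Z, nui_0 | apply Z, nui_N |].
assert (Eh := expd_h j t x y H). assert (Eb := expd_bottom j t x y H).
assert (H1 := hl_pos L h a t x y HL (Hpos t x y H) ltac:(lia)).
assert (H2 := hl_pos L h (a + 1) t x y HL (Hpos t x y H) ltac:(lia)).
assert (Ef : forall b, (1 <= b <= nlay L)%nat -> expd j (f b) t x y)
  by (intros; apply expd_layer; auto).
assert (Edf : forall b, (1 <= b <= nlay L)%nat -> expd j (pd i (f b)) t x y)
  by (intros b Hb; apply hsmooth_expd with Omega; auto using hsmooth_pd).
assert (Es : expd j (fun t x y => hl L h (a + 1) t x y + hl L h a t x y) t x y)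
  by (apply expd_plus; apply expd_hl, Eh).
assert (Edz : expd j (pd i (zi P L h a)) t x y).
{ apply (expd_ext_on j Omega (fun t x y => pd i (bottom P) t x y + lsum L a * pd i h t x y)); auto.
  - intros t' x' y' H'. rewrite pd_zi; auto using expd_h, expd_bottom.
  - apply expd_plus; [|apply expd_scal]; apply hsmooth_expd with Omega; auto using hsmooth_pd. }
apply (expd_minus j t x y
  (fun t x y => nui P L a / (hl L h (a + 1) t x y + hl L h a t x y)
     * (hl L h a t x y * pd i (f a) t x y + hl L h (a + 1) t x y * pd i (f (a + 1)%nat) t x y))
  (fun t x y => 2 * nui P L a * pd i (zi P L h a) t x y
     * ((f (a + 1)%nat t x y - f a t x y) / (hl L h (a + 1) t x y + hl L h a t x y)))).
- apply (expd_mult j t x y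
    (fun t x y => nui P L a / (hl L h (a + 1) t x y + hl L h a t x y))).
  + apply expd_div; [apply expd_const | exact Es | lra].
  + apply expd_plus; (apply expd_mult; [apply expd_hl, Eh | apply Edf; lia]).
- apply (expd_mult j t x y (fun t x y => 2 * nui P L a * pd i (zi P L h a) t x y)).
  + apply expd_scal, Edz.
  + apply (expd_div j t x y (fun t x y => f (a + 1)%nat t x y - f a t x y)
      (fun t x y => hl L h (a + 1) t x y + hl L h a t x y)); [|exact Es|lra].
    apply expd_minus; apply Ef; lia.
Qed.

Lemma lint_hydrostatic a t x y : (1 <= a)%nat ->
  lint P L h (hydrostatic_pressure P h) a t x y
  = rho0 P * grav P * frac L a * (1 - (lsum L (a - 1) + lsum L a) / 2)
    * (h t x y * h t x y).
Proof.
intros Ha. unfold lint, zint, hydrostatic_pressure.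
assert (E : forall z, rho0 P * grav P * (eta P h t x y - z)
  = rho0 P * grav P * eta P h t x y + - (rho0 P * grav P) * z) by (intros; ring).
rewrite (RInt_ext _ _ _ _ (fun z _ => E z)).
destruct (RInt_affine (rho0 P * grav P * eta P h t x y) (- (rho0 P * grav P))
  (zi P L h (a - 1) t x y) (zi P L h a t x y)) as [_ ->].
rewrite !zi_lsum, (lsum_pred L a Ha). unfold eta. field.
Qed.

(** The left side is the layer integral of minus the horizontal pressure gradient over rho0, that is
    -g h_a times the slope of eta = h + z_b. The part in h is an exact gradient because h_a is a
    constant multiple of h. *)
Lemma pressure_force i a t x y : rho0 P <> 0 -> Omega (t, x, y) -> (1 <= a)%nat ->
  - (1 / rho0 P *
      (pd i (lint P L h (hydrostatic_pressure P h) a) t x y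
         - hydrostatic_pressure P h t x y (zi P L h a t x y) * pd i (zi P L h a) t x y
         + hydrostatic_pressure P h t x y (zi P L h (a - 1) t x y)
           * pd i (zi P L h (a - 1)) t x y))
  = - grav P * hl L h a t x y * pd i (bottom P) t x y
    - pd i (fun t x y => grav P / 2 * h t x y * hl L h a t x y) t x y.
Proof.
intros Hr H Ha.
assert (Eh := expd_h i t x y H). assert (Eb := expd_bottom i t x y H).
rewrite (pd_ext_on i Omega (lint P L h (hydrostatic_pressure P h) a) _ t x y HOmega H
  (fun t x y _ => lint_hydrostatic a t x y Ha)).
rewrite (pd_ext_on i Omega (fun t x y => grav P / 2 * h t x y * hl L h a t x y)
  (fun t x y => grav P / 2 * frac L a * (h t x y * h t x y)) t x y HOmega H)
  by (intros; unfold hl; ring).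
rewrite !pd_scal, !pd_mult, !pd_zi by assumption.
unfold hydrostatic_pressure. rewrite !zi_lsum, (lsum_pred L a Ha).
unfold eta, hl. field. assumption.
Qed.

(** * Equivalence of the integrated and the explicit layered systems *)

Section Momentum.
Variables (us vs : nat -> hfield).
Hypotheses (Hus : layers_smooth us) (Hvs : layers_smooth vs).

Lemma layer_mass_pw a t x y : Omega (t, x, y) -> (1 <= a <= nlay L)%nat ->
  hdiv (lint P L h (pw P L h us) a) (lint P L h (pw P L h vs) a) t x y
  = hdiv (hmul (hl L h a) (us a)) (hmul (hl L h a) (vs a)) t x y.
Proof.
intros H Ha. apply hdiv_ext_on with Omega; auto; intros; apply lint_pw; auto.
Qed.

Lemma Gx_0 t x y : Gx L h us vs 0 t x y = 0.
Proof. apply sum1_O. Qed.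

Lemma Gx_pred a t x y : (1 <= a)%nat ->
  Gx L h us vs a t x y - Gx L h us vs (a - 1) t x y
  = dt (hl L h a) t x y + hdiv (hmul (hl L h a) (us a)) (hmul (hl L h a) (vs a)) t x y.
Proof.
intros Ha. destruct a as [|a]; [lia|]. unfold Gx. rewrite sum1_S.
replace (S a - 1)%nat with a by lia. ring.
Qed.

(** Total mass conservation says precisely that no mass crosses the free surface. *)
Lemma Gx_N t x y :
  Gx L h us vs (nlay L) t x y = 0 <-> system_mass L h us vs t x y.
Proof.
unfold Gx, system_mass. rewrite <- sum1_plus. reflexivity.
Qed.

(** Both components at once, and for any [G] that agrees with [Gx] at the interfaces: each term of
    the integrated equation is replaced by its explicit value, after which the two equations differ
    by a rearrangement. *)
Lemma layer_momentum_pw (f : nat -> hfield) i ts (G : nat -> hfield) a t x y :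
  layers_smooth f -> rho0 P <> 0 ->
  Omega (t, x, y) -> (1 <= a <= nlay L)%nat ->
  (forall b, (b <= nlay L)%nat -> G b t x y = Gx L h us vs b t x y) ->
  layer_momentum P L h (pw P L h us) (pw P L h vs) (hydrostatic_pressure P h) (pw P L h f)
    (pd i) G (upwind G f) (layer_stress P L h dx (pw P L h f)) (layer_stress P L h dy (pw P L h f))
    (dual_traction P L h (pw P L h f) ts) a t x y
  <-> system_momentum P L h us vs f (pd i) ts a t x y.
Proof.
intros Hf Hr H Ha HG. unfold layer_momentum, system_momentum.
assert (Hh := Hpos t x y H).
assert (E1 : dt (lint P L h (pw P L h f) a) t x y = dt (hmul (hl L h a) (f a)) t x y).
{ apply (pd_ext_on Dirt Omega); auto. intros; apply lint_pw; auto. }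
rewrite E1; clear E1.
assert (E1 : forall g, layers_smooth g -> forall t x y, Omega (t, x, y) ->
  lint P L h (vmul (pw P L h f) (pw P L h g)) a t x y
  = hmul (hl L h a) (hmul (f a) (g a)) t x y).
{ intros; apply lint_pw_mult; auto. }
rewrite (hdiv_ext_on Omega _ _ _ _ t x y HOmega H (E1 us Hus) (E1 vs Hvs)); clear E1.
rewrite (hdiv_ext_on Omega (layer_stress P L h dx (pw P L h f) a)
  (hmul (hl L h a) (cell_mean (Sig P L h dx f) a))
  (layer_stress P L h dy (pw P L h f) a)
  (hmul (hl L h a) (cell_mean (Sig P L h dy f) a)) t x y HOmega H);
  [|intros; apply (layer_stress_Sig Dirx); auto|intros; apply (layer_stress_Sig Diry); auto].
assert (EU : forall b, (b <= nlay L)%nat ->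
  upwind G f b t x y * G b t x y
  = upwind (Gx L h us vs) f b t x y * Gx L h us vs b t x y).
{ intros b Hb. unfold upwind. rewrite HG by assumption. reflexivity. }
rewrite !EU by lia.
assert (Fp := pressure_force i a t x y Hr H ltac:(lia)).
(* One formula for the three cases of [dual_traction]: [nui] removes the viscous terms at the ends,
   the indicators remove friction and wind elsewhere. *)
assert (ET : forall b, (b <= nlay L)%nat ->
  dual_traction P L h (pw P L h f) ts b t x y
  = 2 * nui P L b * ((f (b + 1)%nat t x y - f b t x y)
      / (hl L h (b + 1) t x y + hl L h b t x y))
    - (Sig P L h dx f b t x y * dx (zi P L h b) t x y
       + Sig P L h dy f b t x y * dy (zi P L h b) t x y)
    + (if Nat.eqb b 0 then kappa P * f 1%nat t x y else 0)
    + (if Nat.eqb b (nlay L) then wind P t x y * ts t x y else 0)).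
{ intros b Hb. unfold dual_traction.
  assert (HN : (1 <= nlay L)%nat) by apply HL.
  destruct (interface_cases L b Hb) as [->|[->|Hb']].
  - rewrite (pw_bottom P L h t x y HL Hh), !Sig_nui_0, nui_0 by apply nui_0.
    destruct (Nat.eqb_spec 0 (nlay L)); [lia|]. simpl. ring.
  - rewrite !Sig_nui_0, nui_N, Nat.eqb_refl by apply nui_N.
    destruct (Nat.eqb_spec (nlay L) 0); [lia|]. ring.
  - rewrite (dual_stress_Sig Dirx f b t x y Hf H Hb
      : dual_stress P L h dx _ _ _ _ _ = Sig P L h dx f b t x y).
    rewrite (dual_stress_Sig Diry f b t x y Hf H Hb
      : dual_stress P L h dy _ _ _ _ _ = Sig P L h dy f b t x y).
    unfold dual_mean_z. cbv zeta. rewrite !(pw_zc P L h t x y HL Hh) by lia.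
    rewrite zc_hi, zc_lo, nui_in by lia.
    destruct (Nat.eqb_spec b 0), (Nat.eqb_spec b (nlay L)); try lia.
    assert (H1 := hl_pos L h b t x y HL Hh ltac:(lia)).
    assert (H2 := hl_pos L h (b + 1) t x y HL Hh ltac:(lia)).
    simpl. field. lra. }
rewrite !ET by lia. clear ET EU.
replace (a - 1 + 1)%nat with a by lia.
unfold kappal, windl.
destruct (Nat.eqb_spec a 0), (Nat.eqb_spec (a - 1) (nlay L)); try lia.
(* The lower face of layer a is interface a - 1, so interface 0 is seen by layer 1 only; the
   truncated subtraction is safe since a >= 1. *)
assert (EK : (if Nat.eqb (a - 1) 0 then kappa P * f 1%nat t x y else 0)
  = (if Nat.eqb a 1 then kappa P else 0) * f a t x y).
{ destruct (Nat.eqb_spec (a - 1) 0), (Nat.eqb_spec a 1); try lia; [subst; reflexivity | ring]. }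
assert (EW : (if Nat.eqb a (nlay L) then wind P t x y * ts t x y else 0)
  = (if Nat.eqb a (nlay L) then wind P t x y else 0) * ts t x y).
{ destruct (Nat.eqb a (nlay L)); ring. }
rewrite EK, EW.
split; intros E; lra.
Qed.

(** Starting from G_{1/2} = 0, the mass balances force each unknown flux to be the partial sum [Gx],
    and the condition at the top becomes the mass equation. Conversely [Gx] itself is the
    witness. *)
Lemma layer_averaged_equiv : rho0 P <> 0 ->
  (layer_averaged_NS P Omega L h us vs <-> layer_averaged_system P Omega L h us vs).
Proof.
intros Hr. split.
- intros [G [HG0 HB]] t x y H.
  assert (EG : forall b, (b <= nlay L)%nat -> G b t x y = Gx L h us vs b t x y).
  { induction b as [|b IH]; intros Hb.
    - rewrite Gx_0. apply HG0, H.
    - destruct (HB t x y H (S b) ltac:(lia)) as [Hm _].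
      cbn [exG layered_exchanges] in Hm. rewrite layer_mass_pw in Hm by (auto; lia).
      rewrite <- Gx_pred in Hm by lia.
      replace (S b - 1)%nat with b in Hm by lia. specialize (IH ltac:(lia)). lra. }
  split.
  + apply Gx_N. rewrite <- EG by lia. apply HG0, H.
  + intros a Ha. destruct (HB t x y H a Ha) as [_ [Hu Hv]]. split.
    * apply (layer_momentum_pw us Dirx (tsx P) G); auto.
    * apply (layer_momentum_pw vs Diry (tsy P) G); auto.
- intros HS. exists (Gx L h us vs). split.
  + intros t x y H. split; [apply Gx_0 | apply Gx_N, HS, H].
  + intros t x y H a Ha. destruct (HS t x y H) as [_ HM]. destruct (HM a Ha) as [Hu Hv].
    repeat split.
    * cbn [exG layered_exchanges]. rewrite layer_mass_pw by auto. rewrite Gx_pred by lia.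
      reflexivity.
    * apply (layer_momentum_pw us Dirx (tsx P)); auto.
    * apply (layer_momentum_pw vs Diry (tsy P)); auto.
Qed.

(** All time derivatives of thicknesses are multiples of [dt h], and total mass expresses [dt h] by
    the divergences. Substitution in the partial sum leaves the weights of [Gx_closed]. *)
Lemma Gx_closed_eq a t x y : system_mass L h us vs t x y -> (a <= nlay L)%nat ->
  Gx L h us vs a t x y = Gx_closed L h us vs a t x y.
Proof.
intros Hm Ha. unfold system_mass in Hm. unfold Gx, Gx_closed.
set (D := fun j => hdiv (hmul (hl L h j) (us j)) (hmul (hl L h j) (vs j)) t x y) in *.
assert (Et : forall n, sum_n_m (fun j => dt (hl L h j) t x y) 1 n
  = lsum L n * dt h t x y :> R).
{ intros n. unfold lsum. rewrite Rmult_comm, <- sum1_scal. apply sum1_ext.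
  intros j _. rewrite Rmult_comm. apply (pd_hl Dirt). }
rewrite Et, lsum_N in Hm by assumption.
rewrite sum1_plus, Et.
fold (lsum L a).
(* The indicator truncates the sum at a; [Nat.min] expresses this for every n, so that induction on
   n goes through. *)
assert (E : forall n, sum_n_m (fun j => (lsum L a - (if Nat.leb j a then 1 else 0)) * D j) 1 n
  = lsum L a * sum_n_m D 1 n - sum_n_m D 1 (Nat.min a n) :> R).
{ induction n as [|n IH].
  - rewrite Nat.min_0_r, !sum1_O. ring.
  - rewrite !sum1_S, IH. destruct (Nat.leb_spec (S n) a).
    + rewrite !Nat.min_r by lia. rewrite sum1_S. ring.
    + rewrite !Nat.min_l by lia. ring. }
rewrite E, Nat.min_l by assumption.
change (fun a => hdiv (hmul (hl L h a) (us a)) (hmul (hl L h a) (vs a)) t x y) with D in Hm.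
fold D. change (sum_n_m (fun j => D j) 1 a) with (sum_n_m D 1 a).
replace (dt h t x y) with (- sum_n_m D 1 (nlay L)) by lra. ring.
Qed.

End Momentum.
End Layered.

(** * Vertical velocity of the layered flow *)

Lemma pd_hmul i f g t x y : expd i f t x y -> expd i g t x y ->
  pd i (hmul f g) t x y = pd i f t x y * g t x y + f t x y * pd i g t x y.
Proof. apply pd_mult. Qed.

Lemma expd_hmul i f g t x y : expd i f t x y -> expd i g t x y -> expd i (hmul f g) t x y.
Proof. apply expd_mult. Qed.

(* Purely syntactic: unification up to conversion would see products behind [hl]
   and unfold [zi]. *)
Ltac expand_hmul :=
  repeat match goal with
  | Hf : forall i, expd i ?f ?t ?x ?y |- context [pd ?i (hmul ?f ?g) ?t ?x ?y] =>
      match goal with Hg : forall i, expd i g t x y |- _ =>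
        rewrite (pd_hmul i f g t x y (Hf i) (Hg i)) end
  end.

Section VerticalVelocity.
Variables (P : params) (Omega : R * R * R -> Prop) (L : layering) (h : hfield).
Hypotheses (HOmega : open Omega) (Hbot : hsmooth Omega (bottom P))
  (HL : valid_layering L) (Hsmooth : hsmooth Omega h)
  (Hpos : forall t x y, Omega (t, x, y) -> 0 < h t x y).

(* Abel summation of the recursion for k_a, one component of the velocity at a time. *)
Definition kpart (i : dir) (f : nat -> hfield) (a : nat) : hfield :=
  fun t x y => pd i (hmul (zi P L h (a - 1)) (f a)) t x y
    - sum_n_m (fun j => pd i (hmul (hl L h j) (f j)) t x y) 1 (a - 1).

(** The new term h_a f_a of the partial sum joins z_{a-1/2} f_a to give z_{a+1/2} f_a, so that the
    increment carries the jump at that interface. *)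
Lemma kpart_S i f a t x y : layers_smooth Omega L f -> Omega (t, x, y) ->
  (1 <= a < nlay L)%nat ->
  kpart i f (S a) t x y = kpart i f a t x y
    + pd i (fun t x y => zi P L h a t x y * (f (a + 1)%nat t x y - f a t x y)) t x y.
Proof.
intros Hf H Ha. unfold kpart.
assert (Eh : forall i, expd i h t x y) by (intros; apply hsmooth_expd with Omega; assumption).
assert (Eb : forall i, expd i (bottom P) t x y)
  by (intros; apply hsmooth_expd with Omega; assumption).
assert (Ea : forall i, expd i (f a) t x y) by (intros; apply expd_layer with Omega L; auto; lia).
assert (Es : forall i, expd i (f (a + 1)%nat) t x y)
  by (intros; apply expd_layer with Omega L; auto; lia).
replace (S a) with (a + 1)%nat by lia. replace (a + 1 - 1)%nat with a by lia.
replace (sum_n_m _ 1 a) with (sum_n_m (fun j => pd i (hmul (hl L h j) (f j)) t x y) 1 (a - 1)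
  + pd i (hmul (hl L h a) (f a)) t x y).
2:{ destruct a as [|a]; [lia|]. rewrite sum1_S. replace (S a - 1)%nat with a by lia.
    reflexivity. }
rewrite (pd_mult i t x y (zi P L h a) (fun t x y => f (a + 1)%nat t x y - f a t x y));
  [|apply expd_zi; auto|apply expd_minus; auto].
rewrite pd_minus by auto.
assert (Za : forall i, expd i (zi P L h a) t x y) by (intros; apply expd_zi; auto).
assert (Zp : forall i, expd i (zi P L h (a - 1)) t x y) by (intros; apply expd_zi; auto).
assert (Hl : forall i, expd i (hl L h a) t x y) by (intros; apply expd_hl; auto).
expand_hmul.
rewrite (zi_pred P L h a), !pd_zi, pd_hl, (lsum_pred L a) by (auto || lia).
ring.
Qed.

Lemma kz_kpart us vs a t x y : layers_smooth Omega L us -> layers_smooth Omega L vs ->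
  Omega (t, x, y) -> (1 <= a <= nlay L)%nat ->
  kz P L h us vs a t x y = kpart Dirx us a t x y + kpart Diry vs a t x y.
Proof.
intros Hus Hvs H. induction a as [|a IH]; intros Ha; [lia|].
destruct a as [|a].
- assert (E : forall i f, kpart i f 1 t x y = pd i (hmul (bottom P) (f 1%nat)) t x y).
  { intros i f. unfold kpart. simpl (1 - 1)%nat. rewrite sum1_O, Rminus_0_r.
    apply (pd_ext_on i Omega); auto. intros. unfold hmul. rewrite zi_bottom. reflexivity. }
  rewrite !E. reflexivity.
- rewrite !(kpart_S _ _ (S a)) by (auto; lia).
  change (kz P L h us vs (S (S a)) t x y) with (kz P L h us vs (S a) t x y
      + hdiv (fun t x y => zi P L h (S a) t x y * (us (S a + 1)%nat t x y - us (S a) t x y))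
             (fun t x y => zi P L h (S a) t x y * (vs (S a + 1)%nat t x y - vs (S a) t x y))
             t x y).
  rewrite IH by lia. unfold hdiv, pd. ring.
Qed.

Lemma zint_below f a t x y z : 0 < h t x y -> (1 <= a <= nlay L)%nat ->
  zi P L h (a - 1) t x y < z < zi P L h a t x y ->
  zint (pw P L h f) (bottom P) (fun _ _ _ => z) t x y
  = sum_n_m (fun j => hmul (hl L h j) (f j) t x y) 1 (a - 1)
    + (z * f a t x y - hmul (zi P L h (a - 1)) (f a) t x y).
Proof.
intros Hh Ha Hz. unfold zint, bottom. rewrite <- (zi_bottom P L h t x y).
destruct (RInt_layers (fun z => pw P L h f t x y z) (fun a => zi P L h a t x y) (a - 1))
  as [I1 E1].
{ intros j Hj. apply (RInt_const_open _ (f j t x y)).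
  - apply zi_pred_le; auto; lia.
  - intros; apply pw_open; auto; lia. }
destruct (RInt_const_open (fun z => pw P L h f t x y z) (f a t x y) (zi P L h (a - 1) t x y) z)
  as [I2 E2].
- lra.
- intros; apply pw_open; auto; lra.
- rewrite <- (RInt_Chasles _ _ _ _ I1 I2), E1, E2. unfold plus; simpl.
  f_equal; [|unfold hmul; ring].
  apply sum1_ext. intros j Hj. apply lint_pw; auto. lia.
Qed.

(** The height z stays fixed while the interfaces move. Being strictly inside layer a persists
    nearby by continuity, so the same explicit formula may be differentiated. *)
Lemma pd_zint_below i f a t x y z : layers_smooth Omega L f -> Omega (t, x, y) ->
  (1 <= a <= nlay L)%nat -> zi P L h (a - 1) t x y < z < zi P L h a t x y ->
  pd i (zint (pw P L h f) (bottom P) (fun _ _ _ => z)) t x y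
  = z * pd i (f a) t x y - kpart i f a t x y.
Proof.
intros Hf H Ha Hz.
assert (Eh : expd i h t x y) by (apply hsmooth_expd with Omega; assumption).
assert (Eb : expd i (bottom P) t x y) by (apply hsmooth_expd with Omega; assumption).
assert (Ef : forall j, (1 <= j <= nlay L)%nat -> expd i (f j) t x y)
  by (intros; apply expd_layer with Omega L; auto).
assert (Ez : forall b, continuous (slice i (zi P L h b) t x y) (coord i t x y))
  by (intros b; apply (ex_derive_continuous (V := R_NormedModule)), expd_zi; assumption).
rewrite (pd_ext_loc i _ (fun t x y =>
  sum_n_m (fun j => hmul (hl L h j) (f j) t x y) 1 (a - 1)
    + (z * f a t x y - hmul (zi P L h (a - 1)) (f a) t x y))).
- assert (E1 : expd i (hmul (zi P L h (a - 1)) (f a)) t x y)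
    by (apply expd_hmul; auto; apply expd_zi; assumption).
  assert (E2 : forall j, (1 <= j <= a - 1)%nat -> expd i (hmul (hl L h j) (f j)) t x y)
    by (intros j Hj; apply expd_hmul; [apply expd_hl, Eh | apply Ef; lia]).
  assert (E3 : expd i (fun t x y => z * f a t x y) t x y) by (apply expd_scal, Ef, Ha).
  rewrite pd_plus; [|apply expd_sum, E2|apply expd_minus; assumption].
  rewrite (pd_minus i t x y (fun t x y => z * f a t x y) (hmul (zi P L h (a - 1)) (f a)))
    by assumption.
  rewrite pd_scal, (pd_sum i t x y (fun j => hmul (hl L h j) (f j))) by assumption.
  unfold kpart. ring.
- assert (L1 : locally (coord i t x y) (fun s => slice i (zi P L h (a - 1)) t x y s < z)).
  { apply (Ez (a - 1)%nat (fun r => r < z)). apply open_lt. rewrite slice_coord. apply Hz. }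
  assert (L2 : locally (coord i t x y) (fun s => z < slice i (zi P L h a) t x y s)).
  { apply (Ez a (fun r => z < r)). apply open_gt. rewrite slice_coord. apply Hz. }
  generalize (filter_and _ _ (open_slice i Omega t x y HOmega H) (filter_and _ _ L1 L2)).
  apply filter_imp. intros s [H1 [H2 H3]].
  destruct i; apply zint_below; auto.
Qed.

Lemma vertical_velocity_layer us vs a t x y z :
  layers_smooth Omega L us -> layers_smooth Omega L vs ->
  Omega (t, x, y) -> (1 <= a <= nlay L)%nat -> zi P L h (a - 1) t x y < z < zi P L h a t x y ->
  vertical_velocity P (pw P L h us) (pw P L h vs) t x y z
  = kz P L h us vs a t x y + - hdiv (us a) (vs a) t x y * z.
Proof.
intros Hus Hvs H Ha Hz. unfold vertical_velocity, hdiv.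
assert (Ex := pd_zint_below Dirx us a t x y z Hus H Ha Hz).
assert (Ey := pd_zint_below Diry vs a t x y z Hvs H Ha Hz).
rewrite kz_kpart by assumption. unfold pd in Ex, Ey. rewrite Ex, Ey. ring.
Qed.

(** Inside a layer the vertical velocity is affine in z with slope minus the divergence, hence its
    mean is its value at z_a. *)
Lemma wl_layer_mean us vs a t x y :
  layers_smooth Omega L us -> layers_smooth Omega L vs ->
  Omega (t, x, y) -> (1 <= a <= nlay L)%nat ->
  wl P L h us vs a t x y
  = layer_mean P L h (vertical_velocity P (pw P L h us) (pw P L h vs)) a t x y.
Proof.
intros Hus Hvs H Ha. unfold layer_mean, lint, zint.
assert (Hp := hl_pos L h a t x y HL (Hpos t x y H) Ha).
destruct (RInt_affine_open
  (fun z => vertical_velocity P (pw P L h us) (pw P L h vs) t x y z)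
  (kz P L h us vs a t x y) (- hdiv (us a) (vs a) t x y)
  (zi P L h (a - 1) t x y) (zi P L h a t x y)) as [_ ->].
- apply zi_pred_le; auto.
- intros z Hz. apply vertical_velocity_layer; assumption.
- unfold wl, zc. rewrite (zi_pred P L h a) by lia. field. lra.
Qed.

End VerticalVelocity.

(** * Energy of the layered flow *)

(** The arithmetic mean would be energy neutral; the upwind value differs from it by half a jump,
    with the sign that dissipates. *)
Lemma upwind_dissipation (G : nat -> hfield) f a t x y :
  G a t x y * (f (a + 1)%nat t x y - f a t x y)
    * ((f (a + 1)%nat t x y + f a t x y) / 2 - upwind G f a t x y)
  = - ((f (a + 1)%nat t x y - f a t x y) ^ 2 / 2 * Rabs (G a t x y)).
Proof.
unfold upwind. destruct (Rle_dec (G a t x y) 0).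
- rewrite Rabs_left1 by assumption. field.
- rewrite Rabs_right by lra. field.
Qed.

(** Stated for abstract fields, with h_a written [l * h], so that [auto_derive] meets variables
    only. The result isolates |u|^2 / 2 + g (h + b), the factor of the mass balance. *)
Lemma expd_El_flux (i : dir) (l g : R) (h b u v w S T : hfield) t x y :
  expd i h t x y -> expd i b t x y -> expd i u t x y -> expd i v t x y ->
  expd i w t x y -> expd i S t x y -> expd i T t x y ->
  expd i (fun t x y =>
    w t x y * (l * h t x y * (u t x y ^ 2 + v t x y ^ 2) / 2
      + g / 2 * (l * h t x y) * h t x y + g * (l * h t x y) * b t x y
      + g / 2 * (l * h t x y) * h t x y)
    - l * h t x y * (u t x y * S t x y + v t x y * T t x y)) t x y /\
  pd i (fun t x y =>
    w t x y * (l * h t x y * (u t x y ^ 2 + v t x y ^ 2) / 2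
      + g / 2 * (l * h t x y) * h t x y + g * (l * h t x y) * b t x y
      + g / 2 * (l * h t x y) * h t x y)
    - l * h t x y * (u t x y * S t x y + v t x y * T t x y)) t x y
  = (pd i w t x y * (l * h t x y) + w t x y * (l * pd i h t x y))
      * ((u t x y ^ 2 + v t x y ^ 2) / 2 + g * (h t x y + b t x y))
    + w t x y * (l * h t x y)
      * (u t x y * pd i u t x y + v t x y * pd i v t x y + g * (pd i h t x y + pd i b t x y))
    - (l * pd i h t x y * S t x y + l * h t x y * pd i S t x y) * u t x y
    - (l * pd i h t x y * T t x y + l * h t x y * pd i T t x y) * v t x y
    - l * h t x y * (S t x y * pd i u t x y + T t x y * pd i v t x y).
Proof.
intros Hh Hb Hu Hv Hw HS HT. rewrite !pd_slice. unfold expd in *.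
destruct i; simpl in *; split.
1, 3, 5: auto_derive; repeat split; assumption.
all: apply is_derive_unique; auto_derive; [repeat split; assumption | field].
Qed.

Lemma pd_El (i : dir) (l g : R) (h b u v : hfield) t x y :
  expd i h t x y -> expd i b t x y -> expd i u t x y -> expd i v t x y ->
  expd i (fun t x y => l * h t x y * (u t x y ^ 2 + v t x y ^ 2) / 2
      + g / 2 * (l * h t x y) * h t x y + g * (l * h t x y) * b t x y) t x y /\
  pd i (fun t x y => l * h t x y * (u t x y ^ 2 + v t x y ^ 2) / 2
      + g / 2 * (l * h t x y) * h t x y + g * (l * h t x y) * b t x y) t x y
  = l * pd i h t x y * ((u t x y ^ 2 + v t x y ^ 2) / 2 + g * (h t x y + b t x y))
    + l * h t x y * (u t x y * pd i u t x y + v t x y * pd i v t x y + g * pd i b t x y).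
Proof.
intros Hh Hb Hu Hv. rewrite !pd_slice. unfold expd in *.
destruct i; simpl in *; split.
1, 3, 5: auto_derive; repeat split; assumption.
all: apply is_derive_unique; auto_derive; [repeat split; assumption | field].
Qed.

Section Energy.
Variables (P : params) (Omega : R * R * R -> Prop) (L : layering) (h : hfield).
Hypotheses (HOmega : open Omega) (HP : valid_params P Omega)
  (HL : valid_layering L) (Hsmooth : hsmooth Omega h)
  (Hpos : forall t x y, Omega (t, x, y) -> 0 < h t x y).

Let Hbot : hsmooth Omega (bottom P).
Proof. apply HP. Qed.

Let Hnu : 0 < nu P.
Proof. destruct HP as [H1 [H2 _]]. apply Rdiv_lt_0_compat; assumption. Qed.

Variables (us vs : nat -> hfield).
Hypotheses (Hus : layers_smooth Omega L us) (Hvs : layers_smooth Omega L vs).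

Lemma energy_discretised : energy_terms_discretised P Omega L h us vs.
Proof.
unfold energy_terms_discretised. intros t x y H.
assert (Hh := Hpos t x y H).
assert (Pw : forall f a z, (1 <= a <= nlay L)%nat ->
  zi P L h (a - 1) t x y < z < zi P L h a t x y -> pw P L h f t x y z = f a t x y)
  by (intros; apply pw_open; auto).
split; [|split; [|split; [|split; [|split; [|split; [|split; [|split; [|split]]]]]]]].
- rewrite (column_layers P L h t x y HL Hh _
    (fun a => (us a t x y ^ 2 + vs a t x y ^ 2) / 2) (fun _ => grav P)).
  2:{ intros a z Ha Hz. unfold energy. rewrite !(Pw _ a) by assumption. reflexivity. }
  (* Potential energies agree only after summation: in one layer they differ by g h^2 / 2 times the
     increment of s - s^2, with s = [lsum], and s - s^2 vanishes at s = 1. *)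
  assert (E : forall n, sum_n_m (fun a => El P L h us vs a t x y) 1 n
    = sum_n_m (fun a => hl L h a t x y
        * ((us a t x y ^ 2 + vs a t x y ^ 2) / 2 + grav P * zc P L h a t x y)) 1 n
      + grav P / 2 * (h t x y ^ 2) * (lsum L n - lsum L n ^ 2) :> R).
  { induction n as [|n IH].
    - rewrite !sum1_O, lsum_0. ring.
    - rewrite !sum1_S, IH. unfold El, zc. rewrite !zi_lsum.
      rewrite (lsum_pred L (S n)) by lia. replace (S n - 1)%nat with n by lia.
      unfold hl. field. }
  rewrite E, lsum_N by assumption. match goal with |- ?a = ?b => change (a = b :> R) end. ring.
- rewrite (column_layers P L h t x y HL Hh _ (fun a => us a t x y *
    ((us a t x y ^ 2 + vs a t x y ^ 2) / 2 + grav P * eta P h t x y)) (fun _ => 0)).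
  + apply sum1_ext. intros a Ha. unfold layered_flux_inviscid, El, eta. field.
  + intros a z Ha Hz. unfold energy_flux, energy. rewrite !(Pw _ a) by assumption. ring.
- rewrite (column_layers P L h t x y HL Hh _ (fun a => vs a t x y *
    ((us a t x y ^ 2 + vs a t x y ^ 2) / 2 + grav P * eta P h t x y)) (fun _ => 0)).
  + apply sum1_ext. intros a Ha. unfold layered_flux_inviscid, El, eta. field.
  + intros a z Ha Hz. unfold energy_flux, energy. rewrite !(Pw _ a) by assumption. ring.
- intros a Ha. unfold layered_flux_viscous.
  assert (E : forall i f, layers_smooth Omega L f ->
    layer_stress P L h (pd i) (pw P L h f) a t x y
    = hl L h a t x y * cell_mean (Sig P L h (pd i) f) a t x y)
    by (intros; apply (layer_stress_Sig P Omega); auto).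
  assert (Ex := fun f => E Dirx f). assert (Ey := fun f => E Diry f). unfold pd in Ex, Ey.
  rewrite !Ex, !Ey by assumption. split; ring.
- unfold horizontal_dissipation. rewrite <- sum1_scal. apply sum1_ext. intros a Ha.
  assert (E : forall i f, layers_smooth Omega L f ->
    Sig P L h (pd i) f a t x y = nu P * dual_mean P L h (pd i) (pw P L h f) a t x y).
  { intros i f Hf. rewrite <- (dual_stress_Sig P Omega) by (auto; lia).
    unfold dual_stress. rewrite nui_in by lia. reflexivity. }
  assert (Ex := fun f => E Dirx f). assert (Ey := fun f => E Diry f). unfold pd in Ex, Ey.
  rewrite !Ex, !Ey, zc_hi, zc_lo by (assumption || lia). field. lra.
- unfold vertical_dissipation. rewrite <- sum1_scal. apply sum1_ext. intros a Ha.
  unfold dual_mean_z. cbv zeta. rewrite !(pw_zc P L h t x y HL Hh) by lia.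
  rewrite zc_hi, zc_lo by lia.
  assert (H1 := hl_pos L h a t x y HL Hh ltac:(lia)).
  assert (H2 := hl_pos L h (a + 1) t x y HL Hh ltac:(lia)).
  field. lra.
- symmetry; apply pw_bottom; assumption.
- symmetry; apply pw_bottom; assumption.
- symmetry; apply pw_eta; assumption.
- symmetry; apply pw_eta; assumption.
Qed.

(* What interface [b] contributes to the energy of the layer below it, resp. above it, through
   one component of the velocity, except for the potential energy. *)
Definition work_below (f : nat -> hfield) (b : nat) t x y : R :=
  let G := Gx L h us vs in
  let S d := Sig P L h d f b t x y in
  f b t x y * (upwind G f b t x y * G b t x y) - f b t x y ^ 2 / 2 * G b t x y
  - f b t x y * (S dx * dx (zi P L h b) t x y + S dy * dy (zi P L h b) t x y)
  - hl L h b t x y / 2 * (S dx * dx (f b) t x y + S dy * dy (f b) t x y)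
  + 2 * nui P L b * f b t x y
    * ((f (b + 1)%nat t x y - f b t x y) / (hl L h (b + 1) t x y + hl L h b t x y)).

(** Interface b is the lower face of layer b + 1: transport, slope and vertical friction change sign
    with respect to [work_below]. The stress work does not, since Sigma_a averages the two faces
    with weight 1/2 each. *)
Definition work_above (f : nat -> hfield) (b : nat) t x y : R :=
  let G := Gx L h us vs in
  let S d := Sig P L h d f b t x y in
  - f (b + 1)%nat t x y * (upwind G f b t x y * G b t x y)
  + f (b + 1)%nat t x y ^ 2 / 2 * G b t x y
  + f (b + 1)%nat t x y * (S dx * dx (zi P L h b) t x y + S dy * dy (zi P L h b) t x y)
  - hl L h (b + 1) t x y / 2
    * (S dx * dx (f (b + 1)%nat) t x y + S dy * dy (f (b + 1)%nat) t x y)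
  - 2 * nui P L b * f (b + 1)%nat t x y
    * ((f (b + 1)%nat t x y - f b t x y) / (hl L h (b + 1) t x y + hl L h b t x y)).

Lemma work_below_N f t x y : Gx L h us vs (nlay L) t x y = 0 -> work_below f (nlay L) t x y = 0.
Proof.
intros HG. unfold work_below. cbv zeta.
rewrite !Sig_nui_0, nui_N, HG by apply nui_N. ring.
Qed.

Lemma work_above_0 f t x y : work_above f 0 t x y = 0.
Proof.
unfold work_above. cbv zeta.
rewrite !Sig_nui_0, nui_0, Gx_0 by apply nui_0. ring.
Qed.

(** By definition of Sigma, half the weighted gradients minus slope times jump equals (h_{b+1} +
    h_b) Sigma / (2 nu). This is exactly what multiplies -Sigma in the sum of the two works, hence
    the square. *)
Lemma work_interface f b t x y : Omega (t, x, y) -> (1 <= b < nlay L)%nat ->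
  work_below f b t x y + work_above f b t x y
  = - ((f (b + 1)%nat t x y - f b t x y) ^ 2 / 2 * Rabs (Gx L h us vs b t x y))
    - (hl L h (b + 1) t x y + hl L h b t x y) / (2 * nu P)
      * (Sig P L h dx f b t x y ^ 2 + Sig P L h dy f b t x y ^ 2)
    - 2 * nu P * ((f (b + 1)%nat t x y - f b t x y) ^ 2
        / (hl L h (b + 1) t x y + hl L h b t x y)).
Proof.
intros H Hb. rewrite <- upwind_dissipation.
unfold work_below, work_above. cbv zeta.
assert (H1 := hl_pos L h b t x y HL (Hpos t x y H) ltac:(lia)).
assert (H2 := hl_pos L h (b + 1) t x y HL (Hpos t x y H) ltac:(lia)).
unfold Sig. rewrite nui_in by assumption. field. lra.
Qed.

Lemma energy_interface b t x y : Omega (t, x, y) -> (1 <= b < nlay L)%nat ->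
  (work_below us b t x y + work_below vs b t x y)
  + (work_above us b t x y + work_above vs b t x y)
  = - (((us (b + 1)%nat t x y - us b t x y) ^ 2 + (vs (b + 1)%nat t x y - vs b t x y) ^ 2) / 2
       * Rabs (Gx L h us vs b t x y))
    - (hl L h (b + 1) t x y + hl L h b t x y) / (2 * nu P)
      * (Sig P L h dx us b t x y ^ 2 + Sig P L h dy us b t x y ^ 2
         + Sig P L h dx vs b t x y ^ 2 + Sig P L h dy vs b t x y ^ 2)
    - 2 * nu P
      * (((us (b + 1)%nat t x y - us b t x y) ^ 2 + (vs (b + 1)%nat t x y - vs b t x y) ^ 2)
         / (hl L h (b + 1) t x y + hl L h b t x y)).
Proof.
intros H Hb.
assert (Eu := work_interface us b t x y H Hb). assert (Ev := work_interface vs b t x y H Hb).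
unfold Rdiv in *. lra.
Qed.

Lemma energy_layer a t x y : Omega (t, x, y) -> (1 <= a <= nlay L)%nat ->
  system_momentum P L h us vs us dx (tsx P) a t x y ->
  system_momentum P L h us vs vs dy (tsy P) a t x y ->
  dt (El P L h us vs a) t x y
  + hdiv (fun t x y => layered_flux_inviscid P L h us vs us a t x y
            - layered_flux_viscous P L h us vs dx a t x y)
         (fun t x y => layered_flux_inviscid P L h us vs vs a t x y
            - layered_flux_viscous P L h us vs dy a t x y) t x y
  = ((work_below us a t x y + work_below vs a t x y)
     + (work_above us (a - 1) t x y + work_above vs (a - 1) t x y))
    + grav P * eta P h t x y * (Gx L h us vs a t x y - Gx L h us vs (a - 1) t x y)
    - kappal P a * (us a t x y ^ 2 + vs a t x y ^ 2)
    + windl P L a t x y * (us a t x y * tsx P t x y + vs a t x y * tsy P t x y).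
Proof.
intros H Ha Mu Mv.
assert (Eh : forall i, expd i h t x y) by (intros; apply hsmooth_expd with Omega; assumption).
assert (Eb : forall i, expd i (bottom P) t x y)
  by (intros; apply hsmooth_expd with Omega; assumption).
assert (Ehl : forall i, expd i (hl L h a) t x y) by (intros; apply expd_hl, Eh).
assert (Eu : forall i, expd i (us a) t x y) by (intros; apply expd_layer with Omega L; auto).
assert (Ev : forall i, expd i (vs a) t x y) by (intros; apply expd_layer with Omega L; auto).
assert (ES : forall i j f, layers_smooth Omega L f ->
  expd i (cell_mean (Sig P L h (pd j) f) a) t x y).
{ intros i j f Hf.
  apply (expd_mult i t x y (fun t x y => Sig P L h (pd j) f a t x y
    + Sig P L h (pd j) f (a - 1) t x y) (fun _ _ _ => / 2)); [|apply expd_const].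
  apply expd_plus; apply expd_Sig with Omega; auto; lia. }
assert (ESu := fun i j => ES i j us Hus). assert (ESv := fun i j => ES i j vs Hvs). clear ES.
destruct (pd_El Dirt (frac L a) (grav P) h (bottom P) (us a) (vs a) t x y) as [_ D0]; auto.
destruct (expd_El_flux Dirx (frac L a) (grav P) h (bottom P) (us a) (vs a) (us a)
  (cell_mean (Sig P L h dx us) a) (cell_mean (Sig P L h dx vs) a) t x y) as [_ Dx'];
  auto; try apply (ESu Dirx Dirx); try apply (ESv Dirx Dirx).
destruct (expd_El_flux Diry (frac L a) (grav P) h (bottom P) (us a) (vs a) (vs a)
  (cell_mean (Sig P L h dy us) a) (cell_mean (Sig P L h dy vs) a) t x y) as [_ Dy'];
  auto; try apply (ESu Diry Diry); try apply (ESv Diry Diry).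
unfold hdiv.
change (dt (El P L h us vs a) t x y) with (pd Dirt (fun t x y =>
  frac L a * h t x y * (us a t x y ^ 2 + vs a t x y ^ 2) / 2
      + grav P / 2 * (frac L a * h t x y) * h t x y
      + grav P * (frac L a * h t x y) * bottom P t x y) t x y).
rewrite D0.
match goal with |- _ + (dx ?A t x y + dy ?B t x y) = _ =>
  change (dx A t x y) with (pd Dirx A t x y); change (dy B t x y) with (pd Diry B t x y) end.
match type of Dx' with ?A = _ => match goal with |- _ + (?B + _) = _ =>
  change B with A end end.
match type of Dy' with ?A = _ => match goal with |- _ + (_ + ?B) = _ =>
  change B with A end end.
rewrite Dx', Dy'. clear D0 Dx' Dy'.
assert (Mm := Gx_pred L h us vs a t x y ltac:(lia)).
unfold system_momentum in Mu, Mv. cbv zeta in Mu, Mv. unfold hdiv in Mu, Mv, Mm.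
assert (EP : forall i, pd i (fun t x y => grav P / 2 * h t x y * hl L h a t x y) t x y
  = grav P * (frac L a * h t x y) * pd i h t x y).
{ intros i. rewrite (pd_ext_on i Omega _
    (fun t x y => grav P / 2 * frac L a * (h t x y * h t x y)) t x y HOmega H)
    by (intros; unfold hl; ring).
  rewrite pd_scal, pd_mult by apply Eh. field. }
assert (EPx := EP Dirx). assert (EPy := EP Diry). clear EP. cbn [pd] in EPx, EPy.
rewrite EPx in Mu. rewrite EPy in Mv. clear EPx EPy.
(* A single form for all derivatives, since [expand_hmul] matches [pd] syntactically. *)
change (@dt) with (pd Dirt) in *. change (@dx) with (pd Dirx) in *.
change (@dy) with (pd Diry) in *.
assert (Euu : forall i, expd i (hmul (us a) (us a)) t x y) by (intros; apply expd_hmul; auto).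
assert (Euv : forall i, expd i (hmul (us a) (vs a)) t x y) by (intros; apply expd_hmul; auto).
assert (Evu : forall i, expd i (hmul (vs a) (us a)) t x y) by (intros; apply expd_hmul; auto).
assert (Evv : forall i, expd i (hmul (vs a) (vs a)) t x y) by (intros; apply expd_hmul; auto).
revert Mu Mv Mm.
assert (Cux := fun i => ESu i Dirx). assert (Cuy := fun i => ESu i Diry).
assert (Cvx := fun i => ESv i Dirx). assert (Cvy := fun i => ESv i Diry).
expand_hmul.
intros Mu Mv Mm.
rewrite !pd_hl in Mu, Mv, Mm.
(* The momentum equation is in conservative form: tested with the velocity it contains |u|^2 times
   the mass balance, whereas the kinetic energy wants half of it. Hence the multiplier g eta - |u|^2
   / 2 of the mass balance. *)
apply (f_equal (Rmult (us a t x y))) in Mu. apply (f_equal (Rmult (vs a t x y))) in Mv.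
apply (f_equal (Rmult (grav P * eta P h t x y - (us a t x y ^ 2 + vs a t x y ^ 2) / 2))) in Mm.
unfold work_below, work_above. cbv zeta. replace (a - 1 + 1)%nat with a by lia.
change (frac L a * h t x y) with (hl L h a t x y) in *.
change (@dx) with (pd Dirx). change (@dy) with (pd Diry).
assert (B0 : pd Dirt (bottom P) t x y = 0) by exact (Derive_const _ _).
rewrite B0. unfold hmul, cell_mean, Rdiv in *.
change (eta P h t x y) with (h t x y + bottom P t x y) in *.
lra.
Qed.

Lemma energy_balance_layered : layer_averaged_system P Omega L h us vs ->
  layered_energy_balance P Omega L h us vs.
Proof.
intros HS t x y H. destruct (HS t x y H) as [Hm HM].
assert (HN : (1 <= nlay L)%nat) by apply HL.
assert (GN : Gx L h us vs (nlay L) t x y = 0) by (apply Gx_N; exact Hm).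
assert (Eh : forall i, expd i h t x y) by (intros; apply hsmooth_expd with Omega; assumption).
assert (Eb : forall i, expd i (bottom P) t x y)
  by (intros; apply hsmooth_expd with Omega; assumption).
assert (EL : forall i f a, layers_smooth Omega L f -> (1 <= a <= nlay L)%nat -> expd i (f a) t x y)
  by (intros; apply expd_layer with Omega L; auto).
assert (ES : forall i j f a, layers_smooth Omega L f -> (1 <= a <= nlay L)%nat ->
  expd i (cell_mean (Sig P L h (pd j) f) a) t x y).
{ intros i j f a Hf Ha.
  apply (expd_mult i t x y (fun t x y => Sig P L h (pd j) f a t x y
    + Sig P L h (pd j) f (a - 1) t x y) (fun _ _ _ => / 2)); [|apply expd_const].
  apply expd_plus; apply expd_Sig with Omega; auto; lia. }
unfold hdiv.
assert (E0 : dt (fun t x y => sum_n_m (fun a => El P L h us vs a t x y) 1 (nlay L)) t x y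
  = sum_n_m (fun a => dt (El P L h us vs a) t x y) 1 (nlay L) :> R).
{ apply (pd_sum Dirt t x y (El P L h us vs)). intros a Ha.
  apply (pd_El Dirt (frac L a) (grav P) h (bottom P) (us a) (vs a) t x y); auto. }
assert (Ef : forall i f, layers_smooth Omega L f ->
  pd i (layered_flux P L h us vs f (pd i)) t x y
  = sum_n_m (fun a => pd i (fun t x y => layered_flux_inviscid P L h us vs f a t x y
            - layered_flux_viscous P L h us vs (pd i) a t x y) t x y) 1 (nlay L) :> R).
{ intros i f Hf.
  apply (pd_sum i t x y (fun a t x y => layered_flux_inviscid P L h us vs f a t x y
            - layered_flux_viscous P L h us vs (pd i) a t x y)).
  intros a Ha.
  apply (expd_El_flux i (frac L a) (grav P) h (bottom P) (us a) (vs a) (f a)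
    (cell_mean (Sig P L h (pd i) us) a) (cell_mean (Sig P L h (pd i) vs) a) t x y); auto. }
rewrite E0.
rewrite (Ef Dirx us Hus : dx (layered_flux P L h us vs us dx) t x y = _).
rewrite (Ef Diry vs Hvs : dy (layered_flux P L h us vs vs dy) t x y = _).
rewrite <- !sum1_plus.
(* The factor g eta is the same in all layers, so its flux terms cancel across interior interfaces
   and vanish with G at the two ends. *)
rewrite (sum1_ext _ (fun a =>
   ((work_below us a t x y + work_below vs a t x y + grav P * eta P h t x y * Gx L h us vs a t x y)
     + (work_above us (a - 1) t x y + work_above vs (a - 1) t x y
        - grav P * eta P h t x y * Gx L h us vs (a - 1) t x y))
   + ((if Nat.eqb a 1 then - kappa P * (us 1%nat t x y ^ 2 + vs 1%nat t x y ^ 2) else 0)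
   + (if Nat.eqb a (nlay L) then wind P t x y * (us (nlay L) t x y * tsx P t x y
        + vs (nlay L) t x y * tsy P t x y) else 0)))).
2:{ intros a Ha. destruct (HM a Ha) as [Mu Mv].
  assert (E := energy_layer a t x y H Ha Mu Mv). unfold hdiv in E.
  etransitivity; [exact E|]. unfold kappal, windl.
  destruct (Nat.eqb_spec a 1) as [E1|_], (Nat.eqb_spec a (nlay L)) as [E2|_];
    rewrite <- ?E2, <- ?E1; ring. }
rewrite sum1_plus.
rewrite (sum1_interfaces
  (fun a => work_below us a t x y + work_below vs a t x y
     + grav P * eta P h t x y * Gx L h us vs a t x y)
  (fun a => work_above us a t x y + work_above vs a t x y
        - grav P * eta P h t x y * Gx L h us vs a t x y)) by lia.
rewrite !work_below_N, !work_above_0, GN, Gx_0 by assumption.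
assert (ED : sum_n_m (fun b =>
   work_below us b t x y + work_below vs b t x y + grav P * eta P h t x y * Gx L h us vs b t x y
   + (work_above us b t x y + work_above vs b t x y
      - grav P * eta P h t x y * Gx L h us vs b t x y)) 1 (nlay L - 1)
  = - exchange_dissipation L h us vs t x y - horizontal_dissipation P L h us vs t x y
    - vertical_dissipation P L h us vs t x y :> R).
{ unfold exchange_dissipation, horizontal_dissipation, vertical_dissipation.
  match goal with |- _ = - ?A - ?B - ?C =>
    replace (- A - B - C) with (-1 * A + -1 * B + -1 * C) by ring end.
  rewrite <- !sum1_scal, <- !sum1_plus. apply sum1_ext. intros b Hb.
  assert (E := energy_interface b t x y H ltac:(lia)). lra. }
rewrite ED, sum1_plus, !sum1_indicator by lia. ring.
Qed.

End Energy.

(** * Leibniz' rule *)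

Lemma locally_R (x : R) (Q : R -> Prop) (d : posreal) :
  (forall y, Rabs (y - x) < d -> Q y) -> locally x Q.
Proof. intros H. exists d. intros y Hy. apply H, Hy. Qed.

(** Compactness of the segment gives one radius for all its points. The margin beyond both ends
    leaves room for moving limits of integration. *)
Lemma tube (V : R -> R -> Prop) s a b : a <= b ->
  (forall z, a <= z <= b -> locally_2d V s z) ->
  exists d : posreal, forall s' z, Rabs (s' - s) < d -> a - d < z < b + d -> V s' z.
Proof.
intros Hab H.
assert (H' : forall z, exists d : posreal, a <= z <= b ->
  forall s' z', Rabs (s' - s) < d -> Rabs (z' - z) < d -> V s' z').
{ intros z. destruct (classic (a <= z <= b)) as [Hz|Hz].
  - destruct (H z Hz) as [d Hd]. exists d. auto.
  (* A default radius off the segment, making [r] total as the compactness lemma requires. *)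
  - exists (mkposreal 1 Rlt_0_1). tauto. }
set (r := fun z => proj1_sig (constructive_indefinite_description _ (H' z))).
assert (Hr : forall z, a <= z <= b ->
  forall s' z', Rabs (s' - s) < r z -> Rabs (z' - z) < r z -> V s' z')
  by (intros z; exact (proj2_sig (constructive_indefinite_description _ (H' z)))).
(* Radii are halved: z is within d of its projection [c] on the segment, and [c] within r q / 2 of
   the centre [q], with d <= r q / 2. The covering comes under a double negation, hence the argument
   by contradiction. *)
destruct (compactness_value_1d a b (fun z => pos_div_2 (r z))) as [d Hd].
exists d. intros s' z Hs Hz. apply NNPP. intros HV.
set (c := Rmax a (Rmin z b)).
assert (Hc : a <= c <= b /\ Rabs (z - c) < d).
{ unfold c, Rmax, Rmin. assert (0 < d) by apply cond_pos.
  destruct (Rle_dec z b); destruct (Rle_dec a _); split; try lra; apply Rabs_def1; lra. }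
apply (Hd c (proj1 Hc)). intros [q [Hq [H1 H2]]]. apply HV. simpl in H1, H2.
assert (Hrq : 0 < r q) by apply cond_pos.
apply (Hr q Hq); [lra|].
replace (z - q) with ((z - c) + (c - q)) by ring.
apply Rle_lt_trans with (1 := Rabs_triang _ _). lra.
Qed.

Lemma continuity_2d_continuous (F : R -> R -> R) s z :
  continuity_2d_pt F s z -> continuous (F s) z.
Proof.
intros H. apply filterlim_locally. intros eps. destruct (H eps) as [d Hd].
apply (locally_R z _ d). intros y Hy. apply Hd; [|exact Hy].
rewrite Rminus_diag, Rabs_R0. apply cond_pos.
Qed.

(** [V] is the region where [F] is regular. A single tube inside it provides all the local
    conditions of the rule for integrals with a parameter, along the segment and around both
    ends. *)
Lemma is_derive_RInt_leibniz (V : R -> R -> Prop) (F : R -> R -> R) (a b : R -> R) s :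
  a s <= b s -> ex_derive a s -> ex_derive b s ->
  (forall z, a s <= z <= b s -> locally_2d V s z) ->
  (forall s z, V s z -> ex_derive (fun r => F r z) s /\ continuity_2d_pt F s z /\
     continuity_2d_pt (fun r z => Derive (fun q => F q z) r) s z) ->
  is_derive (fun s => RInt (fun z => F s z) (a s) (b s)) s
    (RInt (fun z => Derive (fun q => F q z) s) (a s) (b s)
     + - F s (a s) * Derive a s + F s (b s) * Derive b s).
Proof.
intros Hab Ha Hb HV HF.
destruct (tube V s (a s) (b s) Hab HV) as [d Hd].
assert (Hd0 : 0 < d) by apply cond_pos.
assert (Hs : Rabs (s - s) < d) by (rewrite Rminus_diag, Rabs_R0; exact Hd0).
assert (Int : forall s' c e, Rabs (s' - s) < d -> a s - d < c -> c <= e -> e < b s + d ->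
  ex_RInt (fun z => F s' z) c e).
{ intros s' c e Hs' Hc Hce He. apply (ex_RInt_continuous (V := R_CompleteNormedModule)).
  rewrite Rmin_left, Rmax_right by lra. intros z Hz.
  apply continuity_2d_continuous, HF, Hd; [assumption | lra]. }
(* The tube is open, so closed segments overshooting the ends use the margin d / 2. *)
assert (Hd2 : pos (pos_div_2 d) = d / 2) by reflexivity.
apply is_derive_RInt_param_bound_comp.
- apply (locally_R s _ d). intros s' Hs'. apply Int; lra.
- exists (pos_div_2 d). rewrite Hd2. apply (locally_R s _ d). intros s' Hs'. apply Int; lra.
- exists (pos_div_2 d). rewrite Hd2. apply (locally_R s _ d). intros s' Hs'. apply Int; lra.
- apply Derive_correct, Ha.
- apply Derive_correct, Hb.
- exists (pos_div_2 d). rewrite Hd2. apply (locally_R s _ d). intros s' Hs' z Hz.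
  rewrite Rmin_left, Rmax_right in Hz by lra. apply HF, Hd; [assumption | lra].
- intros z Hz. rewrite Rmin_left, Rmax_right in Hz by lra.
  apply HF, Hd; [assumption | lra].
- exists d. intros s' z Hs' Hz. apply Rabs_def2 in Hz. apply HF, Hd; [assumption | lra].
- exists d. intros s' z Hs' Hz. apply Rabs_def2 in Hz. apply HF, Hd; [assumption | lra].
- apply continuity_pt_filterlim, continuity_2d_continuous, HF, Hd; [assumption | lra].
- apply continuity_pt_filterlim, continuity_2d_continuous, HF, Hd; [assumption | lra].
Qed.

(** * Smooth fields of (t, x, y, z) *)

Definition Dd (i : dir) : vfield -> vfield :=
  match i with Dirt => Dt | Dirx => Dx | Diry => Dy end.

Lemma open_slices4 (D : R * R * R * R -> Prop) t x y z : open D -> D (t, x, y, z) ->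
  locally t (fun s => D (s, x, y, z)) /\ locally x (fun s => D (t, s, y, z)) /\
  locally y (fun s => D (t, x, s, z)) /\ locally z (fun s => D (t, x, y, s)).
Proof.
intros HD H. destruct (HD _ H) as [eps He].
repeat split; exists eps; intros s Hs; apply He; repeat split; simpl in *; auto; apply ball_center.
Qed.

(** [vCk] recurses on the derivative fields themselves, and rules such as the product rule identify
    these on [D] only; openness transfers the property. *)
Lemma vCk_ext k (D : R * R * R * R -> Prop) f g : open D ->
  (forall t x y z, D (t, x, y, z) -> f t x y z = g t x y z) -> vCk k D f -> vCk k D g.
Proof.
intros HD. revert f g. induction k as [|k IH]; intros f g E [Hc Hd].
all: assert (Hc' : forall t x y z, D (t, x, y, z) -> continuous (fun q : R * R * R * R =>
       g (fst (fst (fst q))) (snd (fst (fst q))) (snd (fst q)) (snd q)) (t, x, y, z)).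
1, 3: intros t x y z H; apply continuous_ext_loc with (2 := Hc t x y z H);
  generalize (HD _ H); apply filter_imp; intros [[[t' x'] y'] z'] H'; apply E, H'.
1: split; [exact Hc' | exact I].
destruct Hd as [He [H0 [H1 [H2 H3]]]]. split; [exact Hc'|].
split; [|repeat split].
- intros t x y z H. destruct (open_slices4 D t x y z HD H) as [L0 [L1 [L2 L3]]].
  destruct (He t x y z H) as [E0 [E1 [E2 E3]]].
  repeat split; [revert E0 | revert E1 | revert E2 | revert E3]; apply ex_derive_ext_loc;
    [revert L0 | revert L1 | revert L2 | revert L3]; apply filter_imp; intros s; apply E.
- apply IH with (2 := H0). intros t x y z H. apply Derive_ext_loc.
  destruct (open_slices4 D t x y z HD H) as [L0 [L1 [L2 L3]]].
  revert L0; apply filter_imp; intros s; apply E.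
- apply IH with (2 := H1). intros t x y z H. apply Derive_ext_loc.
  destruct (open_slices4 D t x y z HD H) as [L0 [L1 [L2 L3]]].
  revert L1; apply filter_imp; intros s; apply E.
- apply IH with (2 := H2). intros t x y z H. apply Derive_ext_loc.
  destruct (open_slices4 D t x y z HD H) as [L0 [L1 [L2 L3]]].
  revert L2; apply filter_imp; intros s; apply E.
- apply IH with (2 := H3). intros t x y z H. apply Derive_ext_loc.
  destruct (open_slices4 D t x y z HD H) as [L0 [L1 [L2 L3]]].
  revert L3; apply filter_imp; intros s; apply E.
Qed.

Lemma vsmooth_ext (D : R * R * R * R -> Prop) f g : open D ->
  (forall t x y z, D (t, x, y, z) -> f t x y z = g t x y z) -> vsmooth D f -> vsmooth D g.
Proof. intros HD E Hf k. exact (vCk_ext k D f g HD E (Hf k)). Qed.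

Lemma vsmooth_subset (D D' : R * R * R * R -> Prop) f :
  (forall q, D' q -> D q) -> vsmooth D f -> vsmooth D' f.
Proof.
intros HD Hf k. generalize (Hf k). clear Hf. revert f.
induction k as [|k IH]; intros f [Hc Hd]; (split; [intros; apply Hc, HD; assumption|]).
- exact I.
- destruct Hd as [He [H0 [H1 [H2 H3]]]].
  split; [intros; apply He, HD; assumption | auto].
Qed.

Section SmoothAlgebra.
Variable D : R * R * R * R -> Prop.
Hypothesis HD : open D.

Lemma vsmooth_ex_derive f t x y z : vsmooth D f -> D (t, x, y, z) ->
  ex_derive (fun s => f s x y z) t /\ ex_derive (fun s => f t s y z) x /\
  ex_derive (fun s => f t x s z) y /\ ex_derive (fun s => f t x y s) z.
Proof. intros Hf H. destruct (Hf 1%nat) as [_ [He _]]. apply He, H. Qed.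

Lemma vsmooth_Dd i f : vsmooth D f -> vsmooth D (Dd i f).
Proof. intros Hf k. destruct (Hf (S k)) as [_ [_ [? [? [? ?]]]]]. destruct i; assumption. Qed.

Lemma vsmooth_Dz f : vsmooth D f -> vsmooth D (Dz f).
Proof. intros Hf k. destruct (Hf (S k)) as [_ [_ [? [? [? ?]]]]]. assumption. Qed.

Lemma vCk_const k c : vCk k D (fun _ _ _ _ => c).
Proof.
revert c. induction k as [|k IH]; intros c; (split; [intros; apply continuous_const|]).
- exact I.
- split; [intros; repeat split; apply ex_derive_const|].
  repeat split; apply vCk_ext with (f := fun _ _ _ _ => 0); auto;
    intros; symmetry; exact (Derive_const _ _).
Qed.

Lemma vCk_plus k f g : vCk k D f -> vCk k D g ->
  vCk k D (fun t x y z => f t x y z + g t x y z).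
Proof.
revert f g. induction k as [|k IH]; intros f g [Hf Hf'] [Hg Hg'].
- split; [|exact I]. intros t x y z H.
  apply (continuous_plus (V := R_NormedModule)); [apply Hf, H | apply Hg, H].
- split.
  { intros t x y z H.
    apply (continuous_plus (V := R_NormedModule)); [apply Hf, H | apply Hg, H]. }
  destruct Hf' as [Ef [F0 [F1 [F2 F3]]]], Hg' as [Eg [G0 [G1 [G2 G3]]]].
  split; [|repeat split].
  + intros t x y z H. destruct (Ef _ _ _ _ H) as [? [? [? ?]]], (Eg _ _ _ _ H) as [? [? [? ?]]].
    repeat split; apply (ex_derive_plus (V := R_NormedModule)); assumption.
  + apply vCk_ext with (3 := IH _ _ F0 G0); auto. intros t x y z H. symmetry.
    destruct (Ef _ _ _ _ H) as [e0 [e1 [e2 e3]]], (Eg _ _ _ _ H) as [e0' [e1' [e2' e3']]].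
    exact (Derive_plus (fun s => f s x y z) (fun s => g s x y z) t e0 e0').
  + apply vCk_ext with (3 := IH _ _ F1 G1); auto. intros t x y z H. symmetry.
    destruct (Ef _ _ _ _ H) as [e0 [e1 [e2 e3]]], (Eg _ _ _ _ H) as [e0' [e1' [e2' e3']]].
    exact (Derive_plus (fun s => f t s y z) (fun s => g t s y z) x e1 e1').
  + apply vCk_ext with (3 := IH _ _ F2 G2); auto. intros t x y z H. symmetry.
    destruct (Ef _ _ _ _ H) as [e0 [e1 [e2 e3]]], (Eg _ _ _ _ H) as [e0' [e1' [e2' e3']]].
    exact (Derive_plus (fun s => f t x s z) (fun s => g t x s z) y e2 e2').
  + apply vCk_ext with (3 := IH _ _ F3 G3); auto. intros t x y z H. symmetry.
    destruct (Ef _ _ _ _ H) as [e0 [e1 [e2 e3]]], (Eg _ _ _ _ H) as [e0' [e1' [e2' e3']]].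
    exact (Derive_plus (fun s => f t x y s) (fun s => g t x y s) z e3 e3').
Qed.

Lemma vsmooth_const c : vsmooth D (fun _ _ _ _ => c).
Proof. intros k. apply vCk_const. Qed.

Lemma vsmooth_plus f g : vsmooth D f -> vsmooth D g ->
  vsmooth D (fun t x y z => f t x y z + g t x y z).
Proof. intros Hf Hg k. apply vCk_plus; auto. Qed.

(** The induction on the order keeps both factors fully smooth, so that its hypothesis applies to a
    factor paired with a derivative of the other. *)
Lemma vsmooth_mult f g : vsmooth D f -> vsmooth D g ->
  vsmooth D (fun t x y z => f t x y z * g t x y z).
Proof.
intros Hf Hg k. revert f g Hf Hg. induction k as [|k IH]; intros f g Hf Hg.
- split; [|exact I]. intros t x y z H.
  apply (continuous_mult (K := R_AbsRing)); [apply (Hf 0%nat), H | apply (Hg 0%nat), H].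
- split.
  { intros t x y z H.
    apply (continuous_mult (K := R_AbsRing)); [apply (Hf 0%nat), H | apply (Hg 0%nat), H]. }
  assert (Ef := fun t x y z => vsmooth_ex_derive f t x y z Hf).
  assert (Eg := fun t x y z => vsmooth_ex_derive g t x y z Hg).
  assert (S : forall f' g', vsmooth D f' -> vsmooth D g' ->
    vCk k D (fun t x y z => f' t x y z * g t x y z + f t x y z * g' t x y z))
    by (intros; apply vCk_plus; apply IH; assumption).
  split; [|repeat split].
  + intros t x y z H. destruct (Ef _ _ _ _ H) as [? [? [? ?]]], (Eg _ _ _ _ H) as [? [? [? ?]]].
    repeat split; apply ex_derive_mult; assumption.
  + apply vCk_ext with (3 := S _ _ (vsmooth_Dd Dirt f Hf) (vsmooth_Dd Dirt g Hg)); auto.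
    intros t x y z H. symmetry.
    destruct (Ef _ _ _ _ H) as [e0 [e1 [e2 e3]]], (Eg _ _ _ _ H) as [e0' [e1' [e2' e3']]].
    exact (Derive_mult (fun s => f s x y z) (fun s => g s x y z) t e0 e0').
  + apply vCk_ext with (3 := S _ _ (vsmooth_Dd Dirx f Hf) (vsmooth_Dd Dirx g Hg)); auto.
    intros t x y z H. symmetry.
    destruct (Ef _ _ _ _ H) as [e0 [e1 [e2 e3]]], (Eg _ _ _ _ H) as [e0' [e1' [e2' e3']]].
    exact (Derive_mult (fun s => f t s y z) (fun s => g t s y z) x e1 e1').
  + apply vCk_ext with (3 := S _ _ (vsmooth_Dd Diry f Hf) (vsmooth_Dd Diry g Hg)); auto.
    intros t x y z H. symmetry.
    destruct (Ef _ _ _ _ H) as [e0 [e1 [e2 e3]]], (Eg _ _ _ _ H) as [e0' [e1' [e2' e3']]].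
    exact (Derive_mult (fun s => f t x s z) (fun s => g t x s z) y e2 e2').
  + apply vCk_ext with (3 := S _ _ (vsmooth_Dz f Hf) (vsmooth_Dz g Hg)); auto.
    intros t x y z H. symmetry.
    destruct (Ef _ _ _ _ H) as [e0 [e1 [e2 e3]]], (Eg _ _ _ _ H) as [e0' [e1' [e2' e3']]].
    exact (Derive_mult (fun s => f t x y s) (fun s => g t x y s) z e3 e3').
Qed.

Lemma vsmooth_scal c f : vsmooth D f -> vsmooth D (fun t x y z => c * f t x y z).
Proof. apply (vsmooth_mult (fun _ _ _ _ => c)), vsmooth_const. Qed.

Lemma vsmooth_minus f g : vsmooth D f -> vsmooth D g ->
  vsmooth D (fun t x y z => f t x y z - g t x y z).
Proof.
intros Hf Hg. apply (vsmooth_ext D (fun t x y z => f t x y z + -1 * g t x y z) _ HD).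
- intros; ring.
- apply vsmooth_plus; [|apply vsmooth_scal]; assumption.
Qed.

Lemma vsmooth_z : vsmooth D (fun _ _ _ z => z).
Proof.
intros k. destruct k as [|k]; (split; [intros; apply continuous_snd|]).
- exact I.
- split; [intros; repeat split; (apply ex_derive_const || apply ex_derive_id)|].
  repeat split;
    [apply vCk_ext with (f := fun _ _ _ _ => 0); auto using vCk_const ..
    |apply vCk_ext with (f := fun _ _ _ _ => 1); auto using vCk_const];
    intros; symmetry; (exact (Derive_const _ _) || exact (Derive_id _)).
Qed.

Lemma vsmooth_lift (Omega : R * R * R -> Prop) f : (forall q, D q -> Omega (fst q)) ->
  hsmooth Omega f -> vsmooth D (fun t x y _ => f t x y).
Proof.
intros HO Hf k. generalize (Hf k). clear Hf. revert f.
induction k as [|k IH]; intros f [Hc Hd].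
all: split; [intros t x y z H;
  apply (continuous_comp (fun q : R * R * R * R => fst q)
    (fun q : R * R * R => f (fst (fst q)) (snd (fst q)) (snd q)));
  [apply continuous_fst | apply Hc, (HO _ H)] |].
- exact I.
- destruct Hd as [He [H0 [H1 H2]]]. split; [|repeat split].
  + intros t x y z H. destruct (He t x y (HO _ H)) as [? [? ?]].
    repeat split; try assumption. apply ex_derive_const.
  + exact (IH _ H0).
  + exact (IH _ H1).
  + exact (IH _ H2).
  + apply vCk_ext with (f := fun _ _ _ _ => 0); auto using vCk_const.
    intros; symmetry; exact (Derive_const _ _).
Qed.

Lemma continuous_pair {T U W : UniformSpace} (f : T -> U) (g : T -> W) q :
  continuous f q -> continuous g q -> continuous (fun r => (f r, g r)) q.
Proof.
intros Hf Hg. apply (continuous_comp_2 f g (fun a b => (a, b)) q Hf Hg).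
apply continuous_ext with (f := fun r => r); [intros [? ?]; reflexivity | apply continuous_id].
Qed.

Definition vslice (i : dir) (f : vfield) (t x y : R) : R -> R -> R :=
  match i with
  | Dirt => fun s z => f s x y z
  | Dirx => fun s z => f t s y z
  | Diry => fun s z => f t x s z
  end.

Definition vpoint (i : dir) (t x y s z : R) : R * R * R * R :=
  match i with
  | Dirt => (s, x, y, z)
  | Dirx => (t, s, y, z)
  | Diry => (t, x, s, z)
  end.

Lemma vslice_continuity_2d i f t x y s z : vsmooth D f -> D (vpoint i t x y s z) ->
  continuity_2d_pt (vslice i f t x y) s z.
Proof.
intros Hf H. apply continuity_2d_pt_filterlim.
assert (C0 : continuous (fun q : R * R => fst q) (s, z)) by apply continuous_fst.
assert (C1 : continuous (fun q : R * R => snd q) (s, z)) by apply continuous_snd.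
destruct (Hf 0%nat) as [Hc _].
assert (Cv : continuous (fun q : R * R => vpoint i t x y (fst q) (snd q)) (s, z)).
{ destruct i; simpl; repeat apply continuous_pair; auto using continuous_const. }
destruct i; exact (continuous_comp _ (fun q : R * R * R * R =>
  f (fst (fst (fst q))) (snd (fst (fst q))) (snd (fst q)) (snd q)) _ Cv (Hc _ _ _ _ H)).
Qed.

Lemma vpoint_locally i t x y z : D (t, x, y, z) ->
  locally_2d (fun s z => D (vpoint i t x y s z)) (coord i t x y) z.
Proof.
intros H. destruct (HD _ H) as [eps He]. exists eps. intros s z' Hs Hz. apply He.
destruct i; repeat split; simpl in *; try apply ball_center; assumption.
Qed.

Lemma is_derive_zint i f (a b : hfield) t x y : vsmooth D f ->
  a t x y <= b t x y -> (forall z, a t x y <= z <= b t x y -> D (t, x, y, z)) ->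
  expd i a t x y -> expd i b t x y ->
  is_derive (slice i (zint f a b) t x y) (coord i t x y)
    (zint (Dd i f) a b t x y
     + f t x y (b t x y) * pd i b t x y - f t x y (a t x y) * pd i a t x y).
Proof.
intros Hf Hab HI Ha Hb.
assert (H := is_derive_RInt_leibniz (fun s z => D (vpoint i t x y s z)) (vslice i f t x y)
  (slice i a t x y) (slice i b t x y) (coord i t x y)).
rewrite !slice_coord in H. specialize (H Hab Ha Hb).
replace (zint (Dd i f) a b t x y
     + f t x y (b t x y) * pd i b t x y - f t x y (a t x y) * pd i a t x y)
  with (RInt (fun z => Derive (fun q => vslice i f t x y q z) (coord i t x y)) (a t x y) (b t x y)
     + - vslice i f t x y (coord i t x y) (a t x y) * Derive (slice i a t x y) (coord i t x y)
     + vslice i f t x y (coord i t x y) (b t x y) * Derive (slice i b t x y) (coord i t x y)).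
- destruct i; apply H.
  1, 3, 5: intros z Hz; apply vpoint_locally, HI, Hz.
  1-3: intros s z HV; split; [|split; [apply vslice_continuity_2d; assumption|]].
  1, 3, 5: apply (vsmooth_ex_derive f _ _ _ _ Hf HV).
  1: exact (vslice_continuity_2d Dirt (Dd Dirt f) t x y s z (vsmooth_Dd Dirt f Hf) HV).
  1: exact (vslice_continuity_2d Dirx (Dd Dirx f) t x y s z (vsmooth_Dd Dirx f Hf) HV).
  1: exact (vslice_continuity_2d Diry (Dd Diry f) t x y s z (vsmooth_Dd Diry f Hf) HV).
- unfold zint. destruct i; simpl; unfold dt, dx, dy, Dt, Dx, Dy; ring.
Qed.

Lemma pd_zint i f (a b : hfield) t x y : vsmooth D f ->
  a t x y <= b t x y -> (forall z, a t x y <= z <= b t x y -> D (t, x, y, z)) ->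
  expd i a t x y -> expd i b t x y ->
  pd i (zint f a b) t x y
  = zint (Dd i f) a b t x y
    + f t x y (b t x y) * pd i b t x y - f t x y (a t x y) * pd i a t x y.
Proof.
intros. rewrite pd_slice. apply is_derive_unique, is_derive_zint; assumption.
Qed.

Lemma vsmooth_continuous_z f t x y z : vsmooth D f -> D (t, x, y, z) ->
  continuous (fun s => f t x y s) z.
Proof.
intros Hf H. apply (ex_derive_continuous (V := R_NormedModule)).
apply (vsmooth_ex_derive f t x y z Hf H).
Qed.

Lemma vsmooth_ex_RInt f t x y a b : vsmooth D f -> a <= b ->
  (forall z, a <= z <= b -> D (t, x, y, z)) -> ex_RInt (fun z => f t x y z) a b.
Proof.
intros Hf Hab HI. apply (ex_RInt_continuous (V := R_CompleteNormedModule)).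
rewrite Rmin_left, Rmax_right by assumption. intros z Hz.
apply vsmooth_continuous_z; auto.
Qed.

Lemma RInt_Dz f t x y a b : vsmooth D f -> a <= b ->
  (forall z, a <= z <= b -> D (t, x, y, z)) ->
  RInt (fun z => Dz f t x y z) a b = f t x y b - f t x y a.
Proof.
intros Hf Hab HI. apply (RInt_Derive (fun z => f t x y z));
  rewrite Rmin_left, Rmax_right by assumption; intros z Hz.
- apply (vsmooth_ex_derive f t x y z); auto.
- apply (vsmooth_continuous_z (Dz f)); auto using vsmooth_Dz.
Qed.

End SmoothAlgebra.

(** * The continuous system *)

Section Integrals.
Variables (D : R * R * R * R -> Prop) (t x y a b : R).
Hypotheses (HD : open D) (Hab : a <= b) (HI : forall z, a <= z <= b -> D (t, x, y, z)).

Lemma vint_ext (f g : vfield) : (forall z, a < z < b -> f t x y z = g t x y z) ->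
  RInt (fun z => f t x y z) a b = RInt (fun z => g t x y z) a b.
Proof.
intros H. apply (RInt_ext (V := R_CompleteNormedModule)).
rewrite Rmin_left, Rmax_right by assumption. exact H.
Qed.

(** An equation with all its terms on one side, encoded as a list so that integrability and
    linearity of the integral are settled once for any number of terms. *)
Definition lincomb (l : list (R * vfield)) : vfield := fun t x y z =>
  fold_right (fun cf r => fst cf * snd cf t x y z + r) 0 l.

Lemma vint_lincomb (l : list (R * vfield)) : List.Forall (fun cf => vsmooth D (snd cf)) l ->
  (forall z, a < z < b -> lincomb l t x y z = 0) ->
  fold_right (fun cf r => fst cf * RInt (fun z => snd cf t x y z) a b + r) 0 l = 0.
Proof.
intros Hl E.
assert (I : vsmooth D (lincomb l) /\ RInt (fun z => lincomb l t x y z) a b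
  = fold_right (fun cf r => fst cf * RInt (fun z => snd cf t x y z) a b + r) 0 l).
{ clear E. induction Hl as [|[c f] l Hf Hl [S IH]].
  - split; [exact (vsmooth_const D HD 0)|]. unfold lincomb; simpl.
    rewrite (RInt_const (V := R_CompleteNormedModule)). apply Rmult_0_r.
  - assert (Hc := vsmooth_scal D HD c _ Hf). split.
    + exact (vsmooth_plus D HD _ _ Hc S).
    + assert (If := vsmooth_ex_RInt D f t x y a b Hf Hab HI).
      assert (Is := vsmooth_ex_RInt D _ t x y a b S Hab HI).
      exact (eq_trans (RInt_plus _ _ _ _ (ex_RInt_scal _ _ _ c If) Is)
        (f_equal2 Rplus (RInt_scal _ _ _ c If) IH)). }
rewrite <- (proj2 I).
rewrite (vint_ext (lincomb l) (fun _ _ _ _ => 0) E).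
rewrite (RInt_const (V := R_CompleteNormedModule)). apply Rmult_0_r.
Qed.

End Integrals.

Lemma metric_pos f t x y : 0 < metric f t x y.
Proof.
unfold metric. apply sqrt_lt_R0.
assert (0 <= dx f t x y ^ 2) by apply pow2_ge_0.
assert (0 <= dy f t x y ^ 2) by apply pow2_ge_0. lra.
Qed.

Section Products.
Variables (D : R * R * R * R -> Prop) (f g : vfield) (t x y z : R).
Hypotheses (Hf : vsmooth D f) (Hg : vsmooth D g) (H : D (t, x, y, z)).

Lemma Dd_vmul i : Dd i (vmul f g) t x y z
  = Dd i f t x y z * g t x y z + f t x y z * Dd i g t x y z.
Proof.
destruct (vsmooth_ex_derive D f t x y z Hf H) as [e0 [e1 [e2 e3]]].
destruct (vsmooth_ex_derive D g t x y z Hg H) as [e0' [e1' [e2' e3']]].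
destruct i; [exact (Derive_mult _ _ _ e0 e0') | exact (Derive_mult _ _ _ e1 e1')
  | exact (Derive_mult _ _ _ e2 e2')].
Qed.

Lemma Dz_vmul : Dz (vmul f g) t x y z
  = Dz f t x y z * g t x y z + f t x y z * Dz g t x y z.
Proof.
destruct (vsmooth_ex_derive D f t x y z Hf H) as [_ [_ [_ e3]]].
destruct (vsmooth_ex_derive D g t x y z Hg H) as [_ [_ [_ e3']]].
exact (Derive_mult _ _ _ e3 e3').
Qed.

Lemma Dd_lin i c : Dd i (fun t x y z => - g t x y z + c * f t x y z) t x y z
  = - Dd i g t x y z + c * Dd i f t x y z.
Proof.
destruct (vsmooth_ex_derive D f t x y z Hf H) as [e0 [e1 [e2 e3]]].
destruct (vsmooth_ex_derive D g t x y z Hg H) as [e0' [e1' [e2' e3']]].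
destruct i; simpl; unfold Dt, Dx, Dy; apply is_derive_unique; auto_derive;
  repeat split; auto; ring.
Qed.

End Products.

Lemma Dd_scal i c f t x y z : Dd i (fun t x y z => c * f t x y z) t x y z = c * Dd i f t x y z.
Proof. destruct i; exact (Derive_scal _ _ _). Qed.

(** * Hydrostatic pressure and boundary conditions *)

Section Continuous.
Variables (P : params) (Omega : R * R * R -> Prop) (h : hfield).
Hypotheses (HOmega : open Omega) (HP : valid_params P Omega) (Hsmooth : hsmooth Omega h)
  (Hpos : forall t x y, Omega (t, x, y) -> 0 < h t x y).
Variables (u v w p : vfield).
Hypothesis HNS : hydrostatic_NS P Omega h u v w p.
Variable D : R * R * R * R -> Prop.
Hypotheses (HD : open D) (HDO : forall q, D q -> Omega (fst q))
  (HDF : forall t x y z, fluid P Omega h t x y z -> D (t, x, y, z))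
  (Hu : vsmooth D u) (Hv : vsmooth D v) (Hw : vsmooth D w) (Hp : vsmooth D p).

Let Hrho : 0 < rho0 P.
Proof. apply HP. Qed.

Lemma expd_zb i t x y : Omega (t, x, y) -> expd i (bottom P) t x y.
Proof. apply hsmooth_expd, HP. Qed.

Lemma expd_eta i t x y : Omega (t, x, y) -> expd i (eta P h) t x y.
Proof.
intros H. apply (expd_plus i t x y h (bottom P)); [|apply expd_zb, H].
apply hsmooth_expd with Omega; assumption.
Qed.

Lemma dt_bottom t x y : dt (bottom P) t x y = 0.
Proof. exact (Derive_const _ _). Qed.

(** The outward normal of a graph has a nonzero vertical component, so the vertical part of the
    dynamic condition gives p = 0 at the surface; then d_z p is integrated from z up to it. *)
Lemma pressure_hydrostatic t x y z : fluid P Omega h t x y z ->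
  p t x y z = hydrostatic_pressure P h t x y z.
Proof.
intros [H Hz].
assert (Hs : p t x y (eta P h t x y) = 0).
{ destruct (NS_dynamic _ _ _ _ _ _ _ HNS t x y H) as [_ [_ E]].
  unfold patm, nsz in E. assert (M := metric_pos (eta P h) t x y).
  apply Rmult_eq_reg_r with (- (1 / metric (eta P h) t x y)); [lra|].
  assert (0 < 1 / metric (eta P h) t x y) by (apply Rdiv_lt_0_compat; lra). lra. }
assert (HI : forall z', z <= z' <= eta P h t x y -> D (t, x, y, z'))
  by (intros z' Hz'; apply HDF; split; [assumption | lra]).
assert (E := RInt_Dz D p t x y z (eta P h t x y) Hp (proj2 Hz) HI).
rewrite (vint_ext t x y z (eta P h t x y) (proj2 Hz) (Dz p) (fun _ _ _ _ => - rho0 P * grav P)) in E.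
2:{ intros z' Hz'. apply (NS_hydrostatic _ _ _ _ _ _ _ HNS). split; [assumption | lra]. }
rewrite (RInt_const (V := R_CompleteNormedModule)) in E.
change (scal ?r ?s) with (r * s) in E.
unfold hydrostatic_pressure. lra.
Qed.

Lemma no_penetration t x y : Omega (t, x, y) ->
  u t x y (zb P x y) * dx (bottom P) t x y + v t x y (zb P x y) * dy (bottom P) t x y
  - w t x y (zb P x y) = 0.
Proof.
intros H. assert (E := NS_no_penetration _ _ _ _ _ _ _ HNS t x y H). cbv zeta in E.
unfold nbx, nby, nbz in E. assert (M := metric_pos (bottom P) t x y).
apply Rmult_eq_reg_r with (/ metric (bottom P) t x y);
  [|apply Rinv_neq_0_compat; lra].
rewrite Rmult_0_l, <- E. field. lra.
Qed.

(** The bottom normal points downwards: minus [metric] times the normal derivative is the derivative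
    along (-d_x z_b, -d_y z_b, 1). *)
Lemma friction_traction f t x y : 
  nu P * metric (bottom P) t x y
      * dir_deriv f (nbx P t x y) (nby P t x y) (nbz P t x y) t x y (zb P x y)
      = - kappa P * f t x y (zb P x y) ->
  nu P * Dz f t x y (zb P x y)
    - (nu P * Dx f t x y (zb P x y) * dx (bottom P) t x y
       + nu P * Dy f t x y (zb P x y) * dy (bottom P) t x y)
  = kappa P * f t x y (zb P x y).
Proof.
intros E. assert (M := metric_pos (bottom P) t x y).
rewrite <- (Ropp_involutive (kappa P * _)), <- Ropp_mult_distr_l_reverse, <- E.
unfold dir_deriv, nbx, nby, nbz. field. lra.
Qed.

Lemma surface_pressure t x y : Omega (t, x, y) -> p t x y (eta P h t x y) = 0.
Proof.
intros H. rewrite pressure_hydrostatic.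
- unfold hydrostatic_pressure. ring.
- assert (Hh := Hpos t x y H). split; [assumption | unfold eta; lra].
Qed.

(** The condition is imposed along the unit normal, whereas the stress through a graph is counted
    per unit horizontal area; this leaves the factor [metric]. The pressure terms drop since p = 0
    there. *)
Lemma wind_traction f n ts t x y : Omega (t, x, y) ->
  nu P * dir_deriv f (nsx P h t x y) (nsy P h t x y) (nsz P h t x y) t x y (eta P h t x y)
      - p t x y (eta P h t x y) * n
      = - patm * n + wind P t x y * ts ->
  nu P * Dz f t x y (eta P h t x y)
    - (nu P * Dx f t x y (eta P h t x y) * dx (eta P h) t x y
       + nu P * Dy f t x y (eta P h t x y) * dy (eta P h) t x y)
  = metric (eta P h) t x y * wind P t x y * ts.
Proof.
intros H E. rewrite surface_pressure in E by assumption. unfold patm in E.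
assert (M := metric_pos (eta P h) t x y).
replace (metric (eta P h) t x y * wind P t x y * ts)
  with (metric (eta P h) t x y * (- 0 * n + wind P t x y * ts)) by ring.
rewrite <- E. unfold dir_deriv, nsx, nsy, nsz. field. lra.
Qed.

Lemma momentum_vector f i : (f = u /\ i = Dirx) \/ (f = v /\ i = Diry) ->
  forall t x y z, fluid P Omega h t x y z ->
  Dt f t x y z + (Dx (vmul f u) t x y z + Dy (vmul f v) t x y z) + Dz (vmul f w) t x y z
  = - (1 / rho0 P) * Dd i p t x y z
    + nu P * (Dx (Dx f) t x y z + Dy (Dy f) t x y z) + nu P * Dz (Dz f) t x y z.
Proof.
intros [[-> ->]|[-> ->]] t x y z H; assert (HDz := HDF _ _ _ _ H).
- assert (E := NS_momentum_x _ _ _ _ _ _ _ HNS t x y z H). unfold momentum_eq in E.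
  rewrite E.
  rewrite (Dd_lin D (Dx u) p t x y z (vsmooth_Dd D Dirx u Hu) Hp HDz Dirx (mu P)
    : Dx (fun t x y z => - p t x y z + mu P * Dx u t x y z) t x y z = _).
  rewrite (Dd_scal Diry (mu P) (Dy u) t x y z
    : Dy (fun t x y z => mu P * Dy u t x y z) t x y z = _).
  unfold nu. simpl. field. lra.
- assert (E := NS_momentum_y _ _ _ _ _ _ _ HNS t x y z H). unfold momentum_eq in E.
  rewrite E.
  rewrite (Dd_lin D (Dy v) p t x y z (vsmooth_Dd D Diry v Hv) Hp HDz Diry (mu P)
    : Dy (fun t x y z => - p t x y z + mu P * Dy v t x y z) t x y z = _).
  rewrite (Dd_scal Dirx (mu P) (Dx v) t x y z
    : Dx (fun t x y z => mu P * Dx v t x y z) t x y z = _).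
  unfold nu. simpl. field. lra.
Qed.

(** * Balances over a slab between two moving graphs *)

(** Volume crossing the moving graph z = a downwards, relative to it and per unit horizontal area.
    On an interface this is the exact exchange term. *)
Definition flux_through (a : hfield) : hfield := fun t x y =>
  dt a t x y + u t x y (a t x y) * dx a t x y + v t x y (a t x y) * dy a t x y
  - w t x y (a t x y).

(** nu times the derivative of f along the unnormalised upward normal (-d_x a, -d_y a, 1). *)
Definition stress_on (f : vfield) (a : hfield) : hfield := fun t x y =>
  nu P * Dz f t x y (a t x y)
  - (nu P * Dx f t x y (a t x y) * dx a t x y + nu P * Dy f t x y (a t x y) * dy a t x y).

Section Slab.
Variables (a b : hfield) (t x y : R).
Hypotheses (H : Omega (t, x, y)) (Hab : a t x y <= b t x y)
  (HI : forall z, a t x y <= z <= b t x y -> zb P x y <= z <= eta P h t x y)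
  (Ha : forall i, expd i a t x y) (Hb : forall i, expd i b t x y).

Let HF : forall z, a t x y <= z <= b t x y -> fluid P Omega h t x y z.
Proof. intros z Hz. split; auto. Qed.

Let HID : forall z, a t x y <= z <= b t x y -> D (t, x, y, z).
Proof. intros z Hz. apply HDF, HF, Hz. Qed.

Lemma pd_slab i f : vsmooth D f ->
  pd i (zint f a b) t x y = RInt (fun z => Dd i f t x y z) (a t x y) (b t x y)
    + f t x y (b t x y) * pd i b t x y - f t x y (a t x y) * pd i a t x y.
Proof. intros Hf. apply (pd_zint D HD i f a b t x y); auto. Qed.

(** The graphs are arbitrary inside the fluid: the upper one is an interface for the layer balances
    and a fixed height z for [w_vertical_velocity]. *)
Lemma slab_mass :
  hdiv (zint u a b) (zint v a b) t x y
  = (u t x y (b t x y) * dx b t x y + v t x y (b t x y) * dy b t x y - w t x y (b t x y))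
    - (u t x y (a t x y) * dx a t x y + v t x y (a t x y) * dy a t x y - w t x y (a t x y)).
Proof.
unfold hdiv.
rewrite (pd_slab Dirx u Hu : dx (zint u a b) t x y = _).
rewrite (pd_slab Diry v Hv : dy (zint v a b) t x y = _).
assert (E : RInt (fun z => Dx u t x y z) (a t x y) (b t x y)
  + RInt (fun z => Dy v t x y z) (a t x y) (b t x y)
  = - (w t x y (b t x y) - w t x y (a t x y))).
{ rewrite <- (RInt_Dz D w t x y) by auto.
  assert (E := vint_lincomb D t x y _ _ HD Hab HID
    ((1, Dd Dirx u) :: (1, Dd Diry v) :: (1, Dz w) :: nil)).
  unfold lincomb in E. simpl in E.
  lapply E; [clear E; intros E; lapply E; [lra|] |].
  - intros z Hz. assert (I := NS_incompressible _ _ _ _ _ _ _ HNS t x y z (HF z ltac:(lra))). lra.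
  - repeat constructor; [exact (vsmooth_Dd D Dirx u Hu) | exact (vsmooth_Dd D Diry v Hv)
      | exact (vsmooth_Dz D w Hw)]. }
simpl. lra.
Qed.

Lemma slab_momentum f i : (f = u /\ i = Dirx) \/ (f = v /\ i = Diry) ->
  dt (zint f a b) t x y + hdiv (zint (vmul f u) a b) (zint (vmul f v) a b) t x y
  = f t x y (b t x y) * flux_through b t x y - f t x y (a t x y) * flux_through a t x y
    - 1 / rho0 P * (pd i (zint p a b) t x y - p t x y (b t x y) * pd i b t x y
        + p t x y (a t x y) * pd i a t x y)
    + hdiv (zint (fun t x y z => nu P * Dx f t x y z) a b)
        (zint (fun t x y z => nu P * Dy f t x y z) a b) t x y
    + stress_on f b t x y - stress_on f a t x y.
Proof.
intros Hi.
assert (Hf : vsmooth D f) by (destruct Hi as [[-> _]|[-> _]]; assumption).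
assert (Hfu := vsmooth_mult D HD f u Hf Hu). assert (Hfv := vsmooth_mult D HD f v Hf Hv).
assert (Hfw := vsmooth_mult D HD f w Hf Hw).
assert (Hfx := vsmooth_Dd D Dirx f Hf). assert (Hfy := vsmooth_Dd D Diry f Hf).
assert (Hft := vsmooth_Dd D Dirt f Hf). assert (Hfz := vsmooth_Dz D f Hf).
assert (Hnx := vsmooth_scal D HD (nu P) _ Hfx). assert (Hny := vsmooth_scal D HD (nu P) _ Hfy).
unfold hdiv.
rewrite (pd_slab Dirt f Hf : dt (zint f a b) t x y = _).
rewrite (pd_slab Dirx _ Hfu : dx (zint (vmul f u) a b) t x y = _).
rewrite (pd_slab Diry _ Hfv : dy (zint (vmul f v) a b) t x y = _).
rewrite (pd_slab i p Hp).
rewrite (pd_slab Dirx _ Hnx : dx (zint (fun t x y z => nu P * Dx f t x y z) a b) t x y = _).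
rewrite (pd_slab Diry _ Hny : dy (zint (fun t x y z => nu P * Dy f t x y z) a b) t x y = _).
assert (Hpi := vsmooth_Dd D i p Hp).
assert (Hfux := vsmooth_Dd D Dirx _ Hfu). assert (Hfvy := vsmooth_Dd D Diry _ Hfv).
assert (Hnxx := vsmooth_Dd D Dirx _ Hnx). assert (Hnyy := vsmooth_Dd D Diry _ Hny).
assert (Hfwz := vsmooth_Dz D _ Hfw). assert (Hfzz := vsmooth_Dz D _ Hfz).
assert (E := vint_lincomb D t x y _ _ HD Hab HID
  ((1, Dd Dirt f) :: (1, Dd Dirx (vmul f u)) :: (1, Dd Diry (vmul f v)) :: (1, Dz (vmul f w))
   :: (1 / rho0 P, Dd i p) :: (-1, Dd Dirx (fun t x y z => nu P * Dx f t x y z))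
   :: (-1, Dd Diry (fun t x y z => nu P * Dy f t x y z)) :: (- nu P, Dz (Dz f)) :: nil)).
lapply E; [clear E; intros E | repeat (constructor; [assumption|]); constructor].
lapply E; [clear E; intros E |].
2:{ intros z Hz. assert (M := momentum_vector f i Hi t x y z (HF z ltac:(lra))).
  unfold lincomb. simpl.
  rewrite (Dd_scal Dirx (nu P) (Dx f) t x y z
    : Dx (fun t x y z => nu P * Dx f t x y z) t x y z = _).
  rewrite (Dd_scal Diry (nu P) (Dy f) t x y z
    : Dy (fun t x y z => nu P * Dy f t x y z) t x y z = _).
  simpl. lra. }
simpl in E.
rewrite !(RInt_Dz D _ t x y) in E by auto.
unfold vmul in E |- *. unfold flux_through, stress_on. simpl in E |- *. lra.
Qed.

End Slab.
Lemma zb_eta t x y : Omega (t, x, y) -> zb P x y < eta P h t x y.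
Proof. intros H. assert (Hh := Hpos t x y H). unfold eta. lra. Qed.

(** In the slab from the bottom to a fixed height, the bottom contributes nothing by no-penetration
    and the flat top contributes -w. *)
Lemma w_vertical_velocity t x y z : fluid P Omega h t x y z ->
  w t x y z = vertical_velocity P u v t x y z.
Proof.
intros [H Hz]. unfold vertical_velocity.
rewrite (slab_mass (bottom P) (fun _ _ _ => z) t x y H).
- assert (E := no_penetration t x y H).
  rewrite (pd_const Dirx t x y z : dx (fun _ _ _ => z) t x y = 0).
  rewrite (pd_const Diry t x y z : dy (fun _ _ _ => z) t x y = 0).
  unfold bottom at 1 3 5. lra.
- apply Hz.
- unfold bottom. intros; lra.
- intros; apply expd_zb, H.
- intros; apply expd_const.
Qed.

Lemma flux_through_bottom t x y : Omega (t, x, y) -> flux_through (bottom P) t x y = 0.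
Proof.
intros H. unfold flux_through. rewrite dt_bottom, Rplus_0_l. apply no_penetration, H.
Qed.

Lemma flux_through_eta t x y : Omega (t, x, y) -> flux_through (eta P h) t x y = 0.
Proof. intros H. apply (NS_kinematic _ _ _ _ _ _ _ HNS), H. Qed.

Lemma stress_on_bottom t x y : Omega (t, x, y) ->
  stress_on u (bottom P) t x y = kappa P * u t x y (zb P x y) /\
  stress_on v (bottom P) t x y = kappa P * v t x y (zb P x y).
Proof.
intros H. destruct (NS_friction _ _ _ _ _ _ _ HNS t x y H) as [Eu Ev].
split; apply friction_traction; assumption.
Qed.

Lemma stress_on_eta t x y : Omega (t, x, y) ->
  stress_on u (eta P h) t x y = metric (eta P h) t x y * wind P t x y * tsx P t x y /\
  stress_on v (eta P h) t x y = metric (eta P h) t x y * wind P t x y * tsy P t x y.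
Proof.
intros H. destruct (NS_dynamic _ _ _ _ _ _ _ HNS t x y H) as [Eu [Ev _]].
split; eapply wind_traction; eassumption.
Qed.

(** * Integration of the continuous system over the layers *)

Section Layering.
Variable L : layering.
Hypothesis HL : valid_layering L.

Let X := exact_exchanges P L h u v w.

Lemma zi_slab a t x y : Omega (t, x, y) -> (1 <= a <= nlay L)%nat ->
  zi P L h (a - 1) t x y <= zi P L h a t x y /\
  (forall z, zi P L h (a - 1) t x y <= z <= zi P L h a t x y -> zb P x y <= z <= eta P h t x y).
Proof.
intros H Ha. assert (Hh := Hpos t x y H).
assert (C1 := zi_column P L h (a - 1) t x y HL Hh ltac:(lia)).
assert (C2 := zi_column P L h a t x y HL Hh ltac:(lia)).
split; [apply zi_pred_le; assumption | intros; lra].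
Qed.

Lemma expd_zi' i a t x y : Omega (t, x, y) -> expd i (zi P L h a) t x y.
Proof.
intros H. apply expd_zi; [apply expd_zb, H | apply hsmooth_expd with Omega; assumption].
Qed.

Lemma layer_mass_exact a t x y : Omega (t, x, y) -> (1 <= a <= nlay L)%nat ->
  dt (hl L h a) t x y + hdiv (lint P L h u a) (lint P L h v a) t x y
  = exG X a t x y - exG X (a - 1) t x y.
Proof.
intros H Ha. destruct (zi_slab a t x y H Ha) as [S1 S2].
unfold lint. rewrite slab_mass by (auto using expd_zi').
assert (Eh : expd Dirt h t x y) by (apply hsmooth_expd with Omega; assumption).
assert (Eb := expd_zb Dirt t x y H).
assert (E1 := pd_zi Dirt P L h t x y Eb Eh a).
assert (E2 := pd_zi Dirt P L h t x y Eb Eh (a - 1)).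
assert (E3 := pd_hl Dirt L h t x y a). rewrite (lsum_pred L a) in E1 by lia.
cbn [pd] in E1, E2, E3. cbn [exG X exact_exchanges]. rewrite E1, E2, E3. ring.
Qed.

Lemma layer_balance_exact : layer_balance P Omega L h u v p X.
Proof.
intros t x y H a Ha. destruct (zi_slab a t x y H Ha) as [S1 S2].
split; [|split].
- apply layer_mass_exact; assumption.
- apply (slab_momentum (zi P L h (a - 1)) (zi P L h a) t x y H S1 S2) with (i := Dirx);
    auto using expd_zi'.
- apply (slab_momentum (zi P L h (a - 1)) (zi P L h a) t x y H S1 S2) with (i := Diry);
    auto using expd_zi'.
Qed.

Lemma pd_zi_N i t x y : pd i (zi P L h (nlay L)) t x y = pd i (eta P h) t x y.
Proof.
apply pd_ext_loc, filter_forall. intros s. destruct i; apply zi_eta, HL.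
Qed.

Lemma pd_zi_0 i t x y : pd i (zi P L h 0) t x y = pd i (bottom P) t x y.
Proof.
apply pd_ext_loc, filter_forall. intros s. destruct i; apply zi_bottom.
Qed.

Lemma flux_stress_0 f t x y :
  flux_through (zi P L h 0) t x y = flux_through (bottom P) t x y /\
  stress_on f (zi P L h 0) t x y = stress_on f (bottom P) t x y.
Proof.
unfold flux_through, stress_on. rewrite zi_bottom.
assert (E0 := pd_zi_0 Dirt t x y). assert (E1 := pd_zi_0 Dirx t x y).
assert (E2 := pd_zi_0 Diry t x y). cbn [pd] in E0, E1, E2. rewrite E0, E1, E2.
split; reflexivity.
Qed.

Lemma flux_stress_N f t x y :
  flux_through (zi P L h (nlay L)) t x y = flux_through (eta P h) t x y /\
  stress_on f (zi P L h (nlay L)) t x y = stress_on f (eta P h) t x y.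
Proof.
unfold flux_through, stress_on. rewrite zi_eta by assumption.
assert (E0 := pd_zi_N Dirt t x y). assert (E1 := pd_zi_N Dirx t x y).
assert (E2 := pd_zi_N Diry t x y). cbn [pd] in E0, E1, E2. rewrite E0, E1, E2.
split; reflexivity.
Qed.

Lemma exact_exchanges_boundary t x y : Omega (t, x, y) ->
  exG X 0%nat t x y = 0 /\
  exG X (nlay L) t x y = 0 /\
  exTx X 0%nat t x y = kappa P * u t x y (zb P x y) /\
  exTy X 0%nat t x y = kappa P * v t x y (zb P x y) /\
  exTx X (nlay L) t x y = metric (eta P h) t x y * wind P t x y * tsx P t x y /\
  exTy X (nlay L) t x y = metric (eta P h) t x y * wind P t x y * tsy P t x y.
Proof.
intros H.
change (exG X) with (fun a => flux_through (zi P L h a)).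
change (exTx X) with (fun a => stress_on u (zi P L h a)).
change (exTy X) with (fun a => stress_on v (zi P L h a)).
cbv beta.
destruct (flux_stress_0 u t x y) as [-> ->], (flux_stress_0 v t x y) as [_ ->].
destruct (flux_stress_N u t x y) as [-> ->], (flux_stress_N v t x y) as [_ ->].
destruct (stress_on_bottom t x y H), (stress_on_eta t x y H).
rewrite flux_through_bottom, flux_through_eta by assumption. tauto.
Qed.

End Layering.

(** * Energy of the continuous system *)

Lemma Dd_ext_on i f g t x y z : D (t, x, y, z) ->
  (forall t x y z, D (t, x, y, z) -> f t x y z = g t x y z) ->
  Dd i f t x y z = Dd i g t x y z.
Proof.
intros H E. destruct (open_slices4 D t x y z HD H) as [L0 [L1 [L2 _]]].
destruct i; apply Derive_ext_loc; [revert L0 | revert L1 | revert L2];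
  apply filter_imp; intros s; apply E.
Qed.

Lemma Dd_kinetic i t x y z : D (t, x, y, z) ->
  Dd i (kinetic u v) t x y z = u t x y z * Dd i u t x y z + v t x y z * Dd i v t x y z.
Proof.
intros H.
destruct (vsmooth_ex_derive D u t x y z Hu H) as [? [? [? _]]].
destruct (vsmooth_ex_derive D v t x y z Hv H) as [? [? [? _]]].
destruct i; simpl; unfold kinetic, Dt, Dx, Dy; apply is_derive_unique; auto_derive;
  repeat split; auto; field.
Qed.

Lemma vsmooth_kinetic : vsmooth D (kinetic u v).
Proof.
apply (vsmooth_ext D (fun t x y z => / 2 * (u t x y z * u t x y z + v t x y z * v t x y z)) _ HD).
- intros. unfold kinetic. field.
- apply vsmooth_scal; [exact HD|]. apply vsmooth_plus; auto; apply vsmooth_mult; auto.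
Qed.

Lemma vsmooth_energy : vsmooth D (energy P u v).
Proof.
exact (vsmooth_plus D HD _ _ vsmooth_kinetic (vsmooth_scal D HD (grav P) _ (vsmooth_z D HD))).
Qed.

Lemma vsmooth_eta : vsmooth D (fun t x y _ => eta P h t x y).
Proof.
apply (vsmooth_plus D HD (fun t x y _ => h t x y) (fun t x y _ => bottom P t x y));
  apply (vsmooth_lift D HD Omega); auto. apply HP.
Qed.

Definition energy_flux_viscous (f : vfield) (i : dir) : vfield := fun t x y z =>
  energy_flux P h u v f t x y z - nu P * Dd i (kinetic u v) t x y z.

Lemma vsmooth_energy_flux f i : vsmooth D f -> vsmooth D (energy_flux_viscous f i).
Proof.
intros Hf. apply (vsmooth_minus D HD (energy_flux P h u v f)).
- apply (vsmooth_mult D HD f (fun t x y z =>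
    energy P u v t x y z + grav P * (eta P h t x y - z)) Hf).
  apply vsmooth_plus; [exact HD | exact vsmooth_energy |].
  apply vsmooth_scal; [exact HD|].
  exact (vsmooth_minus D HD _ _ vsmooth_eta (vsmooth_z D HD)).
- apply vsmooth_scal, vsmooth_Dd, vsmooth_kinetic. exact HD.
Qed.

Lemma Dd_energy t x y z : D (t, x, y, z) ->
  Dd Dirt (energy P u v) t x y z
  = u t x y z * Dt u t x y z + v t x y z * Dt v t x y z.
Proof.
intros H. destruct (vsmooth_ex_derive D _ t x y z vsmooth_kinetic H) as [? _].
transitivity (Derive (fun s => kinetic u v s x y z) t + Derive (fun _ => grav P * z) t).
- apply (Derive_plus (fun s => kinetic u v s x y z)); [assumption | apply ex_derive_const].
- rewrite Derive_const, Rplus_0_r. exact (Dd_kinetic Dirt t x y z H).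
Qed.

(** The height cancels between g z and g (eta - z), so the advected quantity is the kinetic energy
    plus g eta. *)
Lemma Dd_energy_flux f i t x y z : vsmooth D f -> D (t, x, y, z) ->
  Dd i (energy_flux_viscous f i) t x y z
  = Dd i f t x y z * (kinetic u v t x y z + grav P * eta P h t x y)
    + f t x y z * (u t x y z * Dd i u t x y z + v t x y z * Dd i v t x y z
        + grav P * pd i (eta P h) t x y)
    - nu P * (Dd i u t x y z ^ 2 + Dd i v t x y z ^ 2
        + u t x y z * Dd i (Dd i u) t x y z + v t x y z * Dd i (Dd i v) t x y z).
Proof.
intros Hf H.
rewrite (Dd_ext_on i _ (fun t x y z =>
  f t x y z * (kinetic u v t x y z + grav P * eta P h t x y)
  - nu P * (u t x y z * Dd i u t x y z + v t x y z * Dd i v t x y z)) t x y z H).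
2:{ intros t' x' y' z' H'. unfold energy_flux_viscous, energy_flux, energy.
  rewrite Dd_kinetic by assumption. unfold kinetic. ring. }
assert (Ee := expd_eta i t x y (HDO _ H)). unfold expd in Ee.
destruct (vsmooth_ex_derive D u t x y z Hu H) as [? [? [? _]]].
destruct (vsmooth_ex_derive D v t x y z Hv H) as [? [? [? _]]].
destruct (vsmooth_ex_derive D f t x y z Hf H) as [? [? [? _]]].
destruct (vsmooth_ex_derive D _ t x y z (vsmooth_Dd D i u Hu) H) as [? [? [? _]]].
destruct (vsmooth_ex_derive D _ t x y z (vsmooth_Dd D i v Hv) H) as [? [? [? _]]].
rewrite pd_slice. unfold kinetic.
destruct i; simpl in *;
  [ change (Dt ?F t x y z) with (Derive (fun s => F s x y z) t)
  | change (Dx ?F t x y z) with (Derive (fun s => F t s y z) x)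
  | change (Dy ?F t x y z) with (Derive (fun s => F t x s z) y) ];
  apply is_derive_unique; auto_derive; repeat split; auto; unfold Dt, Dx, Dy; field.
Qed.

Definition vertical_flux : vfield := fun t x y z =>
  - 1 * (w t x y z * (kinetic u v t x y z + grav P * eta P h t x y))
  + nu P * (u t x y z * Dz u t x y z + v t x y z * Dz v t x y z).

Lemma vsmooth_vertical_flux : vsmooth D vertical_flux.
Proof.
apply vsmooth_plus; [exact HD | |].
- apply vsmooth_scal; [exact HD|]. apply vsmooth_mult; [exact HD | exact Hw |].
  apply vsmooth_plus; [exact HD | exact vsmooth_kinetic |].
  apply vsmooth_scal; [exact HD | exact vsmooth_eta].
- apply vsmooth_scal; [exact HD|].
  apply vsmooth_plus; [exact HD | |]; apply vsmooth_mult; auto using vsmooth_Dz.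
Qed.

Lemma Dz_vertical_flux t x y z : D (t, x, y, z) ->
  Dz vertical_flux t x y z
  = - Dz w t x y z * (kinetic u v t x y z + grav P * eta P h t x y)
    - w t x y z * (u t x y z * Dz u t x y z + v t x y z * Dz v t x y z)
    + nu P * (Dz u t x y z ^ 2 + Dz v t x y z ^ 2
        + u t x y z * Dz (Dz u) t x y z + v t x y z * Dz (Dz v) t x y z).
Proof.
intros H.
destruct (vsmooth_ex_derive D u t x y z Hu H) as [_ [_ [_ ?]]].
destruct (vsmooth_ex_derive D v t x y z Hv H) as [_ [_ [_ ?]]].
destruct (vsmooth_ex_derive D w t x y z Hw H) as [_ [_ [_ ?]]].
destruct (vsmooth_ex_derive D _ t x y z (vsmooth_Dz D u Hu) H) as [_ [_ [_ ?]]].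
destruct (vsmooth_ex_derive D _ t x y z (vsmooth_Dz D v Hv) H) as [_ [_ [_ ?]]].
unfold vertical_flux, kinetic.
change (Dz ?F t x y z) with (Derive (fun s => F t x y s) z).
apply is_derive_unique; auto_derive; repeat split; auto; unfold Dz; field.
Qed.

(** Strict inequalities keep the point at height z in the fluid for neighbouring (t, x, y); the
    formula for p is available there, not on all of [D]. *)
Lemma pressure_gradient i t x y z : Omega (t, x, y) -> zb P x y < z < eta P h t x y ->
  Dd i p t x y z = rho0 P * grav P * pd i (eta P h) t x y.
Proof.
intros H Hz.
assert (Ee := expd_eta i t x y H). assert (Eb := expd_zb i t x y H).
assert (Ce := ex_derive_continuous (V := R_NormedModule) _ _ Ee).
assert (Cb := ex_derive_continuous (V := R_NormedModule) _ _ Eb).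
assert (L1 : locally (coord i t x y) (fun s => slice i (bottom P) t x y s < z)).
{ apply (Cb (fun r => r < z)). apply open_lt. rewrite slice_coord. apply Hz. }
assert (L2 : locally (coord i t x y) (fun s => z < slice i (eta P h) t x y s)).
{ apply (Ce (fun r => z < r)). apply open_gt. rewrite slice_coord. apply Hz. }
assert (LL := filter_and _ _ (open_slice i Omega t x y HOmega H) (filter_and _ _ L1 L2)).
rewrite pd_slice.
transitivity (Derive (fun s => rho0 P * grav P * (slice i (eta P h) t x y s - z))
  (coord i t x y)).
- transitivity (Derive (fun s => vslice i p t x y s z) (coord i t x y)); [destruct i; reflexivity|].
  apply Derive_ext_loc. revert LL. apply filter_imp. intros s [H1 [H2 H3]].
  destruct i; simpl in *; apply pressure_hydrostatic; (split; [exact H1 | unfold bottom in H2; lra]).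
- unfold expd in Ee. apply is_derive_unique. auto_derive; [repeat split; exact Ee |].
  change (fun s => slice i (eta P h) t x y s) with (slice i (eta P h) t x y). ring.
Qed.

Lemma energy_interior t x y z : Omega (t, x, y) -> zb P x y < z < eta P h t x y ->
  Dd Dirt (energy P u v) t x y z + Dd Dirx (energy_flux_viscous u Dirx) t x y z
  + Dd Diry (energy_flux_viscous v Diry) t x y z + nu P * dissipation u v t x y z
  = Dz vertical_flux t x y z.
Proof.
intros H Hz.
assert (HF : fluid P Omega h t x y z) by (split; [assumption | lra]).
assert (HDz := HDF _ _ _ _ HF).
rewrite Dd_energy, Dd_energy_flux, Dd_energy_flux, Dz_vertical_flux by assumption.
assert (Mu := momentum_vector u Dirx (or_introl (conj eq_refl eq_refl)) t x y z HF).
assert (Mv := momentum_vector v Diry (or_intror (conj eq_refl eq_refl)) t x y z HF).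
assert (I := NS_incompressible _ _ _ _ _ _ _ HNS t x y z HF).
rewrite pressure_gradient in Mu, Mv by assumption.
assert (A := fun f g Hf Hg => Dd_vmul D f g t x y z Hf Hg HDz).
assert (Ax := fun f g Hf Hg => A f g Hf Hg Dirx). assert (Ay := fun f g Hf Hg => A f g Hf Hg Diry).
assert (Az := fun f g Hf Hg => Dz_vmul D f g t x y z Hf Hg HDz).
cbn [Dd] in Ax, Ay. clear A.
rewrite Ax, Ay, Az in Mu, Mv by assumption. clear Ax Ay Az.
replace (- (1 / rho0 P) * (rho0 P * grav P * pd Dirx (eta P h) t x y))
  with (- grav P * pd Dirx (eta P h) t x y) in Mu by (field; lra).
replace (- (1 / rho0 P) * (rho0 P * grav P * pd Diry (eta P h) t x y))
  with (- grav P * pd Diry (eta P h) t x y) in Mv by (field; lra).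
unfold dissipation. cbn [Dd].
apply (f_equal (Rmult (u t x y z))) in Mu. apply (f_equal (Rmult (v t x y z))) in Mv.
(* The conservative momentum equation tested with the velocity brings |u|^2 div U, which the energy
   flux does not contain; it is subtracted from the natural multiplier |u|^2 / 2 + g eta. *)
apply (f_equal (Rmult (kinetic u v t x y z + grav P * eta P h t x y
  - u t x y z ^ 2 - v t x y z ^ 2))) in I.
lra.
Qed.

Lemma energy_balance_continuous : continuous_energy_balance P Omega h u v.
Proof.
intros t x y H zs.
assert (Hze := zb_eta t x y H).
assert (Hab : bottom P t x y <= eta P h t x y) by (unfold bottom; lra).
assert (HI : forall z, bottom P t x y <= z <= eta P h t x y ->
  zb P x y <= z <= eta P h t x y) by (intros z Hz; exact Hz).
assert (Eb : forall i, expd i (bottom P) t x y) by (intros; apply expd_zb, H).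
assert (Ee : forall i, expd i (eta P h) t x y) by (intros; apply expd_eta, H).
assert (HID : forall z, bottom P t x y <= z <= eta P h t x y -> D (t, x, y, z))
  by (intros z Hz; apply HDF; split; auto).
assert (Sl := fun i f => pd_slab (bottom P) (eta P h) t x y H Hab HI Eb Ee i f).
assert (HFx := vsmooth_energy_flux u Dirx Hu). assert (HFy := vsmooth_energy_flux v Diry Hv).
unfold hdiv, column.
rewrite (Sl Dirt _ vsmooth_energy : dt (zint (energy P u v) (bottom P) (eta P h)) t x y = _).
rewrite (Sl Dirx _ HFx : dx (zint (fun t x y z => energy_flux P h u v u t x y z
  - nu P * Dx (kinetic u v) t x y z) (bottom P) (eta P h)) t x y = _).
rewrite (Sl Diry _ HFy : dy (zint (fun t x y z => energy_flux P h u v v t x y z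
  - nu P * Dy (kinetic u v) t x y z) (bottom P) (eta P h)) t x y = _).
assert (Hdiss : vsmooth D (dissipation u v)).
{ assert (Q : forall f, vsmooth D f -> vsmooth D (fun t x y z => f t x y z ^ 2)).
  { intros f Hf. apply (vsmooth_ext D (fun t x y z => f t x y z * f t x y z) _ HD).
    - intros; ring.
    - apply vsmooth_mult; auto. }
  repeat (apply vsmooth_plus; [exact HD | |]); apply Q;
    solve [exact (vsmooth_Dd D Dirx u Hu) | exact (vsmooth_Dd D Dirx v Hv)
      | exact (vsmooth_Dd D Diry u Hu) | exact (vsmooth_Dd D Diry v Hv)
      | exact (vsmooth_Dz D u Hu) | exact (vsmooth_Dz D v Hv)]. }
assert (E := vint_lincomb D t x y _ _ HD Hab HID
  ((1, Dd Dirt (energy P u v)) :: (1, Dd Dirx (energy_flux_viscous u Dirx))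
   :: (1, Dd Diry (energy_flux_viscous v Diry)) :: (nu P, dissipation u v)
   :: (-1, Dz vertical_flux) :: nil)).
lapply E; [clear E; intros E |].
2:{ repeat constructor; simpl; [exact (vsmooth_Dd D Dirt _ vsmooth_energy)
  | exact (vsmooth_Dd D Dirx _ HFx) | exact (vsmooth_Dd D Diry _ HFy) | exact Hdiss
  | exact (vsmooth_Dz D _ vsmooth_vertical_flux)]. }
lapply E; [clear E; intros E |].
2:{ intros z Hz. assert (M := energy_interior t x y z H Hz). unfold lincomb.
  cbn [fold_right fst snd]. lra. }
cbn [fold_right fst snd] in E.
rewrite (RInt_Dz D vertical_flux t x y) in E by auto using vsmooth_vertical_flux.
assert (Gb := flux_through_bottom t x y H). assert (Gs := flux_through_eta t x y H).
destruct (stress_on_bottom t x y H) as [Tbu Tbv], (stress_on_eta t x y H) as [Tsu Tsv].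
unfold flux_through in Gb, Gs. unfold stress_on in Tbu, Tbv, Tsu, Tsv.
assert (Db : D (t, x, y, bottom P t x y)) by (apply HID; lra).
assert (Ds : D (t, x, y, eta P h t x y)) by (apply HID; lra).
assert (Vf : forall z, vertical_flux t x y z
  = - 1 * (w t x y z * (kinetic u v t x y z + grav P * eta P h t x y))
    + nu P * (u t x y z * Dz u t x y z + v t x y z * Dz v t x y z)) by reflexivity.
rewrite !Vf in E. clear Vf.
assert (Fl : forall f i z, D (t, x, y, z) -> energy_flux_viscous f i t x y z
  = f t x y z * (kinetic u v t x y z + grav P * eta P h t x y)
    - nu P * (u t x y z * Dd i u t x y z + v t x y z * Dd i v t x y z)).
{ intros f i z Hz. unfold energy_flux_viscous, energy_flux, energy.
  rewrite Dd_kinetic by assumption. unfold kinetic. ring. }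
rewrite !Fl by assumption. clear Fl. cbn [Dd pd] in E |- *.
change (zint (dissipation u v) (bottom P) (eta P h) t x y)
  with (RInt (fun z => dissipation u v t x y z) (bottom P t x y) (eta P h t x y)).
assert (En : forall z, energy P u v t x y z = kinetic u v t x y z + grav P * z) by reflexivity.
rewrite !En, dt_bottom. rewrite dt_bottom in Gb. clear En.
unfold zs. change (zb P x y) with (bottom P t x y) in *.
(* At the surface g z = g eta, and at the bottom the graph does not move in time. Hence all
   advective boundary terms are |u|^2 / 2 + g eta times a flux through the graph, and the viscous
   ones are the velocity times a stress. *)
apply (f_equal (Rmult (kinetic u v t x y (bottom P t x y) + grav P * eta P h t x y))) in Gb.
apply (f_equal (Rmult (kinetic u v t x y (eta P h t x y) + grav P * eta P h t x y))) in Gs.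
apply (f_equal (Rmult (u t x y (bottom P t x y)))) in Tbu.
apply (f_equal (Rmult (v t x y (bottom P t x y)))) in Tbv.
apply (f_equal (Rmult (u t x y (eta P h t x y)))) in Tsu.
apply (f_equal (Rmult (v t x y (eta P h t x y)))) in Tsv.
lra.
Qed.

(** * Vanishing of the upwind dissipation *)

Lemma vsmooth_bounded f t x y : vsmooth D f -> Omega (t, x, y) ->
  exists M, 0 <= M /\ forall z, zb P x y <= z <= eta P h t x y -> Rabs (f t x y z) <= M.
Proof.
intros Hf H. assert (Hze := zb_eta t x y H).
destruct (continuity_ab_maj (fun z => Rabs (f t x y z)) (zb P x y) (eta P h t x y))
  as [m [Hm _]]; [lra| |].
- intros z Hz. apply continuity_pt_filterlim.
  apply (continuous_comp (fun z => f t x y z) Rabs).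
  + apply (vsmooth_continuous_z D f t x y z Hf), HDF. split; assumption.
  + apply continuous_Rabs.
- exists (Rabs (f t x y m)). split; [apply Rabs_pos | exact Hm].
Qed.

Lemma vsmooth_lipschitz f t x y : vsmooth D f -> Omega (t, x, y) ->
  exists M, 0 <= M /\ forall z z', zb P x y <= z <= eta P h t x y ->
    zb P x y <= z' <= eta P h t x y -> Rabs (f t x y z - f t x y z') <= M * Rabs (z - z').
Proof.
intros Hf H. destruct (vsmooth_bounded (Dz f) t x y (vsmooth_Dz D f Hf) H) as [M [HM B]].
exists M. split; [exact HM|].
assert (W : forall z z', z' <= z -> zb P x y <= z <= eta P h t x y ->
    zb P x y <= z' <= eta P h t x y -> Rabs (f t x y z - f t x y z') <= M * Rabs (z - z')).
{ intros z z' Hzz Hz Hz'.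
  assert (HID : forall s, z' <= s <= z -> D (t, x, y, s))
    by (intros s Hs; apply HDF; split; [assumption | lra]).
  rewrite <- (RInt_Dz D f t x y) by auto.
  rewrite (Rabs_right (z - z')), Rmult_comm by lra.
  apply abs_RInt_le_const; [assumption | |intros s Hs; apply B; lra].
  apply vsmooth_ex_RInt with D; auto using vsmooth_Dz. }
intros z z' Hz Hz'. destruct (Rle_dec z' z); [apply W; assumption|].
rewrite Rabs_minus_sym, (Rabs_minus_sym z). apply W; lra.
Qed.

(** * Layer means of a smooth flow *)

Section LayerMeans.
Variable L : layering.
Hypothesis HL : valid_layering L.

(** h_a times a layer mean is the layer integral, so the exact mass balances telescope from the
    impermeable bottom. *)
Lemma Gx_exact a t x y : Omega (t, x, y) -> (a <= nlay L)%nat ->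
  Gx L h (layer_mean P L h u) (layer_mean P L h v) a t x y = flux_through (zi P L h a) t x y.
Proof.
intros H Ha. unfold Gx.
transitivity (sum_n_m (fun j => flux_through (zi P L h j) t x y
  - flux_through (zi P L h (j - 1)) t x y) 1 a).
- apply sum1_ext. intros j Hj. assert (Hj' : (1 <= j <= nlay L)%nat) by lia.
  etransitivity; [|exact (layer_mass_exact L HL j t x y H Hj')]. f_equal.
  assert (E : forall f t x y, Omega (t, x, y) ->
    hmul (hl L h j) (layer_mean P L h f j) t x y = lint P L h f j t x y).
  { intros f t' x' y' H'. unfold hmul, layer_mean.
    assert (Hh := hl_pos L h j t' x' y' HL (Hpos t' x' y' H') Hj'). field. lra. }
  apply hdiv_ext_on with Omega; auto.
- etransitivity; [apply (sum1_telescope (fun j => flux_through (zi P L h j) t x y))|].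
  destruct (exact_exchanges_boundary L HL t x y H) as [E _].
  change (flux_through (zi P L h 0) t x y = 0) in E. rewrite E. apply Rminus_0_r.
Qed.

(** With [c] on the interface shared by two layers, both means are compared with the same value;
    this bounds their jump. *)
Lemma layer_mean_close f M a c t x y : vsmooth D f -> Omega (t, x, y) ->
  (1 <= a <= nlay L)%nat -> 0 <= M ->
  zi P L h (a - 1) t x y <= c <= zi P L h a t x y ->
  (forall z z', zb P x y <= z <= eta P h t x y ->
    zb P x y <= z' <= eta P h t x y -> Rabs (f t x y z - f t x y z') <= M * Rabs (z - z')) ->
  Rabs (layer_mean P L h f a t x y - f t x y c) <= M * hl L h a t x y.
Proof.
intros Hf H Ha HM Hc HLip.
assert (Hh := hl_pos L h a t x y HL (Hpos t x y H) Ha).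
destruct (zi_slab L HL a t x y H Ha) as [S1 S2].
assert (Ez := zi_pred P L h a t x y ltac:(lia)).
assert (Hg : vsmooth D (fun t' x' y' z => f t' x' y' z - f t x y c))
  by (apply vsmooth_minus; [exact HD | exact Hf | apply vsmooth_const, HD]).
assert (HID : forall z, zi P L h (a - 1) t x y <= z <= zi P L h a t x y -> D (t, x, y, z))
  by (intros z Hz; apply HDF; split; auto).
assert (E : layer_mean P L h f a t x y - f t x y c
  = RInt (fun z => f t x y z - f t x y c) (zi P L h (a - 1) t x y) (zi P L h a t x y)
    / hl L h a t x y).
{ assert (If := vsmooth_ex_RInt D f t x y _ _ Hf S1 HID).
  assert (Ic := ex_RInt_const (V := R_NormedModule)
    (zi P L h (a - 1) t x y) (zi P L h a t x y) (f t x y c)).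
  assert (E := RInt_minus (V := R_CompleteNormedModule) _ _ _ _ If Ic).
  rewrite (RInt_const (V := R_CompleteNormedModule)) in E.
  change (scal ?r ?s) with (r * s) in E. change (minus ?r ?s) with (r - s) in E.
  unfold layer_mean, lint, zint. etransitivity; [|exact (f_equal (fun r => r / _) (eq_sym E))].
  rewrite Ez. field. lra. }
rewrite E. unfold Rdiv. rewrite Rabs_mult, (Rabs_right (/ _)).
2:{ apply Rle_ge, Rlt_le, Rinv_0_lt_compat, Hh. }
apply Rmult_le_reg_r with (hl L h a t x y); [exact Hh|].
rewrite Rmult_assoc, Rinv_l, Rmult_1_r by lra.
apply Rle_trans with ((zi P L h a t x y - zi P L h (a - 1) t x y) * (M * hl L h a t x y)).
- apply abs_RInt_le_const; [exact S1 | |].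
  + exact (vsmooth_ex_RInt D _ t x y _ _ Hg S1 HID).
  + intros z Hz. apply Rle_trans with (1 := HLip z c (S2 z Hz) (S2 c Hc)).
    apply Rmult_le_compat_l; [exact HM|]. apply Rabs_le. lra.
- right. rewrite Ez. ring.
Qed.

Lemma layer_mean_jump f M a t x y : vsmooth D f -> Omega (t, x, y) ->
  (1 <= a < nlay L)%nat -> 0 <= M ->
  (forall z z', zb P x y <= z <= eta P h t x y ->
    zb P x y <= z' <= eta P h t x y -> Rabs (f t x y z - f t x y z') <= M * Rabs (z - z')) ->
  (layer_mean P L h f (a + 1) t x y - layer_mean P L h f a t x y) ^ 2
  <= (M * h t x y) ^ 2 * (frac L a + frac L (a + 1)) ^ 2.
Proof.
intros Hf H Ha HM HLip.
destruct (zi_slab L HL a t x y H ltac:(lia)) as [S1 _].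
destruct (zi_slab L HL (a + 1) t x y H ltac:(lia)) as [S2 _].
replace (a + 1 - 1)%nat with a in S2 by lia.
assert (C1 := layer_mean_close f M a (zi P L h a t x y) t x y Hf H ltac:(lia) HM
  (conj S1 (Rle_refl _)) HLip).
assert (C2 := layer_mean_close f M (a + 1) (zi P L h a t x y) t x y Hf H ltac:(lia) HM).
replace (a + 1 - 1)%nat with a in C2 by lia.
specialize (C2 (conj (Rle_refl _) S2) HLip).
apply Rabs_le_between in C1. apply Rabs_le_between in C2. unfold hl in C1, C2.
rewrite <- Rpow_mult_distr. apply pow_maj_Rabs. apply Rabs_le. split; lra.
Qed.

Lemma sum_frac_pairs n :
  sum_n_m (fun a => frac L a + frac L (a + 1)) 1 n
  = lsum L n + lsum L (n + 1) - frac L 1 :> R.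
Proof.
induction n as [|n IH].
- rewrite sum1_O, lsum_0, (lsum_S L 0), lsum_0. simpl. ring.
- rewrite sum1_S, IH. rewrite (lsum_S L (S n)). replace (n + 1)%nat with (S n) by lia.
  replace (lsum L (S n)) with (lsum L n + frac L (S n)) at 2; [ring|].
  rewrite (lsum_pred L (S n)) by lia. f_equal. f_equal. lia.
Qed.

(** In each square one factor l_a + l_{a+1} is at most 2 eps, and the other factors add up to at
    most 2 since each fraction occurs at most twice. *)
Lemma exchange_dissipation_small C eps t x y : 0 <= C ->
  (forall a, (1 <= a <= nlay L)%nat -> frac L a < eps) ->
  (forall a, (1 <= a < nlay L)%nat ->
    ((layer_mean P L h u (a + 1) t x y - layer_mean P L h u a t x y) ^ 2
     + (layer_mean P L h v (a + 1) t x y - layer_mean P L h v a t x y) ^ 2) / 2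
      * Rabs (Gx L h (layer_mean P L h u) (layer_mean P L h v) a t x y)
    <= C * (frac L a + frac L (a + 1)) ^ 2) ->
  0 <= exchange_dissipation L h (layer_mean P L h u) (layer_mean P L h v) t x y <= 4 * C * eps.
Proof.
intros HC Heps HB. unfold exchange_dissipation.
assert (HN : (1 <= nlay L)%nat) by apply HL.
assert (Hfr : forall a, (1 <= a <= nlay L)%nat -> 0 < frac L a) by apply HL.
assert (He : 0 < eps)
  by (apply Rlt_trans with (frac L 1); [apply Hfr; lia | apply Heps; lia]).
split.
- replace 0 with (sum_n_m (fun _ => 0) 1 (nlay L - 1)).
  + apply sum1_le. intros a _. apply Rmult_le_pos; [|apply Rabs_pos].
    assert (Q := pow2_ge_0). apply Rmult_le_pos; [|lra]. apply Rplus_le_le_0_compat; apply Q.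
  + etransitivity; [|exact (Rmult_0_l (sum_n_m (fun _ => 0) 1 (nlay L - 1)))].
    rewrite <- sum1_scal. apply sum1_ext. intros a _. exact (eq_sym (Rmult_0_l 0)).
- apply Rle_trans with (2 * C * eps * sum_n_m (fun a => frac L a + frac L (a + 1)) 1 (nlay L - 1)).
  + rewrite <- sum1_scal. apply sum1_le. intros a Ha.
    apply Rle_trans with (1 := HB a ltac:(lia)).
    assert (F1 := Hfr a ltac:(lia)). assert (F2 := Hfr (a + 1)%nat ltac:(lia)).
    assert (E1 := Heps a ltac:(lia)). assert (E2 := Heps (a + 1)%nat ltac:(lia)).
    replace (2 * C * eps * (frac L a + frac L (a + 1)))
      with (C * (2 * eps * (frac L a + frac L (a + 1)))) by ring.
    apply Rmult_le_compat_l; [exact HC|]. simpl. rewrite Rmult_1_r.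
    apply Rmult_le_compat_r; lra.
  + rewrite sum_frac_pairs. replace (nlay L - 1 + 1)%nat with (nlay L) by lia.
    rewrite lsum_N by exact HL.
    assert (S1 := lsum_01 L (nlay L - 1) HL ltac:(lia)).
    assert (F1 := Hfr 1%nat ltac:(lia)).
    replace (4 * C * eps) with (2 * C * eps * 2) by ring.
    apply Rmult_le_compat_l; [|lra].
    apply Rmult_le_pos; lra.
Qed.

End LayerMeans.

Lemma exchange_dissipation_limit : exchange_dissipation_vanishes P Omega h u v.
Proof.
intros Ls HLs Href t x y H.
assert (Hh := Hpos t x y H).
destruct (vsmooth_lipschitz u t x y Hu H) as [Lu [Lu0 HLu]].
destruct (vsmooth_lipschitz v t x y Hv H) as [Lv [Lv0 HLv]].
destruct (vsmooth_bounded u t x y Hu H) as [Mu [Mu0 HMu]].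
destruct (vsmooth_bounded v t x y Hv H) as [Mv [Mv0 HMv]].
destruct (vsmooth_bounded w t x y Hw H) as [Mw [Mw0 HMw]].
(* Bounds the derivatives of every interface of every layering, because [lsum] lies in [0, 1]; thus
   [B] and [C] do not depend on n. *)
set (S := fun i => Rabs (pd i (bottom P) t x y) + Rabs (pd i h t x y)).
assert (S0 : forall i, 0 <= S i)
  by (intros i; apply Rplus_le_le_0_compat; apply Rabs_pos).
set (B := S Dirt + Mu * S Dirx + Mv * S Diry + Mw).
assert (B0 : 0 <= B).
{ unfold B. assert (P1 := Rmult_le_pos _ _ Mu0 (S0 Dirx)).
  assert (P2 := Rmult_le_pos _ _ Mv0 (S0 Diry)). assert (P3 := S0 Dirt). lra. }
assert (HB : forall L a, valid_layering L -> (a <= nlay L)%nat ->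
  Rabs (flux_through (zi P L h a) t x y) <= B).
{ intros L a HL Ha.
  assert (Z := zi_column P L h a t x y HL Hh Ha).
  assert (HS : forall i, Rabs (pd i (zi P L h a) t x y) <= S i).
  { intros i. rewrite pd_zi by (try apply expd_zb; try apply hsmooth_expd with Omega; assumption).
    apply Rle_trans with (1 := Rabs_triang _ _). apply Rplus_le_compat_l.
    rewrite Rabs_mult. assert (l := lsum_01 L a HL Ha).
    rewrite <- (Rmult_1_l (Rabs (pd i h t x y))) at 2.
    apply Rmult_le_compat_r; [apply Rabs_pos|]. apply Rabs_le. lra. }
  assert (A0 := HS Dirt). cbn [pd] in A0.
  assert (A1 : Rabs (u t x y (zi P L h a t x y) * dx (zi P L h a) t x y) <= Mu * S Dirx).
  { rewrite Rabs_mult. apply Rmult_le_compat; auto using Rabs_pos. apply (HS Dirx). }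
  assert (A2 : Rabs (v t x y (zi P L h a t x y) * dy (zi P L h a) t x y) <= Mv * S Diry).
  { rewrite Rabs_mult. apply Rmult_le_compat; auto using Rabs_pos. apply (HS Diry). }
  assert (A3 := HMw _ Z).
  apply Rabs_le_between in A0. apply Rabs_le_between in A1. apply Rabs_le_between in A2.
  apply Rabs_le_between in A3.
  unfold flux_through, B. apply Rabs_le. lra. }
set (C := ((Lu * h t x y) ^ 2 + (Lv * h t x y) ^ 2) / 2 * B).
assert (C0 : 0 <= C).
{ unfold C. apply Rmult_le_pos; [|exact B0].
  assert (Q := pow2_ge_0). assert (Q1 := Q (Lu * h t x y)). assert (Q2 := Q (Lv * h t x y)). lra. }
apply is_lim_seq_spec. intros [eps He]. simpl.
(* The added 1 keeps the denominator positive when C = 0. *)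
assert (He' : 0 < eps / (4 * C + 1)) by (apply Rdiv_lt_0_compat; lra).
destruct (Href _ He') as [n0 Hn0]. exists n0. intros n Hn.
assert (Sm := exchange_dissipation_small (Ls n) (HLs n) C _ t x y C0 (Hn0 n Hn)).
destruct Sm as [Sm0 Sm1].
- intros a Ha.
  assert (Ju := layer_mean_jump (Ls n) (HLs n) u Lu a t x y Hu H Ha Lu0 HLu).
  assert (Jv := layer_mean_jump (Ls n) (HLs n) v Lv a t x y Hv H Ha Lv0 HLv).
  rewrite Gx_exact by (auto; lia).
  assert (G := HB (Ls n) a (HLs n) ltac:(lia)).
  replace (C * _) with (((Lu * h t x y) ^ 2 * (frac (Ls n) a + frac (Ls n) (a + 1)) ^ 2
    + (Lv * h t x y) ^ 2 * (frac (Ls n) a + frac (Ls n) (a + 1)) ^ 2) / 2 * B)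
    by (unfold C; field).
  apply Rmult_le_compat; [|apply Rabs_pos| |exact G].
  + assert (Q := pow2_ge_0). apply Rmult_le_pos; [|lra]. apply Rplus_le_le_0_compat; apply Q.
  + lra.
- rewrite Rminus_0_r, Rabs_right by lra.
  apply Rle_lt_trans with (1 := Sm1).
  apply Rmult_lt_reg_r with (4 * C + 1); [lra|].
  replace (4 * C * (eps / (4 * C + 1)) * (4 * C + 1)) with (4 * C * eps) by (field; lra).
  assert (0 <= C * eps) by (apply Rmult_le_pos; lra). lra.
Qed.

End Continuous.

Theorem proposition3p4 (P : params) (Omega : R * R * R -> Prop) (L : layering) (h : hfield)
  (HOmega : open Omega)
  (HP : valid_params P Omega)
  (HL : valid_layering L)
  (Hsmooth : hsmooth Omega h)
  (Hpos : forall t x y, Omega (t, x, y) -> 0 < h t x y) :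
  (* the layer-integrated balances and the energy balance of the continuous system *)
  (forall u v w p : vfield,
     smooth_flow P Omega h u v w p ->
     hydrostatic_NS P Omega h u v w p ->
     let X := exact_exchanges P L h u v w in
     (forall t x y z, fluid P Omega h t x y z ->
        p t x y z = hydrostatic_pressure P h t x y z /\
        w t x y z = vertical_velocity P u v t x y z) /\
     layer_balance P Omega L h u v p X /\
     (forall t x y, Omega (t, x, y) ->
        exG X 0%nat t x y = 0 /\
        exG X (nlay L) t x y = 0 /\
        exTx X 0%nat t x y = kappa P * u t x y (zb P x y) /\
        exTy X 0%nat t x y = kappa P * v t x y (zb P x y) /\
        exTx X (nlay L) t x y = metric (eta P h) t x y * wind P t x y * tsx P t x y /\
        exTy X (nlay L) t x y = metric (eta P h) t x y * wind P t x y * tsy P t x y) /\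
     continuous_energy_balance P Omega h u v /\
     exchange_dissipation_vanishes P Omega h u v) /\
  (* the layer-averaged system, its vertical velocities and its energy balance *)
  (forall us vs : nat -> hfield,
     (forall a, (1 <= a <= nlay L)%nat -> hsmooth Omega (us a) /\ hsmooth Omega (vs a)) ->
     (layer_averaged_NS P Omega L h us vs <-> layer_averaged_system P Omega L h us vs) /\
     (forall t x y, Omega (t, x, y) -> forall a, (1 <= a <= nlay L)%nat ->
        wl P L h us vs a t x y
        = layer_mean P L h (vertical_velocity P (pw P L h us) (pw P L h vs)) a t x y) /\
     energy_terms_discretised P Omega L h us vs /\
     (layer_averaged_system P Omega L h us vs ->
        (forall t x y, Omega (t, x, y) -> forall a, (a <= nlay L)%nat ->
           Gx L h us vs a t x y = Gx_closed L h us vs a t x y) /\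
        layered_energy_balance P Omega L h us vs)).
Proof.
assert (Hbot : hsmooth Omega (bottom P)) by apply HP.
assert (Hrho : rho0 P <> 0) by (apply Rgt_not_eq, HP).
split.
- intros u v w p [O [HO [HFO [Hu [Hv [Hw Hp]]]]]] HNS X.
  (* The open set of [smooth_flow] may project outside [Omega], where [h] and [bottom] carry no
     regularity; intersecting with the cylinder over [Omega] makes every field smooth on [D]. *)
  set (D := fun q : R * R * R * R => O q /\ Omega (fst q)).
  assert (HD : open D).
  { apply open_and; [exact HO|]. apply open_comp; [|exact HOmega].
    intros [q z] _. apply continuous_fst. }
  assert (HDO : forall q, D q -> Omega (fst q)) by (intros q [_ Hq]; exact Hq).
  assert (HDF : forall t x y z, fluid P Omega h t x y z -> D (t, x, y, z)).
  { intros t x y z HF. split; [apply HFO, HF | apply HF]. }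
  assert (Sub : forall f, vsmooth O f -> vsmooth D f)
    by (intros f; apply vsmooth_subset; intros q [Hq _]; exact Hq).
  apply Sub in Hu, Hv, Hw, Hp.
  split; [|split; [|split; [|split]]].
  + intros t x y z HF. split.
    * apply (pressure_hydrostatic P Omega h u v w p HNS D); assumption.
    * apply (w_vertical_velocity P Omega h HP u v w p HNS D); assumption.
  + apply (layer_balance_exact P Omega h HP Hsmooth Hpos u v w p HNS D); assumption.
  + intros t x y. apply (exact_exchanges_boundary P Omega h Hpos u v w p HNS D); assumption.
  + apply (energy_balance_continuous P Omega h HOmega HP Hsmooth Hpos u v w p HNS D); assumption.
  + apply (exchange_dissipation_limit P Omega h HOmega HP Hsmooth Hpos u v w p HNS D); assumption.
- intros us vs Hsm.
  assert (Hus : layers_smooth Omega L us) by (intros a Ha; apply (Hsm a Ha)).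
  assert (Hvs : layers_smooth Omega L vs) by (intros a Ha; apply (Hsm a Ha)).
  split; [|split; [|split]].
  + apply layer_averaged_equiv; assumption.
  + intros t x y H a Ha. apply (wl_layer_mean P Omega); assumption.
  + apply energy_discretised; assumption.
  + intros HS. split.
    * intros t x y H a Ha. apply Gx_closed_eq; auto. apply HS, H.
    * apply energy_balance_layered; assumption.
Qed.
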